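(* Assume the standing hypotheses on the continuous problem, on the space discretization and on the Runge–Kutta coefficients listed in the context. Assume also that $f(t,u(t))\in D(A)$ for every $t\in[0,T]$ and $$Af(\cdot,u(\cdot))\in C([0,T],X),\qquad u\in C([0,T],D(A^2))\cap C^2([0,T],X).$$ Then the local error of the time semidiscretization defined in the context satisfies $\rho_n=O(k^2)$. Moreover, if $f\in C^2([0,T]\times X,X)$, $u\in C^3([0,T],X)$, there exists a constant $C$ such that $$\|A_0^{-1}f_u(t,u(t))A_0w\|\le C\|w\|\quad\text{for every } w\in D(A_0)\text{ and } t\in[0,T],$$ and the Runge–Kutta tableau corresponds to a method of classical order $\ge2$, then $A_0^{-1}\rho_n=O(k^3)$.
   Context: **Continuous problem.** $\Omega\subset\mathbb R^d$ is a bounded domain, $X=C(\overline\Omega)$ with the maximum norm, $Y$ is a Banach space, $A:D(A)\subset X\to X$ and $\partial:D(A)\to Y$ are linear. $u$ is the solution of $u'(t)=Au(t)+f(t,u(t))$, $0\le t\le T$, $u(0)=u_0\in X$, $\partial u(t)=g(t)\in Y$, with $f:[0,T]\times X\to X$ (in general nonlinear) and $g:[0,T]\to Y$. $f_t,f_u$ denote partial (Fréchet) derivatives. *Standing hypotheses on the continuous problem:* (i) $\partial:D(A)\to Y$ is onto and $g\in C^1([0,T],Y)$. (ii) $\ker\partial$ is dense in $X$ and $A_0$, the restriction of $A$ to $D(A_0)=\ker\partial$, generates a $C_0$-semigroup $\{e^{tA_0}\}_{t\ge0}$ on $X$ of negative type $\omega$. (iii) For $\Re z>0$ and $v\in Y$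 the problem $Ax=zx$, $\partial x=v$ has a unique solution $x=K(z)v$, and $\|K(z)v\|\le C\|v\|$ with $C$ uniform for $\Re z\ge\omega_0>\omega$. (iv) $f\in C^1([0,T]\times X,X)$. (v) $u\in C^1([0,T],X)$, $u(t)\in D(A)$ for all $t\in[0,T]$, $Au\in C([0,T],X)$. **Space discretization** (part of the standing setting). For a mesh parameter $h$, $\Omega_h$ is a grid with $N$ nodes; $\|\cdot\|_h$ is the maximum norm on $\mathbb C^N$ (and induced operator norms); $P_h:X\to\mathbb C^N$ maps a function to its grid values; $A_{h,0}$ is an $N\times N$ matrix (discretizing $A_0$) and $C_h:Y\to\mathbb C^N$ is linear, so that $A$ acting on functions with $\partial u=g$ is discretized by $A_{h,0}U_h+C_hg$. The function $f$ also makes sense as a map $[0,T]\times\mathbb C^N\to\mathbb C^N$ and $P_hf(t,u)=f(t,P_hu)$. *Standing hypotheses on the discretization:* (a) $\|e^{tA_{h,0}}\|_h\le1$ for $t\ge0$; $A_{h,0}$ is invertible and $\|A_{h,0}^{-1}\|_h\le C$ with $C$ independent of $h$. (b) Let $R_h:D(A)\to\mathbb C^N$ be defined by $A_{h,0}R_hu+C_h\partial u=P_hAu$. There is a subspace $Z\subset D(A)$ with norm $\|\cdot\|_Z$ such that for $u\in Z$: $A_0^{-1}u\in Z$ and $e^{tA_0}u,f(t,u)\in Z$ for $t\in[0,T]$; $\|A_{h,0}(P_hu-R_hu)\|_h\le\varepsilon_h\|u\|_Z$ and $\|P_hu-R_hu\|_h\le\eta_h\|u\|_Z$, with $\varepsilon_h,\eta_h$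 small with $h$. Moreover $\|A_{h,0}^{-1}C_h\|_h\le C''$ with $C''$ independent of $h$. (c) $f\in C^1([0,T]\times\mathbb C^N,\mathbb C^N)$ with derivative in the $\mathbb C^N$ variable uniformly bounded in a neighbourhood of the solution where the numerical approximation stays. **Runge–Kutta coefficients.** $a_{ij}$ ($j<i$), $b_i$, $c_i$ ($1\le i\le s$) form an explicit Runge–Kutta tableau with $\sum_{i=1}^sb_i=1$, $\sum_{j=1}^{i-1}a_{ij}=c_i$; $0\le c_i\le1$ and $c_j\le c_i$ whenever $a_{ij}\neq0$. $k>0$ is the stepsize, $t_n=nk$, $t_{n+1}\le T$. **Solutions of linear problems.** For $v_0\in X$ and $\psi\in C^1([0,S],X)$ with $\psi(s)\in D(A)$, $A\psi\in C([0,S],X)$, the solution of $\dot v(s)=Av(s)$, $v(0)=v_0$, $\partial v(s)=\partial\psi(s)$ is understood as $v(s)=\psi(s)+e^{sA_0}(v_0-\psi(0))+\int_0^se^{(s-\tau)A_0}(A\psi(\tau)-\dot\psi(\tau))\,d\tau$. **Time semidiscretization and its local error (one step from $u(t_n)$).** For $i=1,\dots,s$, $$\bar K_{n,i}=\bar v_n(c_ik)+k\sum_{j=1}^{i-1}a_{ij}\bar w_{n,j}((c_i-c_j)k),\qquad \bar u_{n+1}=\bar{\tilde v}_n(k)+k\sum_{i=1}^sb_i\bar{\tilde w}_{n,i}((1-c_i)k),$$ where all four functions satisfy $\dot y(s)=Ay(s)$ with - $\bar v_n(0)=u(t_n)$, $\partial\bar v_n(s)=\partial u(t_n)$; - $\bar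 w_{n,j}(0)=f(t_n+c_jk,\bar K_{n,j})$, $\partial\bar w_{n,j}(s)=0$; - $\bar{\tilde v}_n(0)=u(t_n)$, $\partial\bar{\tilde v}_n(s)=\partial[u(t_n)+sAu(t_n)]$; - $\bar{\tilde w}_{n,j}(0)=f(t_n+c_jk,\bar K_{n,j})$, $\partial\bar{\tilde w}_{n,j}(s)=\partial f(t_n,u(t_n))$. The local error is $\rho_{n+1}=\bar u_{n+1}-u(t_{n+1})$. $O(\cdot)$ bounds are in the norm of $X$, uniform in $n$ and $k$. $D(A^l)$ carries the graph norm. *)

(* Defs.v *)
From mathcomp Require Import ssreflect ssrfun ssrbool eqtype seq fintype bigop.
From Stdlib Require Import Reals Factorial Lra Lia Classical ClassicalEpsilon
  FunctionalExtensionality PropExtensionality ProofIrrelevance.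
From Coquelicot Require Import Coquelicot.
Open Scope R_scope.

(** Finite powers [V^n] with the maximum norm (used for R^d, R^m and C^N). *)

Section FinPower.
Variables (K : AbsRing) (n : nat) (V : NormedModule K).

Definition fin_plus (x y : 'I_n -> V) : 'I_n -> V := fun i => plus (x i) (y i).
Definition fin_opp (x : 'I_n -> V) : 'I_n -> V := fun i => opp (x i).
Definition fin_zero : 'I_n -> V := fun _ => zero.
Definition fin_scal (a : K) (x : 'I_n -> V) : 'I_n -> V := fun i => scal a (x i).

Definition fin_AbelianMonoid_mixin : AbelianMonoid.mixin_of ('I_n -> V).
Proof.
apply: (AbelianMonoid.Mixin _ fin_plus fin_zero).
- by move=> x y; apply: functional_extensionality => i; apply: plus_comm.
- by move=> x y z; apply: functional_extensionality => i; apply: plus_assoc.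
- by move=> x; apply: functional_extensionality => i; apply: plus_zero_r.
Defined.

Definition fin_AbelianMonoid := AbelianMonoid.Pack _ fin_AbelianMonoid_mixin ('I_n -> V).

Definition fin_AbelianGroup_mixin : AbelianGroup.mixin_of fin_AbelianMonoid.
Proof.
apply: (AbelianGroup.Mixin fin_AbelianMonoid fin_opp).
by move=> x; apply: functional_extensionality => i; apply: plus_opp_r.
Defined.

Definition fin_AbelianGroup :=
  AbelianGroup.Pack _ (AbelianGroup.Class _ _ fin_AbelianGroup_mixin) ('I_n -> V).

Definition fin_ModuleSpace_mixin : ModuleSpace.mixin_of K fin_AbelianGroup.
Proof.
apply: (ModuleSpace.Mixin K fin_AbelianGroup fin_scal).
- by move=> a b x; apply: functional_extensionality => i; apply: scal_assoc.
- by move=> x; apply: functional_extensionality => i; apply: scal_one.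
- by move=> a x y; apply: functional_extensionality => i; apply: scal_distr_l.
- by move=> a b x; apply: functional_extensionality => i; apply: scal_distr_r.
Defined.

Definition fin_ModuleSpace_class :=
  ModuleSpace.Class K _ (AbelianGroup.class fin_AbelianGroup) fin_ModuleSpace_mixin.

Definition fin_norm (x : 'I_n -> V) : R := \big[Rmax/0]_(i < n) norm (x i).

Lemma fin_norm_ge0 x : 0 <= fin_norm x.
Proof.
rewrite /fin_norm.
elim/big_ind: _ => [|a b Ha Hb|i _]; [exact: Rle_refl | | exact: norm_ge_0].
exact: Rle_trans Ha (Rmax_l _ _).
Qed.

Lemma fin_norm_ub x i : norm (x i) <= fin_norm x.
Proof.
rewrite /fin_norm; have := mem_index_enum i.
elim: (index_enum _) => [|j l IH] //.
rewrite big_cons in_cons => /orP[/eqP <-|/IH H]; first exact: Rmax_l.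
exact: Rle_trans H (Rmax_r _ _).
Qed.

Lemma fin_norm_le x M : 0 <= M -> (forall i, norm (x i) <= M) -> fin_norm x <= M.
Proof.
move=> HM Hx; rewrite /fin_norm.
by elim/big_ind: _ => // a b Ha Hb; apply: Rmax_lub.
Qed.

Definition fin_ball (x : 'I_n -> V) (e : R) (y : 'I_n -> V) : Prop :=
  fin_norm (fin_plus y (fin_opp x)) < e.

Lemma fin_norm_triangle x y : fin_norm (fin_plus x y) <= fin_norm x + fin_norm y.
Proof.
apply: fin_norm_le => [|i].
  by have := fin_norm_ge0 x; have := fin_norm_ge0 y; lra.
apply: Rle_trans (norm_triangle _ _) _.
by have := fin_norm_ub x i; have := fin_norm_ub y i; lra.
Qed.

Definition fin_UniformSpace_mixin : UniformSpace.mixin_of ('I_n -> V).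
Proof.
apply: (UniformSpace.Mixin _ fin_zero fin_ball).
- move=> x e; apply: Rle_lt_trans (cond_pos e).
  apply: fin_norm_le => [|i]; first exact: Rle_refl.
  by rewrite /fin_plus /fin_opp plus_opp_r norm_zero; apply: Rle_refl.
- move=> x y e; apply: Rle_lt_trans.
  apply: fin_norm_le => [|i]; first exact: fin_norm_ge0.
  have := fin_norm_ub (fin_plus y (fin_opp x)) i.
  by rewrite /fin_plus /fin_opp -norm_opp opp_plus opp_opp plus_comm.
- move=> x y z e1 e2 H1 H2; apply: Rle_lt_trans (Rplus_lt_compat _ _ _ _ H1 H2).
  rewrite Rplus_comm; apply: Rle_trans (fin_norm_triangle _ _).
  apply: Req_le; congr fin_norm; apply: functional_extensionality => i.
  rewrite /fin_plus /fin_opp -plus_assoc; congr plus.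
  by rewrite plus_assoc plus_opp_l plus_zero_l.
Defined.

Definition fin_NormedModuleAux :=
  NormedModuleAux.Pack K ('I_n -> V)
    (NormedModuleAux.Class K _ fin_ModuleSpace_class fin_UniformSpace_mixin) ('I_n -> V).

Definition fin_NormedModule_mixin : NormedModule.mixin_of K fin_NormedModuleAux.
Proof.
apply: (NormedModule.Mixin K fin_NormedModuleAux fin_norm 1).
- exact: fin_norm_triangle.
- move=> a x; apply: fin_norm_le => [|i].
    by apply: Rmult_le_pos; [apply: abs_ge_0 | apply: fin_norm_ge0].
  apply: Rle_trans (norm_scal _ _) _.
  by apply: Rmult_le_compat_l; [apply: abs_ge_0 | apply: fin_norm_ub].
- by [].
- by move=> x y e; rewrite Rmult_1_l.
- move=> x Hx; apply: functional_extensionality => i; apply: norm_eq_zero.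
  by apply: Rle_antisym; [rewrite -Hx; apply: fin_norm_ub | apply: norm_ge_0].
Defined.

Definition fin_NormedModule : NormedModule K :=
  NormedModule.Pack K ('I_n -> V)
    (NormedModule.Class K _ _ fin_NormedModule_mixin) ('I_n -> V).

End FinPower.

Definition Rn (d : nat) : NormedModule R_AbsRing := fin_NormedModule R_AbsRing d R_NormedModule.
Definition Cn (N : nat) : NormedModule C_AbsRing := fin_NormedModule C_AbsRing N C_NormedModule.

(** Restriction of scalars: the same space, norm and topology over [R]. *)

Section RealPart.
Variable V : NormedModule C_AbsRing.

Definition re_ModuleSpace_mixin : ModuleSpace.mixin_of R_Ring V.
Proof.
apply: (ModuleSpace.Mixin R_Ring V (fun (r : R) (x : V) => scal (RtoC r : C_Ring) x)).
- by move=> r s x; rewrite scal_assoc; congr scal; rewrite /mult /= RtoC_mult.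
- by move=> x; apply: (scal_one x).
- by move=> r x y; apply: scal_distr_l.
- by move=> r s x; rewrite -scal_distr_r; congr scal; rewrite /plus /= RtoC_plus.
Defined.

Definition re_NormedModuleAux :=
  NormedModuleAux.Pack R_AbsRing V
    (NormedModuleAux.Class R_AbsRing V
      (ModuleSpace.Class R_Ring V (AbelianGroup.class V) re_ModuleSpace_mixin)
      (UniformSpace.class V)) V.

Definition re_NormedModule_mixin : NormedModule.mixin_of R_AbsRing re_NormedModuleAux.
Proof.
apply: (NormedModule.Mixin R_AbsRing re_NormedModuleAux
          (@norm _ V) (@norm_factor _ V)).
- exact: norm_triangle.
- move=> r x; apply: Rle_trans (norm_scal _ _) _.
  by apply: Req_le; congr Rmult; apply: Cmod_R.
- exact: norm_compat1.
- exact: norm_compat2.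
- exact: norm_eq_zero.
Defined.

Definition re_NormedModule : NormedModule R_AbsRing :=
  NormedModule.Pack R_AbsRing V
    (NormedModule.Class R_AbsRing V _ re_NormedModule_mixin) V.

End RealPart.

Definition re_Banach (V : CompleteNormedModule C_AbsRing) : CompleteNormedModule R_AbsRing :=
  CompleteNormedModule.Pack R_AbsRing V
    (CompleteNormedModule.Class R_AbsRing V
      (NormedModule.class R_AbsRing (re_NormedModule V))
      (CompleteNormedModule.mixin C_AbsRing V (CompleteNormedModule.class C_AbsRing V))) V.

Record bounded_domain (d : nat) := BoundedDomain {
  dom :> Rn d -> Prop;
  dom_nonempty : exists x, dom x;
  dom_open : open dom;
  dom_connected : forall U V : Rn d -> Prop, open U -> open V ->
    (forall x, dom x -> U x \/ V x) ->
    (exists x, dom x /\ U x) -> (exists x, dom x /\ V x) ->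
    exists x, dom x /\ U x /\ V x;
  dom_bounded : exists M, forall x, dom x -> norm x <= M
}.

Definition closure {d} (D : Rn d -> Prop) (x : Rn d) : Prop :=
  forall e : posreal, exists y, D y /\ ball x e y.

Section ContinuousFunctions.
Variables (d : nat) (Omega : bounded_domain d).

Definition cl_dom : Type := {x : Rn d | closure Omega x}.

Record contfun := Contfun {
  cfun :> cl_dom -> C;
  cfun_cont : forall (x : cl_dom) (e : posreal), exists r : posreal, forall y : cl_dom,
    ball (sval x) r (sval y) -> Cmod (Cminus (cfun y) (cfun x)) < e
}.

Lemma contfun_eq (f g : contfun) : (forall x, f x = g x) -> f = g.
Proof.
case: f g => f Hf [g Hg] /= H.
have E : f = g by apply: functional_extensionality.
by subst g; rewrite (proof_irrelevance _ Hf Hg).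
Qed.

Lemma cl_dom_inhabited : inhabited cl_dom.
Proof.
case: (dom_nonempty _ Omega) => x Hx; constructor; exists x => e.
by exists x; split=> //; apply: ball_center.
Qed.

Fixpoint to_Tn (n : nat) (x : nat -> R) : Compactness.Tn n R :=
  match n with
  | O => tt
  | S m => (x O, to_Tn m (fun i => x (S i)))
  end.

Fixpoint of_Tn (n : nat) : Compactness.Tn n R -> nat -> R :=
  match n with
  | O => fun _ _ => 0
  | S m => fun t i => match i with O => fst t | S j => of_Tn m (snd t) j end
  end.

Lemma bounded_n_to_Tn n M x : (forall i, - M <= x i <= M) ->
  bounded_n n (to_Tn n (fun _ => - M)) (to_Tn n (fun _ => M)) (to_Tn n x).
Proof. by elim: n x => [|n IH] x H //=; split; [apply: H | apply: IH]. Qed.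

Lemma close_n_to_Tn n e x t i : close_n n e (to_Tn n x) t -> (i < n)%nat ->
  Rabs (x i - of_Tn n t i) < e.
Proof.
elim: n x t i => [|n IH] x; first by move=> t i _ Hi; lia.
move=> [t1 t2] [|i] /=; first by case.
by move=> [_ H] Hi; apply: (IH (fun i => x (S i))) => //; lia.
Qed.

Definition extend (x : Rn d) (i : nat) : R :=
  match insub i with Some j => x j | None => 0 end.

Lemma extend_ord x (i : 'I_d) : extend x i = x i.
Proof. by rewrite /extend valK. Qed.

Lemma contfun_bounded (f : contfun) : exists M, forall x, Cmod (f x) <= M.
Proof.
case: (dom_bounded _ Omega) => M0 HM0.
pose M := M0 + 1.
have HM (x : Rn d) : closure Omega x -> norm x <= M.
  move=> /(_ (mkposreal 1 Rlt_0_1)) [y [/HM0 Hy Hb]].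
  have Hb' : norm (minus x y) < 1 by apply: (ball_sym _ _ _ Hb).
  have := norm_triangle (minus x y) y.
  have -> : plus (minus x y) y = x.
    by rewrite /minus -plus_assoc plus_opp_l plus_zero_r.
  move=> H; rewrite /M; apply: Rle_trans H _.
  by rewrite Rplus_comm; apply: Rplus_le_compat Hy _; apply: Rlt_le.
pose toR (t : Compactness.Tn d R) : Rn d := fun i : 'I_d => of_Tn d t i.
have Hd (t : Compactness.Tn d R) : exists r : posreal, exists B : R,
    forall x : cl_dom, ball (toR t) r (sval x) -> Cmod (f x) <= B.
  case: (classic (closure Omega (toR t))) => Ht.
    pose p : cl_dom := exist _ _ Ht.
    have [r Hr] := cfun_cont f p (mkposreal 1 Rlt_0_1).
    exists r, (1 + Cmod (f p)) => x /Hr Hx.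
    have -> : f x = Cplus (Cminus (f x) (f p)) (f p) by ring.
    apply: Rle_trans (Cmod_triangle _ _) _.
    by apply: Rplus_le_compat_r; apply: Rlt_le.
  have [e He] := not_all_ex_not _ _ Ht.
  exists (pos_div_2 e), 0 => x Hx; exfalso; apply: He.
  have [y [Hy1 Hy2]] := proj2_sig x (pos_div_2 e).
  exists y; split=> //; rewrite -(Rplus_half_diag (pos e)); exact: ball_triangle Hx Hy2.
pose rad t := proj1_sig (constructive_indefinite_description _ (Hd t)).
have Hrad t : exists B : R, forall x : cl_dom, ball (toR t) (rad t) (sval x) -> Cmod (f x) <= B
  := proj2_sig (constructive_indefinite_description _ (Hd t)).
apply: NNPP => Hn.
apply: (compactness_list d (to_Tn d (fun _ => - M)) (to_Tn d (fun _ => M)) rad) => [[l Hl]].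
apply: Hn.
have [B HB] : exists B, forall t, List.In t l -> forall x : cl_dom,
    ball (toR t) (rad t) (sval x) -> Cmod (f x) <= B.
  elim: l {Hl} => [|t l [B HB]]; first by exists 0.
  have [B' HB'] := Hrad t.
  exists (Rmax B B') => t' [<- x /HB'|/HB H x /H] H'.
    exact: Rle_trans H' (Rmax_r _ _).
  exact: Rle_trans H' (Rmax_l _ _).
exists B => x.
have Hx : forall i, - M <= extend (sval x) i <= M.
  move=> i; have HMx := HM _ (proj2_sig x); rewrite /extend.
  case: insubP => [j _ _|_].
    have := fin_norm_ub _ _ _ (sval x) j => Hj.
    by apply Rabs_le_between; exact: Rle_trans Hj HMx.
  by have := norm_ge_0 (sval x); lra.
have [t [Ht [_ Hc]]] := Hl _ (bounded_n_to_Tn d M _ Hx).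
apply: (HB _ Ht).
rewrite /ball /= /fin_ball.
case: (rad t) Hc => r Hr /= Hc.
have Hi (i : 'I_d) : Rabs (sval x i - toR t i) < r.
  rewrite -extend_ord; apply: close_n_to_Tn Hc _.
  by apply/ssrnat.ltP; apply: ltn_ord.
rewrite /fin_norm; elim/big_ind: _ => //; first by move=> *; apply: Rmax_lub_lt.
by move=> i _; apply: Hi.
Qed.

(** The maximum norm, written as a supremum (attained, the closure being compact). *)
Definition cf_norm (f : contfun) : R :=
  real (Lub_Rbar (fun r => exists x, r = Cmod (f x))).

Lemma cf_norm_lub (f : contfun) :
  is_lub_Rbar (fun r => exists x, r = Cmod (f x)) (cf_norm f).
Proof.
have H := Lub_Rbar_correct (fun r => exists x, r = Cmod (f x)).
rewrite /cf_norm; have [M HM] := contfun_bounded f.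
have [x0] := cl_dom_inhabited.
case: (Lub_Rbar _) H => [r||] //= [H1 H2].
- by case: (H2 (Finite M)) => r [x ->]; apply: HM.
- by case: (H1 (Cmod (f x0))); exists x0.
Qed.

Lemma cf_norm_ub (f : contfun) x : Cmod (f x) <= cf_norm f.
Proof. by have [H _] := cf_norm_lub f; apply: (H (Cmod (f x))); exists x. Qed.

Lemma cf_norm_le (f : contfun) M : (forall x, Cmod (f x) <= M) -> cf_norm f <= M.
Proof. by have [_ H] := cf_norm_lub f; move=> HM; apply: (H (Finite M)) => r [x ->]; apply: HM. Qed.

Lemma cf_norm_ge0 (f : contfun) : 0 <= cf_norm f.
Proof. by have [x] := cl_dom_inhabited; apply: Rle_trans (cf_norm_ub f x); apply: Cmod_ge_0. Qed.

Definition cf_zero : contfun.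
Proof.
exists (fun _ => RtoC 0) => x e; exists e => y _.
by rewrite /Cminus Cplus_opp_r Cmod_0; apply: cond_pos.
Defined.

Definition cf_plus (f g : contfun) : contfun.
Proof.
exists (fun x => Cplus (f x) (g x)) => x e.
have [r Hr] := cfun_cont f x (pos_div_2 e); have [s Hs] := cfun_cont g x (pos_div_2 e).
have Hm : 0 < Rmin r s by apply: Rmin_pos; apply: cond_pos.
exists (mkposreal _ Hm) => y Hy.
have /Hr /= H1 := ball_le _ _ _ (Rmin_l r s) _ Hy.
have /Hs /= H2 := ball_le _ _ _ (Rmin_r r s) _ Hy.
have -> : Cminus (Cplus (f y) (g y)) (Cplus (f x) (g x)) =
  Cplus (Cminus (f y) (f x)) (Cminus (g y) (g x)) by ring.
by apply: Rle_lt_trans (Cmod_triangle _ _) _; lra.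
Defined.

Definition cf_scal (a : C) (f : contfun) : contfun.
Proof.
exists (fun x => Cmult a (f x)) => x e.
have Ha : 0 < Cmod a + 1 by have := Cmod_ge_0 a; lra.
have He : 0 < e / (Cmod a + 1) by apply: Rdiv_lt_0_compat => //; apply: cond_pos.
have [r Hr] := cfun_cont f x (mkposreal _ He).
exists r => y /Hr /= H.
have -> : Cminus (Cmult a (f y)) (Cmult a (f x)) = Cmult a (Cminus (f y) (f x)) by ring.
rewrite Cmod_mult; have H0 := Cmod_ge_0 (Cminus (f y) (f x)).
apply: (Rle_lt_trans _ ((Cmod a + 1) * Cmod (Cminus (f y) (f x)))); first by nra.
have -> : pos e = (Cmod a + 1) * (e / (Cmod a + 1)) by field; lra.
exact: Rmult_lt_compat_l.
Defined.

Definition cf_opp (f : contfun) : contfun := cf_scal (RtoC (-1)) f.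

Definition cf_AbelianMonoid_mixin : AbelianMonoid.mixin_of contfun.
Proof.
apply: (AbelianMonoid.Mixin _ cf_plus cf_zero).
- by move=> f g; apply: contfun_eq => x /=; ring.
- by move=> f g h; apply: contfun_eq => x /=; ring.
- by move=> f; apply: contfun_eq => x /=; ring.
Defined.

Definition cf_AbelianMonoid := AbelianMonoid.Pack _ cf_AbelianMonoid_mixin contfun.

Definition cf_AbelianGroup_mixin : AbelianGroup.mixin_of cf_AbelianMonoid.
Proof.
apply: (AbelianGroup.Mixin cf_AbelianMonoid cf_opp).
by move=> f; apply: contfun_eq => x /=; ring.
Defined.

Definition cf_AbelianGroup :=
  AbelianGroup.Pack _ (AbelianGroup.Class _ _ cf_AbelianGroup_mixin) contfun.

Definition cf_ModuleSpace_mixin : ModuleSpace.mixin_of C_Ring cf_AbelianGroup.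
Proof.
apply: (ModuleSpace.Mixin C_Ring cf_AbelianGroup cf_scal).
- by move=> a b f; apply: contfun_eq => x; rewrite /= /mult /=; ring.
- by move=> f; apply: contfun_eq => x; rewrite /= /one /=; ring.
- by move=> a f g; apply: contfun_eq => x /=; ring.
- by move=> a b f; apply: contfun_eq => x; rewrite /= /plus /=; ring.
Defined.

Definition cf_dist (f g : contfun) : R := cf_norm (cf_plus g (cf_opp f)).
Definition cf_ball (f : contfun) (e : R) (g : contfun) : Prop := cf_dist f g < e.

Lemma cf_dist_ub (f g : contfun) x : Cmod (Cminus (g x) (f x)) <= cf_dist f g.
Proof.
have := cf_norm_ub (cf_plus g (cf_opp f)) x => /=.
by have -> : Cplus (g x) (Cmult (RtoC (-1)) (f x)) = Cminus (g x) (f x) by ring.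
Qed.

Lemma cf_dist_le (f g : contfun) M : (forall x, Cmod (Cminus (g x) (f x)) <= M) -> cf_dist f g <= M.
Proof.
move=> H; apply: cf_norm_le => x /=.
by have -> : Cplus (g x) (Cmult (RtoC (-1)) (f x)) = Cminus (g x) (f x) by ring.
Qed.

Definition cf_UniformSpace_mixin : UniformSpace.mixin_of contfun.
Proof.
apply: (UniformSpace.Mixin _ cf_zero cf_ball).
- move=> f e; apply: Rle_lt_trans (cond_pos e); apply: cf_dist_le => x.
  by rewrite /Cminus Cplus_opp_r Cmod_0; apply: Rle_refl.
- move=> f g e; apply: Rle_lt_trans; apply: cf_dist_le => x.
  rewrite -Cmod_opp; have -> : Copp (Cminus (f x) (g x)) = Cminus (g x) (f x) by ring.
  exact: cf_dist_ub.
- move=> f g h e1 e2 H1 H2; apply: Rle_lt_trans (Rplus_lt_compat _ _ _ _ H1 H2).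
  apply: cf_dist_le => x.
  have -> : Cminus (h x) (f x) = Cplus (Cminus (g x) (f x)) (Cminus (h x) (g x)) by ring.
  apply: Rle_trans (Cmod_triangle _ _) _.
  by apply: Rplus_le_compat; apply: cf_dist_ub.
Defined.

Definition cf_NormedModuleAux :=
  NormedModuleAux.Pack C_AbsRing contfun
    (NormedModuleAux.Class C_AbsRing contfun
      (ModuleSpace.Class C_Ring contfun (AbelianGroup.class cf_AbelianGroup)
         cf_ModuleSpace_mixin)
      cf_UniformSpace_mixin) contfun.

Definition cf_NormedModule_mixin : NormedModule.mixin_of C_AbsRing cf_NormedModuleAux.
Proof.
apply: (NormedModule.Mixin C_AbsRing cf_NormedModuleAux cf_norm 1).
- move=> f g; apply: cf_norm_le => x; apply: Rle_trans (Cmod_triangle _ _) _.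
  by apply: Rplus_le_compat; apply: cf_norm_ub.
- move=> a f; apply: cf_norm_le => x /=; rewrite Cmod_mult.
  by apply: Rmult_le_compat_l; [apply: Cmod_ge_0 | apply: cf_norm_ub].
- by [].
- by move=> f g e; rewrite Rmult_1_l.
- move=> f Hf; apply: contfun_eq => x; apply: Cmod_eq_0.
  by apply: Rle_antisym; [rewrite -Hf; apply: cf_norm_ub | apply: Cmod_ge_0].
Defined.

Definition cf_NormedModule : NormedModule C_AbsRing :=
  NormedModule.Pack C_AbsRing contfun
    (NormedModule.Class C_AbsRing contfun _ cf_NormedModule_mixin) contfun.

Lemma cf_complete (F : (contfun -> Prop) -> Prop) : ProperFilter F ->
  @cauchy cf_NormedModule F ->
  exists g : contfun, forall e : posreal, F (cf_ball g e).
Proof.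
move=> FF HF.
have Hc (e : posreal) : exists f, F (cf_ball f e) by apply: HF.
pose G x (P : C -> Prop) := F (fun f => P (f x)).
pose g x := C_complete_lim (G x).
have HG x : ProperFilter (G x).
  split.
    by move=> P /(filter_ex (F := F)) [f Hf]; exists (f x).
  split; first exact: filter_true.
    by move=> P Q H1 H2; apply: filter_and.
  by move=> P Q HPQ; apply: filter_imp => f; apply: HPQ.
have Hg x (e : posreal) : F (fun f => Cmod (Cminus (f x) (g x)) < e).
  have Hs : 0 < e / sqrt 2.
    apply: Rdiv_lt_0_compat; [exact: cond_pos | exact: Rlt_sqrt2_0].
  have Hcx : cauchy (T := C_UniformSpace) (G x).
    move=> e'; have [f Hf] := Hc e'; exists (f x); refine (filter_imp (F := F) _ _ _ Hf) => h Hh.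
    apply: C_NormedModule_mixin_compat1.
    exact (Rle_lt_trans _ _ _ (cf_dist_ub f h x) Hh).
  have := C_complete_ax1 (G x) (HG x) Hcx (mkposreal _ Hs).
  rewrite /G; apply: filter_imp => f Hf.
  have := C_NormedModule_mixin_compat2 _ _ _ Hf.
  have -> : sqrt 2 * (e / sqrt 2) = e.
    by field; apply: Rgt_not_eq; apply: Rlt_sqrt2_0.
  by [].
have Hu (e : posreal) : F (fun f => forall x, Cmod (Cminus (f x) (g x)) <= e).
  have [f0 Hf0] := Hc (pos_div_2 (pos_div_2 e)).
  apply: (filter_imp _ _ _ Hf0) => f Hf x.
  have [h [Hh1 Hh2]] := filter_ex _ (filter_and _ _ Hf0 (Hg x (pos_div_2 e))).
  have -> : Cminus (f x) (g x) = Cplus (Cplus (Cminus (f x) (f0 x))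
    (Copp (Cminus (h x) (f0 x)))) (Cminus (h x) (g x)) by ring.
  have H1 := Rle_lt_trans _ _ _ (cf_dist_ub f0 f x) Hf.
  have H2 := Rle_lt_trans _ _ _ (cf_dist_ub f0 h x) Hh1.
  have H3 := Cmod_triangle (Cplus (Cminus (f x) (f0 x)) (Copp (Cminus (h x) (f0 x))))
               (Cminus (h x) (g x)).
  have H4 := Cmod_triangle (Cminus (f x) (f0 x)) (Copp (Cminus (h x) (f0 x))).
  by move: H1 H2 H3 H4 Hh2; rewrite Cmod_opp /=; lra.
have Hgc (x : cl_dom) (e : posreal) : exists r : posreal, forall y : cl_dom,
    ball (sval x) r (sval y) -> Cmod (Cminus (g y) (g x)) < e.
  have He : 0 < e / 3 by have := cond_pos e; lra.
  have [f Hf] := filter_ex _ (Hu (mkposreal _ He)).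
  have [r Hr] := cfun_cont f x (mkposreal _ He).
  exists r => y /Hr /= H0.
  have -> : Cminus (g y) (g x) = Cplus (Cplus (Copp (Cminus (f y) (g y)))
    (Cminus (f y) (f x))) (Cminus (f x) (g x)) by ring.
  have H1 := Hf x; have H2 := Hf y.
  have H3 := Cmod_triangle (Cplus (Copp (Cminus (f y) (g y))) (Cminus (f y) (f x)))
               (Cminus (f x) (g x)).
  have H4 := Cmod_triangle (Copp (Cminus (f y) (g y))) (Cminus (f y) (f x)).
  by move: H0 H1 H2 H3 H4; rewrite Cmod_opp /=; lra.
exists (Contfun g Hgc) => e.
apply: filter_imp (Hu (pos_div_2 e)) => f Hf.
apply: (Rle_lt_trans _ (e / 2)); first exact: cf_dist_le.
by have := cond_pos e; lra.
Qed.

Definition cf_lim (F : (contfun -> Prop) -> Prop) : contfun :=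
  epsilon (inhabits cf_zero) (fun g => forall e : posreal, F (cf_ball g e)).

Definition cf_CompleteSpace_mixin : CompleteSpace.mixin_of cf_NormedModule.
Proof.
apply: (CompleteSpace.Mixin cf_NormedModule cf_lim).
- by move=> F FF HF; exact (epsilon_spec (inhabits cf_zero) _ (cf_complete F FF HF)).
- move=> F1 F2 H12 H21.
  have -> : F1 = F2.
    apply: functional_extensionality => P; apply: propositional_extensionality.
    by split; [apply: H21 | apply: H12].
  by move=> e; apply: ball_center.
Defined.

Definition CX : CompleteNormedModule C_AbsRing :=
  CompleteNormedModule.Pack C_AbsRing contfun
    (CompleteNormedModule.Class C_AbsRing contfun
      (NormedModule.class C_AbsRing cf_NormedModule) cf_CompleteSpace_mixin) contfun.

End ContinuousFunctions.

Arguments CX {d} Omega.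

(** Differentiability classes.  [diff_class D n w F] says that [F], a family of
    maps indexed by [P], is of class C^n on [D] in the sense of Frechet, all
    o(.) and continuity conditions being uniform in [p : P] relative to the
    weight [w p].  At the successor step the increment [h] of the derivative is
    added to the index with weight [norm h], so that the uniformity is that of
    the operator norm (of multilinear maps, for higher derivatives).
    Derivatives are relative to [D]: one-sided at the endpoints of an interval. *)

Fixpoint diff_class {U V : NormedModule R_AbsRing} (D : U -> Prop) (n : nat)
    {P : Type} (w : P -> R) (F : U -> P -> V) {struct n} : Prop :=
  match n with
  | O => forall x, D x -> forall eps, 0 < eps -> exists delta, 0 < delta /\
      forall y, D y -> norm (minus y x) < delta ->
      forall p, norm (minus (F y p) (F x p)) <= eps * w p
  | S m => exists dF : U -> U * P -> V,
      (forall x, D x ->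
         (forall p, is_linear (fun h => dF x (h, p))) /\
         exists M, forall h p, norm (dF x (h, p)) <= M * norm h * w p) /\
      (forall x, D x -> forall eps, 0 < eps -> exists delta, 0 < delta /\
         forall y, D y -> norm (minus y x) < delta -> forall p,
         norm (minus (minus (F y p) (F x p)) (dF x (minus y x, p)))
           <= eps * norm (minus y x) * w p) /\
      diff_class D m (fun q : U * P => norm (fst q) * w (snd q)) dF
  end.

Definition class_C {U V : NormedModule R_AbsRing} (n : nat) (D : U -> Prop) (f : U -> V) :=
  diff_class D n (fun _ : unit => 1) (fun x _ => f x).

Definition is_derive_on {V : NormedModule R_AbsRing} (D : R -> Prop) (u : R -> V) (t : R) (l : V) :=
  filterdiff u (within D (locally t)) (fun s : R => scal s l).

(** Stages are numbered from 1 to [rk_s]; only [rk_a i j] with [j < i] is used. *)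

Record tableau := Tableau {
  rk_s : nat;
  rk_a : nat -> nat -> R;
  rk_b : nat -> R;
  rk_c : nat -> R
}.

Record tableau_hyp (rk : tableau) : Prop := {
  rk_sum_b : sum_n_m (rk_b rk) 1 (rk_s rk) = 1;
  rk_sum_a : forall i, (1 <= i <= rk_s rk)%nat -> sum_n_m (rk_a rk i) 1 (i - 1) = rk_c rk i;
  rk_c_range : forall i, (1 <= i <= rk_s rk)%nat -> 0 <= rk_c rk i <= 1;
  rk_c_mono : forall i j, (1 <= j < i)%nat -> (i <= rk_s rk)%nat ->
    rk_a rk i j <> 0 -> rk_c rk j <= rk_c rk i
}.

(** In [stage_fuel] the first argument bounds the recursion depth; the stages
    satisfy the defining relation [stageE]. *)

Section Stages.
Context {V : NormedModule R_AbsRing}.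
Variables (rk : tableau) (k : R) (base : nat -> V) (inc : nat -> nat -> V -> V).

Fixpoint stage_fuel (m i : nat) : V :=
  match m with
  | O => zero
  | S m' => plus (base i)
      (scal k (sum_n_m (fun j => scal (rk_a rk i j) (inc i j (stage_fuel m' j))) 1 (i - 1)))
  end.

Definition stage (i : nat) : V := stage_fuel i i.

Lemma stage_fuelE m i : (1 <= i <= m)%nat -> stage_fuel m i = stage i.
Proof.
have H N : forall m i, (1 <= i <= m)%nat -> (i <= N)%nat -> stage_fuel m i = stage i.
  elim: N => [|N IH] m' i' Hi Hn; first lia.
  rewrite /stage; case: m' Hi => [|m'] Hi; first lia.
  case: i' Hi Hn => [|i'] Hi Hn; first lia.
  rewrite [LHS]/= [RHS]/=; congr plus; congr scal.
  apply: sum_n_m_ext_loc => j Hj; congr scal; congr inc.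
  by rewrite (IH m' j) ?(IH i' j) //; lia.
by move=> Hi; apply: (H i).
Qed.

Lemma stageE i : (1 <= i)%nat ->
  stage i = plus (base i)
    (scal k (sum_n_m (fun j => scal (rk_a rk i j) (inc i j (stage j))) 1 (i - 1))).
Proof.
case: i => [|i] Hi; first lia.
rewrite /stage [LHS]/=; congr plus; congr scal; apply: sum_n_m_ext_loc => j Hj.
by congr scal; congr inc; apply: stage_fuelE; lia.
Qed.

End Stages.

Definition rk_step {V : NormedModule R_AbsRing} (rk : tableau) (F : R -> V -> V)
    (k t0 : R) (y0 : V) : V :=
  let Y := stage rk k (fun _ => y0) (fun _ j K => F (t0 + rk_c rk j * k) K) in
  plus y0 (scal k (sum_n_m (fun i => scal (rk_b rk i) (F (t0 + rk_c rk i * k) (Y i)))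
                           1 (rk_s rk))).

(** The local error is O(k^{p+1}) for every smooth ODE system. *)
Definition classical_order_ge (rk : tableau) (p : nat) : Prop :=
  forall (m : nat) (F : R -> Rn m -> Rn m) (t0 tau : R) (y : R -> Rn m),
  (forall n, class_C (U := prod_NormedModule R_AbsRing R_NormedModule (Rn m)) n
               (fun _ => True) (fun q => F (fst q) (snd q))) ->
  0 < tau ->
  (forall t, t0 <= t <= t0 + tau ->
     is_derive_on (fun s => t0 <= s <= t0 + tau) y t (F t (y t))) ->
  exists M k0, 0 < k0 <= tau /\ forall k, 0 < k <= k0 ->
    norm (minus (rk_step rk F k t0 (y t0)) (y (t0 + k))) <= M * k ^ (p + 1).

(** Linear operators with a domain are total functions restricted to a predicate. *)

Definition subspace {V : ModuleSpace C_Ring} (D : V -> Prop) : Prop :=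
  D zero /\ (forall x y, D x -> D y -> D (plus x y)) /\
  (forall (a : C) x, D x -> D (scal a x)).

Definition linear_on {V W : ModuleSpace C_Ring} (D : V -> Prop) (L : V -> W) : Prop :=
  (forall x y, D x -> D y -> L (plus x y) = plus (L x) (L y)) /\
  (forall (a : C) x, D x -> L (scal a x) = scal a (L x)).

Definition norm_on {V : ModuleSpace C_Ring} (D : V -> Prop) (nu : V -> R) : Prop :=
  (forall x, D x -> 0 <= nu x) /\
  (forall x, D x -> nu x = 0 -> x = zero) /\
  (forall x y, D x -> D y -> nu (plus x y) <= nu x + nu y) /\
  (forall (a : C) x, D x -> nu (scal a x) = Cmod a * nu x).

Section Semigroups.
Variable X : CompleteNormedModule C_AbsRing.

Record C0_semigroup (E : R -> X -> X) : Prop := {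
  sg_linear : forall t, 0 <= t -> is_linear (E t);
  sg_0 : forall x, E 0 x = x;
  sg_add : forall s t x, 0 <= s -> 0 <= t -> E (s + t) x = E s (E t x);
  sg_cont : forall x, filterlim (fun t => E t x) (at_right 0) (locally x)
}.

Definition generates (D : X -> Prop) (L : X -> X) (E : R -> X -> X) : Prop :=
  C0_semigroup E /\
  forall x y, (D x /\ L x = y) <->
    filterlim (fun t => scal (RtoC (/ t)) (minus (E t x) x)) (at_right 0) (locally y).

(** The type (growth bound) of a semigroup; it may be [m_infty]. *)
Definition semigroup_type (E : R -> X -> X) (omega : Rbar) : Prop :=
  is_glb_Rbar (fun a => exists M, forall t x, 0 <= t ->
    norm (E t x) <= M * exp (a * t) * norm x) omega.

End Semigroups.

Definition itv (T t : R) : Prop := 0 <= t <= T.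

Section Problem.
Variables X Y : CompleteNormedModule C_AbsRing.
Variables (T : R) (DA : X -> Prop) (A : X -> X) (bd : X -> Y) (E : R -> X -> X).
Variables (f : R -> X -> X) (u : R -> X).

Let XR := re_Banach X.
Let YR := re_Banach Y.

Definition DA0 (x : X) : Prop := DA x /\ bd x = zero.

(** [A_0^{-1} x]; well defined as soon as [0] is in the resolvent set of [A_0]. *)
Definition A0inv (x : X) : X := iota (fun y => DA0 y /\ A y = x).

(** [f] as a function on the product, on which it is differentiated over R. *)
Definition class_C_f (n : nat) : Prop :=
  class_C (U := prod_NormedModule R_AbsRing R_NormedModule XR) (V := XR) n
    (fun q => itv T (fst q)) (fun q => f (fst q) (snd q)).

Definition partial_u (fu : R -> X -> X -> X) : Prop :=
  forall t v, itv T t ->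
    filterdiff (U := XR) (V := XR) (f t) (locally (v : XR)) (fu t v).

Record continuous_hyp (omega : Rbar) (g : R -> Y) (u0 : X) : Prop := {
  hp_T : 0 < T;
  hp_DA : subspace DA;
  hp_A : linear_on DA A;
  hp_bd : linear_on DA bd;
  hp_sol : forall t, itv T t ->
    DA (u t) /\ is_derive_on (V := XR) (itv T) u t (plus (A (u t)) (f t (u t)));
  hp_init : u 0 = u0;
  hp_bc : forall t, itv T t -> bd (u t) = g t;
  hp_onto : forall v, exists x, DA x /\ bd x = v;
  hp_g : class_C (V := YR) 1 (itv T) g;
  hp_dense : forall (x : X) eps, 0 < eps -> exists y, DA0 y /\ norm (minus y x) < eps;
  hp_gen : generates X DA0 A E;
  hp_type : semigroup_type X E omega /\ Rbar_lt omega 0;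
  hp_K : forall (z : C) v, 0 < Re z -> exists! x, DA x /\ A x = scal z x /\ bd x = v;
  hp_K_bound : exists omega0 M : R, Rbar_lt omega omega0 /\
    forall (z : C) v x, 0 < Re z -> omega0 <= Re z ->
      DA x -> A x = scal z x -> bd x = v -> norm x <= M * norm v;
  hp_f : class_C_f 1;
  hp_u : class_C (V := XR) 1 (itv T) u;
  hp_Au : class_C (V := XR) 0 (itv T) (fun t => A (u t))
}.

(** [D(A^l)] and its graph norm. *)
Definition DAl (l : nat) (x : X) : Prop := forall j, (j < l)%nat -> DA (Nat.iter j A x).
Definition graph_norm (l : nat) (x : X) : R := sum_n (fun j => norm (Nat.iter j A x)) l.

Definition continuous_into_DAl (l : nat) (v : R -> X) : Prop :=
  (forall t, itv T t -> DAl l (v t)) /\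
  forall t, itv T t -> forall eps, 0 < eps -> exists delta, 0 < delta /\
    forall s, itv T s -> Rabs (s - t) < delta -> graph_norm l (minus (v s) (v t)) < eps.

(** The solution at [s] of [v' = A v], [v(0) = v0], [bd v = bd psi];
    [dpsi] is the derivative of [psi]. *)
Definition lin_sol (v0 : X) (psi dpsi : R -> X) (s : R) : X :=
  plus (plus (psi s) (E s (minus v0 (psi 0))))
    (RInt (V := XR) (fun tau => E (s - tau) (minus (A (psi tau)) (dpsi tau))) 0 s).

Section Step.
Variables (rk : tableau) (k : R) (n : nat).

Let tn := INR n * k.
Let un := u tn.
Let tc (i : nat) := tn + rk_c rk i * k.

Definition Kbar : nat -> X :=
  stage (V := XR) rk k
    (fun i => lin_sol un (fun _ => un) (fun _ => zero) (rk_c rk i * k))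
    (fun i j K => lin_sol (f (tc j) K) (fun _ => zero) (fun _ => zero)
                    ((rk_c rk i - rk_c rk j) * k)).

(** [\bar u_{n+1}]. *)
Definition ubar : XR :=
  plus (lin_sol un (fun s => plus un (scal (RtoC s) (A un))) (fun _ => A un) k)
    (scal k (sum_n_m (fun i => scal (rk_b rk i)
       (lin_sol (f (tc i) (Kbar i)) (fun _ => f tn un) (fun _ => zero)
          ((1 - rk_c rk i) * k) : XR)) 1 (rk_s rk))).

(** [\rho_{n+1}]. *)
Definition local_error : X := minus (ubar : X) (u (INR (S n) * k)).

End Step.

(** [e k n = O(k^p)] uniformly in the steps [n] with [t_{n+1} <= T]. *)
Definition step_bigO (e : R -> nat -> X) (p : nat) : Prop :=
  exists M k0, 0 < k0 /\ forall k n, 0 < k <= k0 -> INR (S n) * k <= T ->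
    norm (e k n) <= M * k ^ p.

End Problem.

Arguments DA0 {X Y} DA bd x.
Arguments A0inv {X Y} DA A bd x.
Arguments class_C_f {X} T f n.
Arguments partial_u {X} T f fu.
Arguments continuous_hyp {X Y} T DA A bd E f u omega g u0.
Arguments continuous_into_DAl {X} T DA A l v.
Arguments local_error {X} A E f u rk k n.
Arguments step_bigO {X} T e p.

(** Space discretization.  All data are indexed by the mesh parameter, which
    ranges over a set of positive numbers accumulating at 0. *)

Section Discretization.
Variables (d : nat) (Omega : bounded_domain d) (Y : CompleteNormedModule C_AbsRing).
Let X := CX Omega.

Record discretization := Discretization {
  mesh : R -> Prop;
  nnodes : R -> nat;
  node : forall h, 'I_(nnodes h) -> cl_dom d Omega;
  Ah : forall h, 'I_(nnodes h) -> 'I_(nnodes h) -> C;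
  Ch : forall h, Y -> Cn (nnodes h);
  fh : forall h, R -> Cn (nnodes h) -> Cn (nnodes h);
  Rh : forall h, X -> Cn (nnodes h)
}.

Definition matvec {N} (M : 'I_N -> 'I_N -> C) (v : Cn N) : Cn N :=
  fun i => \big[Cplus/RtoC 0]_(j < N) Cmult (M i j) (v j).

(** [w = e^{tM} v]. *)
Definition is_matexp {N} (M : 'I_N -> 'I_N -> C) (t : R) (v w : Cn N) : Prop :=
  is_series (fun j => scal (RtoC (t ^ j / INR (fact j))) (Nat.iter j (matvec M) v)) w.

Definition is_inverse {N} (M B : 'I_N -> 'I_N -> C) : Prop :=
  forall v, matvec B (matvec M v) = v /\ matvec M (matvec B v) = v.

Variable D : discretization.

Definition Ph (h : R) (w : X) : Cn (nnodes D h) := fun i => w (node D h i).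

Variables (T : R) (DA : X -> Prop) (A : X -> X) (bd : X -> Y) (E : R -> X -> X).
Variables (f : R -> X -> X) (u : R -> X).

Record discretization_hyp : Prop := {
  hd_mesh : (forall h, mesh D h -> 0 < h) /\
    forall eps, 0 < eps -> exists h, mesh D h /\ h < eps;
  hd_nodes : forall h, mesh D h -> forall i j, node D h i = node D h j -> i = j;
  hd_Ch : forall h, mesh D h -> linear_on (fun _ => True) (Ch D h);
  hd_fh : forall h, mesh D h -> forall t w, itv T t -> Ph h (f t w) = fh D h t (Ph h w);
  hd_exp : forall h, mesh D h -> forall t v w, 0 <= t ->
    is_matexp (Ah D h) t v w -> norm w <= norm v;
  hd_inv : exists M M' : R, forall h, mesh D h -> exists B, is_inverse (Ah D h) B /\
    (forall v : Cn (nnodes D h), norm (matvec B v : Cn _) <= M * norm v) /\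
    (forall y : Y, norm (matvec B (Ch D h y) : Cn _) <= M' * norm y);
  hd_Rh : forall h, mesh D h -> forall w, DA w ->
    plus (matvec (Ah D h) (Rh D h w)) (Ch D h (bd w)) = Ph h (A w);
  hd_Z : exists (Z : X -> Prop) (normZ : X -> R) (eps eta : R -> R),
    subspace Z /\ (forall w, Z w -> DA w) /\ norm_on Z normZ /\
    (forall w, Z w -> Z (A0inv DA A bd w) /\
       forall t, itv T t -> Z (E t w) /\ Z (f t w)) /\
    (forall h, mesh D h -> forall w, Z w ->
       norm (matvec (Ah D h) (minus (Ph h w) (Rh D h w)) : Cn _) <= eps h * normZ w /\
       norm (minus (Ph h w) (Rh D h w)) <= eta h * normZ w) /\
    filterlim eps (within (mesh D) (at_right 0)) (locally 0) /\
    filterlim eta (within (mesh D) (at_right 0)) (locally 0);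
  hd_fh_C1 : forall h, mesh D h ->
    let V := re_NormedModule (Cn (nnodes D h)) in
    class_C (U := prod_NormedModule R_AbsRing R_NormedModule V) (V := V) 1
      (fun q => itv T (fst q)) (fun q => fh D h (fst q) (snd q));
  (* the neighbourhood is a tube, of radius independent of [h], around [P_h u] *)
  hd_fh_bound : exists r L, 0 < r /\ forall h, mesh D h ->
    let V := re_NormedModule (Cn (nnodes D h)) in
    forall t (v : V) (J : V -> V), itv T t ->
      norm (minus v (Ph h (u t) : V)) < r ->
      filterdiff (fh D h t : V -> V) (locally v) J ->
      forall w, norm (J w) <= L * norm w
}.

End Discretization.

Arguments discretization_hyp {d Omega Y} D T DA A bd E f u.

(* Main.v *)
Require Import Defs.
From mathcomp Require Import ssreflect.
From Stdlib Require Import Reals Lra Lia List Classical IndefiniteDescription.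
From Coquelicot Require Import Coquelicot.
Open Scope R_scope.

(** Every function in the definition of the step is an orbit of the exponentially stable semigroup
    [e^{s A_0}] plus a variation-of-constants integral.  Expanding, the local error is the sum of
    [int_0^k e^{(k-s)A_0} s A^2 u ds], of [k sum_i b_i e^{(1-c_i)kA_0} (f_i - f)] with
    [f_i - f = O(k)], of [k sum_i b_i int_0^{(1-c_i)k} e^{sA_0} A f ds], and of
    [u + k u' - u(t+k)], all of which are [O(k^2)].

    For the second bound, [A_0^{-1}] exists and is bounded by stability, and
    [e^{sA_0} A_0^{-1} w - A_0^{-1} w = O(s) |w|].  So after applying [A_0^{-1}] each semigroup
    operator may be replaced by the identity at the price of one more power of [k]; the bound on
    [A_0^{-1} f_u A_0] allows this also inside the stages.  With [sum_i b_i c_i = 1/2] what is left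
    is [k^2/2 A_0^{-1} (A^2 u + A f + d/dt f(t,u) - u'')], which vanishes because
    [d/dt (A u) = A u']. *)

(** * Linear identities in real vector spaces *)

(** Two obstacles shape the estimates. First, the space is infinite dimensional, so [f] of class C^1
    or C^2 has no Lipschitz or Taylor constant on bounded sets; the only compactness at hand is that
    of [0,T]. All constants for [f] are taken in a tube of fixed radius around the solution curve,
    and stages enter it for small k because they are O(k)-close to u(t_n). Second, e^{sA_0} w - w
    need not be O(s) when w is outside D(A_0). The stage defect K_i - u - c_i k u' is therefore
    known to be O(k^2) only after applying A_0^{-1}, whereas [f] acts on the stage before A_0^{-1}
    does. Writing y = A_0 w turns the hypothesis on A_0^{-1} f_u A_0 into |A_0^{-1} f_u y| <= C
    |A_0^{-1} y| for every y, so the linear part of [f] transmits the weak estimate, while the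
    quadratic remainder is O(k^2) in norm already. Differentiation and integration in time are real,
    whereas A and the boundary operator are complex linear; hence the estimates run over the reals
    and the semigroup is transported by restriction of scalars. *)

(** Both sides of an identity are expanded over their atoms, so that only identities between the
    real coefficients remain. *)
Inductive mexpr :=
  | MVar (n : nat)
  | MZero
  | MPlus (a b : mexpr)
  | MOpp (a : mexpr)
  | MScal (r : R) (a : mexpr).

Section ModuleReflection.
Variable V : ModuleSpace R_Ring.

Fixpoint meval (env : list V) (e : mexpr) : V :=
  match e with
  | MVar n => List.nth n env zero
  | MZero => zero
  | MPlus a b => plus (meval env a) (meval env b)
  | MOpp a => opp (meval env a)
  | MScal r a => scal r (meval env a)
  end.

Fixpoint mcoef (e : mexpr) (i : nat) : R :=
  match e with
  | MVar n => if Nat.eqb n i then 1 else 0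
  | MZero => 0
  | MPlus a b => mcoef a i + mcoef b i
  | MOpp a => - mcoef a i
  | MScal r a => r * mcoef a i
  end.

Fixpoint lincomb (env : list V) (c : nat -> R) : V :=
  match env with
  | nil => zero
  | x :: l => plus (scal (c O) x) (lincomb l (fun i => c (S i)))
  end.

Fixpoint same_coef (n : nat) (c d : nat -> R) : Prop :=
  match n with
  | O => True
  | S m => c O = d O /\ same_coef m (fun i => c (S i)) (fun i => d (S i))
  end.

Lemma lincomb_ext env c d : same_coef (length env) c d -> lincomb env c = lincomb env d.
Proof.
elim: env c d => [|x l IH] c d //= [-> /IH H].
by rewrite H.
Qed.

Lemma lincomb_zero env : lincomb env (fun _ => 0) = zero.
Proof. by elim: env => [|x l IH] //=; rewrite IH plus_zero_r; apply: (scal_zero_l x). Qed.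

Lemma lincomb_plus env c d :
  lincomb env (fun i => c i + d i) = plus (lincomb env c) (lincomb env d).
Proof.
elim: env c d => [|x l IH] c d /=; first by rewrite plus_zero_r.
rewrite IH (scal_distr_r (c O) (d O) x) -!plus_assoc; congr plus.
by rewrite !plus_assoc (plus_comm (lincomb l _)).
Qed.

Lemma lincomb_scal env r c : lincomb env (fun i => r * c i) = scal r (lincomb env c).
Proof.
elim: env c => [|x l IH] c /=; first by rewrite scal_zero_r.
by rewrite IH scal_distr_l scal_assoc.
Qed.

Lemma lincomb_opp env c : lincomb env (fun i => - c i) = opp (lincomb env c).
Proof.
elim: env c => [|x l IH] c /=; first by rewrite opp_zero.
by rewrite IH opp_plus (scal_opp_l (c O) x).
Qed.

Lemma lincomb_var env n :
  lincomb env (fun i => if Nat.eqb n i then 1 else 0) = List.nth n env zero.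
Proof.
elim: env n => [|x l IH] [|n] //=.
  by rewrite lincomb_zero plus_zero_r (scal_one x).
by rewrite (scal_zero_l x) plus_zero_l IH.
Qed.

Lemma meval_lincomb env e : meval env e = lincomb env (mcoef e).
Proof.
elim: e => [n||a IHa b IHb|a IHa|r a IHa] /=.
- by rewrite lincomb_var.
- by rewrite lincomb_zero.
- by rewrite IHa IHb lincomb_plus.
- by rewrite IHa lincomb_opp.
- by rewrite IHa lincomb_scal.
Qed.

Lemma meval_eq env e1 e2 : same_coef (length env) (mcoef e1) (mcoef e2) ->
  meval env e1 = meval env e2.
Proof. by rewrite !meval_lincomb; apply: lincomb_ext. Qed.

End ModuleReflection.

Ltac mod_index x env :=
  lazymatch env with
  | cons x _ => constr:(O)
  | cons _ ?l => let n := mod_index x l in constr:(S n)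
  end.

Ltac mod_mem x env :=
  lazymatch env with
  | cons x _ => constr:(true)
  | cons _ ?l => mod_mem x l
  | nil => constr:(false)
  end.

Ltac mod_atoms x env :=
  lazymatch x with
  | plus ?a ?b => let e := mod_atoms a env in mod_atoms b e
  | minus ?a ?b => let e := mod_atoms a env in mod_atoms b e
  | opp ?a => mod_atoms a env
  | scal ?r ?a => mod_atoms a env
  | zero => env
  | _ => lazymatch mod_mem x env with
         | true => env
         | false => constr:(cons x env)
         end
  end.

Ltac mod_reify x env :=
  lazymatch x with
  | plus ?a ?b => let p := mod_reify a env in let q := mod_reify b env in constr:(MPlus p q)
  | minus ?a ?b =>
      let p := mod_reify a env in let q := mod_reify b env in constr:(MPlus p (MOpp q))
  | opp ?a => let p := mod_reify a env in constr:(MOpp p)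
  | scal ?r ?a => let p := mod_reify a env in constr:(MScal r p)
  | zero => constr:(MZero)
  | _ => let n := mod_index x env in constr:(MVar n)
  end.

Ltac module_coefs :=
  lazymatch goal with
  | |- @eq (ModuleSpace.sort _ ?V) ?x ?y =>
      let env0 := mod_atoms x (@nil V) in
      let env := mod_atoms y env0 in
      let p := mod_reify x env in
      let q := mod_reify y env in
      apply: (meval_eq V env p q); cbn [length same_coef mcoef Nat.eqb]; repeat split
  end.

(** An equation may be typed at a carrier that is only convertible to the intended one, such as a
    complex space and its restriction to the reals. Retyping it over the named real module gives the
    reifier one ambient space. *)
Ltac in_module V := lazymatch goal with |- @eq _ ?x ?y =>
  change (@eq (ModuleSpace.sort R_Ring (NormedModule.ModuleSpace R_AbsRing V)) x y) end.

Tactic Notation "module" constr(V) := in_module V; module_coefs; try ring.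

(** * Relative differentiability and mean value inequalities *)

Lemma norm_minus_sym {K : AbsRing} {V : NormedModule K} (x y : V) :
  norm (minus x y) = norm (minus y x).
Proof. by rewrite -norm_opp opp_minus. Qed.

(** The norm axiom gives one inequality; applied to the scalar 1/r and the vector r x it gives the
    other. *)
Lemma norm_scal_R {V : NormedModule R_AbsRing} (r : R) (x : V) :
  norm (scal r x) = Rabs r * norm x.
Proof.
apply: Rle_antisym; first exact: norm_scal.
case: (Req_dec r 0) => [->|Hr].
  by rewrite Rabs_R0 Rmult_0_l; apply: norm_ge_0.
have Hx : norm x <= Rabs (/ r) * norm (scal r x).
  apply: Rle_trans _ (norm_scal (/ r) (scal r x)); apply: Req_le; congr norm.
  by module V; field.
have Ha : 0 < Rabs r by apply: Rabs_pos_lt.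
rewrite Rabs_inv in Hx.
apply: (Rmult_le_reg_l (/ Rabs r)); first exact: Rinv_0_lt_compat.
by rewrite -Rmult_assoc Rinv_l ?Rmult_1_l //; apply: Rgt_not_eq.
Qed.

Lemma norm_plus_le {K : AbsRing} {V : NormedModule K} (x y : V) a b :
  norm x <= a -> norm y <= b -> norm (plus x y) <= a + b.
Proof. by move=> Hx Hy; apply: Rle_trans (norm_triangle x y) _; lra. Qed.

Lemma norm_plus_lt {K : AbsRing} {V : NormedModule K} (x y : V) a b :
  norm x < a -> norm y <= b -> norm (plus x y) < a + b.
Proof. by move=> Hx Hy; apply: Rle_lt_trans (norm_triangle x y) _; lra. Qed.

Lemma norm_minus_le {K : AbsRing} {V : NormedModule K} (x y : V) a b :
  norm x <= a -> norm y <= b -> norm (minus x y) <= a + b.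
Proof. by move=> Hx Hy; apply: norm_plus_le => //; rewrite norm_opp. Qed.

Lemma norm_eq_0_of_le {V : NormedModule R_AbsRing} (x : V) M :
  (forall eps, 0 < eps -> norm x <= eps * M) -> x = zero.
Proof.
move=> H; apply: norm_eq_zero; apply: Rle_antisym; last exact: norm_ge_0.
apply: le_epsilon => e He; rewrite Rplus_0_l.
have Hp : 0 < Rabs M + 1 by have := Rabs_pos M; lra.
apply: Rle_trans (H (e / (Rabs M + 1)) _) _; first exact: Rdiv_lt_0_compat.
apply: Rle_trans (Rmult_le_compat_l _ _ (Rabs M + 1) _ _) _.
- by apply: Rlt_le; apply: Rdiv_lt_0_compat.
- by have := Rle_abs M; lra.
- by apply: Req_le; field; lra.
Qed.

(** The epsilon-delta content of a derivative relative to [D], separated from linearity of [L] and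
    from the quantification over limit points in [filterdiff]. It is one-sided at end points and
    passes to subsets of [D]. *)
Definition frechet {U V : NormedModule R_AbsRing} (D : U -> Prop) (F : U -> V) (x : U)
    (L : U -> V) : Prop :=
  forall eps, 0 < eps -> exists delta, 0 < delta /\
    forall y, D y -> norm (minus y x) < delta ->
    norm (minus (minus (F y) (F x)) (L (minus y x))) <= eps * norm (minus y x).

Definition deriv_within {V : NormedModule R_AbsRing} (D : R -> Prop) (phi : R -> V) (t : R)
    (l : V) : Prop :=
  frechet (U := R_NormedModule) D phi t (fun h : R => scal h l).

Lemma deriv_withinE {V : NormedModule R_AbsRing} (D : R -> Prop) (phi : R -> V) t l : deriv_within D phi t l <->
  forall eps, 0 < eps -> exists delta, 0 < delta /\
    forall s, D s -> Rabs (s - t) < delta ->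
    norm (minus (minus (phi s) (phi t)) (scal (s - t) l)) <= eps * Rabs (s - t).
Proof. by []. Qed.

Section Derivatives.
Context {V W : NormedModule R_AbsRing}.
Implicit Types (D : R -> Prop) (phi psi : R -> V).

Lemma deriv_within_subset D D' phi t l : (forall s, D' s -> D s) ->
  deriv_within D phi t l -> deriv_within D' phi t l.
Proof.
move=> HD H eps He; have [d [Hd H']] := H _ He; exists d; split=> // s Hs.
by apply: H'; apply: HD.
Qed.

Lemma deriv_within_ext D phi psi t l : D t -> (forall s, D s -> phi s = psi s) ->
  deriv_within D phi t l -> deriv_within D psi t l.
Proof.
move=> Ht HE H eps He; have [d [Hd H']] := H _ He; exists d; split=> // s Hs.
by rewrite -!HE //; apply: H'.
Qed.

Lemma deriv_within_plus D phi psi t l m :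
  deriv_within D phi t l -> deriv_within D psi t m ->
  deriv_within D (fun s => plus (phi s) (psi s)) t (plus l m).
Proof.
move=> H1 H2; apply/deriv_withinE => eps He.
have He2 : 0 < eps / 2 by lra.
have [d1 [Hd1 K1]] := proj1 (deriv_withinE _ _ _ _) H1 _ He2.
have [d2 [Hd2 K2]] := proj1 (deriv_withinE _ _ _ _) H2 _ He2.
exists (Rmin d1 d2); split; first exact: Rmin_pos.
move=> s Ds Hs.
have L1 := K1 s Ds (Rlt_le_trans _ _ _ Hs (Rmin_l _ _)).
have L2 := K2 s Ds (Rlt_le_trans _ _ _ Hs (Rmin_r _ _)).
have -> : minus (minus (plus (phi s) (psi s)) (plus (phi t) (psi t))) (scal (s - t) (plus l m))
  = plus (minus (minus (phi s) (phi t)) (scal (s - t) l))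
         (minus (minus (psi s) (psi t)) (scal (s - t) m)) by module V.
by apply: Rle_trans (norm_plus_le _ _ _ _ L1 L2) _; lra.
Qed.

Lemma deriv_within_linear D phi t l (L : V -> W) : is_linear L ->
  deriv_within D phi t l -> deriv_within D (fun s => L (phi s)) t (L l).
Proof.
move=> HL H; apply/deriv_withinE => eps He.
have [M [HM HLM]] := linear_norm _ HL.
have [d [Hd K]] := proj1 (deriv_withinE _ _ _ _) H _ (Rdiv_lt_0_compat _ _ He HM).
exists d; split=> // s Ds Hs.
rewrite -(linear_scal _ HL) -!(linear_minus _ _ _ HL).
apply: Rle_trans (HLM _) _.
apply: Rle_trans (Rmult_le_compat_l _ _ _ (Rlt_le _ _ HM) (K s Ds Hs)) _.
by apply: Req_le; field; lra.
Qed.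

Lemma deriv_within_scal D phi t l c : deriv_within D phi t l ->
  deriv_within D (fun s => scal c (phi s)) t (scal c l).
Proof.
move=> H; apply/deriv_withinE => eps He.
have Hc : 0 < Rabs c + 1 by have := Rabs_pos c; lra.
have [d [Hd K]] := proj1 (deriv_withinE _ _ _ _) H _ (Rdiv_lt_0_compat _ _ He Hc).
exists d; split=> // s Ds Hs.
have -> : minus (minus (scal c (phi s)) (scal c (phi t))) (scal (s - t) (scal c l)) =
  scal c (minus (minus (phi s) (phi t)) (scal (s - t) l)) by module V.
rewrite norm_scal_R.
apply: (Rle_trans _ ((Rabs c + 1) * (eps / (Rabs c + 1) * Rabs (s - t)))).
  apply: Rmult_le_compat; [exact: Rabs_pos | exact: norm_ge_0 | lra | exact: K].
by apply: Req_le; field; lra.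
Qed.

Lemma deriv_within_minus D phi psi t l m :
  deriv_within D phi t l -> deriv_within D psi t m ->
  deriv_within D (fun s => minus (phi s) (psi s)) t (minus l m).
Proof.
move=> H1 H2 eps He.
have [d [Hd K]] := deriv_within_plus _ _ _ _ _ _ H1 (deriv_within_scal _ _ _ _ (-1) H2) _ He.
exists d; split=> // s Ds Hs.
apply: Rle_trans _ (K s Ds Hs); apply: Req_le; congr norm; by module V.
Qed.

Lemma deriv_within_id D (x : V) t : deriv_within D (fun s => scal s x) t x.
Proof.
apply/deriv_withinE => eps He; exists 1; split=> [|s _ _]; first lra.
have -> : minus (minus (scal s x) (scal t x)) (scal (s - t) x) = zero by module V.
rewrite norm_zero.
by apply: Rmult_le_pos; [lra | apply: Rabs_pos].
Qed.

Lemma deriv_within_sqr D (x : V) a t :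
  deriv_within D (fun s => scal ((s - a) ^ 2 / 2) x) t (scal (t - a) x).
Proof.
apply/deriv_withinE => eps He.
have Hx : 0 < norm x + 1 by have := norm_ge_0 x; lra.
exists (eps / (norm x + 1)); split=> [|s _ Hs]; first exact: Rdiv_lt_0_compat.
have -> : minus (minus (scal ((s - a) ^ 2 / 2) x) (scal ((t - a) ^ 2 / 2) x))
   (scal (s - t) (scal (t - a) x)) = scal ((s - t) * (s - t) / 2) x by module V; field.
rewrite norm_scal_R Rabs_mult Rabs_mult (Rabs_pos_eq (/ 2)); last lra.
have H1 : Rabs (s - t) * norm x <= eps.
  apply: Rle_trans (Rmult_le_compat _ (eps / (norm x + 1)) _ (norm x + 1) _ _ _ _) _.
  - exact: Rabs_pos.
  - exact: norm_ge_0.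
  - exact: Rlt_le.
  - lra.
  - by apply: Req_le; field; lra.
have := Rabs_pos (s - t); have := norm_ge_0 x.
move: (Rabs (s - t)) (norm x) H1 => p q H1 Hq Hp.
have : p * (p * q) <= p * eps by apply: Rmult_le_compat_l.
have : 0 <= p * (p * q) by apply: Rmult_le_pos => //; apply: Rmult_le_pos.
nra.
Qed.

Lemma deriv_within_continuous D phi t l : deriv_within D phi t l ->
  forall eps, 0 < eps -> exists delta, 0 < delta /\ forall s, D s -> Rabs (s - t) < delta ->
    norm (minus (phi s) (phi t)) < eps.
Proof.
move=> H eps He.
have [d [Hd K]] := proj1 (deriv_withinE _ _ _ _) H 1 Rlt_0_1.
have Hl : 0 < norm l + 1 by have := norm_ge_0 l; lra.
have He2 : 0 < eps / (norm l + 1) by apply: Rdiv_lt_0_compat.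
exists (Rmin d (eps / (norm l + 1))); split; first exact: Rmin_pos.
move=> s Ds Hs.
have K' := K s Ds (Rlt_le_trans _ _ _ Hs (Rmin_l _ _)).
have Hs' := Rlt_le_trans _ _ _ Hs (Rmin_r _ _).
have -> : minus (phi s) (phi t) =
  plus (minus (minus (phi s) (phi t)) (scal (s - t) l)) (scal (s - t) l) by module V.
apply: Rle_lt_trans (norm_triangle _ _) _.
have := norm_scal_R (s - t) l; move: (norm (scal _ _)) => z ->.
apply: (Rle_lt_trans _ (Rabs (s - t) * (norm l + 1))); first by lra.
apply: (Rlt_le_trans _ (eps / (norm l + 1) * (norm l + 1))).
  by apply: Rmult_lt_compat_r.
by apply: Req_le; field; lra.
Qed.

Lemma deriv_within_unique a b phi t l m : a < b -> a <= t <= b ->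
  deriv_within (fun s => a <= s <= b) phi t l ->
  deriv_within (fun s => a <= s <= b) phi t m -> l = m.
Proof.
move=> Hab Ht H1 H2.
suff H : minus l m = zero.
  have -> : l = plus (minus l m) m by module V.
  by rewrite H plus_zero_l.
apply: (norm_eq_0_of_le _ 2) => eps He.
have [d1 [Hd1 K1]] := proj1 (deriv_withinE _ _ _ _) H1 _ He.
have [d2 [Hd2 K2]] := proj1 (deriv_withinE _ _ _ _) H2 _ He.
(* A test point different from t is needed; it is taken on the right of t unless t = b, and then on
   the left, where a < b leaves room. *)
have [s [Hs [Hs0 Hsd]]] : exists s, a <= s <= b /\ 0 < Rabs (s - t) /\ Rabs (s - t) < Rmin d1 d2.
  have Hd := Rmin_pos _ _ Hd1 Hd2.
  case: (Rlt_le_dec t b) => Htb.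
    have Hm : 0 < Rmin (b - t) (Rmin d1 d2 / 2) by apply: Rmin_pos; lra.
    exists (t + Rmin (b - t) (Rmin d1 d2 / 2)).
    have -> : t + Rmin (b - t) (Rmin d1 d2 / 2) - t = Rmin (b - t) (Rmin d1 d2 / 2) by ring.
    rewrite Rabs_pos_eq; last lra.
    have := Rmin_l (b - t) (Rmin d1 d2 / 2); have := Rmin_r (b - t) (Rmin d1 d2 / 2); lra.
  have Hm : 0 < Rmin (b - a) (Rmin d1 d2 / 2) by apply: Rmin_pos; lra.
  exists (t - Rmin (b - a) (Rmin d1 d2 / 2)).
  have -> : t - Rmin (b - a) (Rmin d1 d2 / 2) - t = - Rmin (b - a) (Rmin d1 d2 / 2) by ring.
  rewrite Rabs_Ropp Rabs_pos_eq; last lra.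
  have := Rmin_l (b - a) (Rmin d1 d2 / 2); have := Rmin_r (b - a) (Rmin d1 d2 / 2); lra.
have := K1 s Hs (Rlt_le_trans _ _ _ Hsd (Rmin_l _ _)).
have := K2 s Hs (Rlt_le_trans _ _ _ Hsd (Rmin_r _ _)).
set p := minus _ (scal _ m); set q := minus _ (scal _ l) => Hp Hq.
apply: (Rmult_le_reg_l (Rabs (s - t))) => //.
rewrite -norm_scal_R.
have -> : scal (s - t) (minus l m) = minus p q by rewrite /p /q; module V.
by apply: Rle_trans (norm_minus_le _ _ _ _ Hp Hq) _; lra.
Qed.

(** Vector values admit no intermediate point, so a continuation argument replaces it. With the
    slope C + c0, the set of x up to which the bound holds contains its supremum, and from there the
    local estimate extends it to the right unless the supremum is b. The slack c0 absorbs the error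
    of the derivative; its denominator b - a + 1 keeps the case a = b regular. *)
Lemma mean_value (phi phi' : R -> V) a b C : a <= b ->
  (forall t, a <= t <= b -> deriv_within (fun s => a <= s <= b) phi t (phi' t)) ->
  (forall t, a <= t <= b -> norm (phi' t) <= C) ->
  norm (minus (phi b) (phi a)) <= C * (b - a).
Proof.
move=> Hab Hd HC.
apply: le_epsilon => e He.
set c0 := e / (b - a + 1).
have Hc0 : 0 < c0 by apply: Rdiv_lt_0_compat; lra.
suff H : norm (minus (phi b) (phi a)) <= (C + c0) * (b - a).
  have : c0 * (b - a) <= e.
    apply: (Rle_trans _ (c0 * (b - a + 1))); first by apply: Rmult_le_compat_l; lra.
    by apply: Req_le; rewrite /c0; field; lra.
  by move: H; lra.
have step t : a <= t <= b -> exists delta, 0 < delta /\ forall s, a <= s <= b ->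
    Rabs (s - t) < delta -> norm (minus (phi s) (phi t)) <= (C + c0) * Rabs (s - t).
  move=> Ht; have [d [Hd' K]] := proj1 (deriv_withinE _ _ _ _) (Hd t Ht) _ Hc0.
  exists d; split=> // s Hs Hsd.
  have -> : minus (phi s) (phi t) = plus (minus (minus (phi s) (phi t)) (scal (s - t) (phi' t)))
    (scal (s - t) (phi' t)) by module V.
  apply: Rle_trans (norm_triangle _ _) _; rewrite norm_scal_R.
  have := K s Hs Hsd; have := HC t Ht; have := Rabs_pos (s - t).
  move: (Rabs _) => p Hp H1 H2.
  have : p * norm (phi' t) <= p * C by apply: Rmult_le_compat_l.
  lra.
pose S x := a <= x <= b /\ norm (minus (phi x) (phi a)) <= (C + c0) * (x - a).
have Sa : S a.
  split; first lra.
  by rewrite minus_eq_zero norm_zero Rminus_diag Rmult_0_r; apply: Rle_refl.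
have trans x y : norm (minus (phi x) (phi a)) <= (C + c0) * (x - a) ->
    norm (minus (phi y) (phi x)) <= (C + c0) * (y - x) ->
    norm (minus (phi y) (phi a)) <= (C + c0) * (y - a).
  move=> H1 H2.
  have -> : minus (phi y) (phi a) = plus (minus (phi y) (phi x)) (minus (phi x) (phi a))
    by module V.
  by apply: Rle_trans (norm_triangle _ _) _; lra.
have [c [Hub Hlub]] : {c | is_lub S c}.
  by apply: completeness; [exists b => x [Hx _]; lra | exists a].
have Hac : a <= c by apply: Hub.
have Hcb : c <= b by apply: Hlub => x [Hx _]; lra.
have [d [Hd' K]] := step c (conj Hac Hcb).
have Sc : S c.
  split; first by [].
  have [x [[Hx1 Hx2] Hxc]] : exists x, S x /\ c - d < x.
    apply: NNPP => Hn; have : c <= c - d; last lra.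
    apply: Hlub => x Sx; apply: Rnot_lt_le => Hx; apply: Hn; by exists x.
  have Hxc' : x <= c by apply: Hub.
  apply: (trans x) => //.
  have Habs : Rabs (x - c) = c - x by rewrite Rabs_minus_sym Rabs_pos_eq; lra.
  rewrite norm_minus_sym -Habs; apply: K => //; rewrite Habs; lra.
case: (Rle_lt_or_eq_dec _ _ Hcb) => [Hlt|<-]; last by case: Sc.
have Hm : 0 < Rmin (b - c) (d / 2) by apply: Rmin_pos; lra.
have Hm1 := Rmin_l (b - c) (d / 2); have Hm2 := Rmin_r (b - c) (d / 2).
set y := c + Rmin (b - c) (d / 2).
have Habs : Rabs (y - c) = y - c by rewrite Rabs_pos_eq /y; lra.
have : y <= c; last by rewrite /y; lra.
apply: Hub; split; first by rewrite /y; lra.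
apply: (trans c); first by case: Sc.
rewrite -[X in _ * X]Habs; apply: K; first by rewrite /y; lra.
by rewrite Habs /y; lra.
Qed.

Lemma mean_value_linear (phi phi' : R -> V) (l : V) a b C : a <= b ->
  (forall t, a <= t <= b -> deriv_within (fun s => a <= s <= b) phi t (phi' t)) ->
  (forall t, a <= t <= b -> norm (minus (phi' t) l) <= C) ->
  norm (minus (minus (phi b) (phi a)) (scal (b - a) l)) <= C * (b - a).
Proof.
move=> Hab Hd HC.
have -> : minus (minus (phi b) (phi a)) (scal (b - a) l) =
  minus (minus (phi b) (scal b l)) (minus (phi a) (scal a l)) by module V.
apply: (mean_value (fun s => minus (phi s) (scal s l)) (fun s => minus (phi' s) l)) => //.
by move=> t Ht; apply: deriv_within_minus (Hd t Ht) _; apply: deriv_within_id.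
Qed.

End Derivatives.

(** * Mean value inequalities on convex sets, Lipschitz and Taylor estimates *)

Definition convex {V : NormedModule R_AbsRing} (D : V -> Prop) : Prop :=
  forall x y s, D x -> D y -> 0 <= s <= 1 -> D (plus x (scal s (minus y x))).

Section Segments.
Context {U V : NormedModule R_AbsRing}.

Lemma frechet_minus_linear (D : U -> Prop) (F : U -> V) (x : U) L (N : U -> V) :
  is_linear N -> frechet D F x L ->
  frechet D (fun y => minus (F y) (N y)) x (fun h => minus (L h) (N h)).
Proof.
move=> HN H eps He; have [d [Hd K]] := H _ He; exists d; split=> // y Dy Hy.
apply: Rle_trans _ (K y Dy Hy); apply: Req_le; congr norm.
by rewrite (linear_minus _ _ _ HN); module V.
Qed.

Lemma frechet_segment (D : U -> Prop) (F : U -> V) (x h : U) t L : is_linear L ->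
  (forall s, 0 <= s <= 1 -> D (plus x (scal s h))) ->
  frechet D F (plus x (scal t h)) L ->
  deriv_within (fun s => 0 <= s <= 1) (fun s => F (plus x (scal s h))) t (L h).
Proof.
move=> HL HD H; apply/deriv_withinE => eps He.
have Hh : 0 < norm h + 1 by have := norm_ge_0 h; lra.
have [d [Hd K]] := H _ (Rdiv_lt_0_compat _ _ He Hh).
exists (d / (norm h + 1)); split=> [|s Hs Hst]; first exact: Rdiv_lt_0_compat.
have E : minus (plus x (scal s h)) (plus x (scal t h)) = scal (s - t) h by module U.
have Hle : Rabs (s - t) * norm h <= Rabs (s - t) * (norm h + 1).
  by apply: Rmult_le_compat_l; [exact: Rabs_pos | lra].
have := K _ (HD s Hs); rewrite E (linear_scal _ HL) norm_scal_R => K'.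
apply: Rle_trans (K' _) _.
  apply: Rle_lt_trans Hle _.
  apply: (Rlt_le_trans _ (d / (norm h + 1) * (norm h + 1))); first exact: Rmult_lt_compat_r.
  by apply: Req_le; field; lra.
apply: (Rle_trans _ (eps / (norm h + 1) * (Rabs (s - t) * (norm h + 1)))).
  by apply: Rmult_le_compat_l => //; apply: Rlt_le; apply: Rdiv_lt_0_compat.
by apply: Req_le; field; lra.
Qed.

Lemma mean_value_segment (D : U -> Prop) (F : U -> V) (dF : U -> U -> V) (x y : U) C :
  convex D -> D x -> D y ->
  (forall z, D z -> is_linear (dF z) /\ frechet D F z (dF z)) ->
  (forall s, 0 <= s <= 1 -> norm (dF (plus x (scal s (minus y x))) (minus y x)) <= C) ->
  norm (minus (F y) (F x)) <= C.
Proof.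
move=> HD Dx Dy HF HC.
have E0 : plus x (scal 0 (minus y x)) = x by module U.
have E1 : plus x (scal 1 (minus y x)) = y by module U.
have -> : minus (F y) (F x) =
  minus (F (plus x (scal 1 (minus y x)))) (F (plus x (scal 0 (minus y x)))).
  by rewrite E0 E1.
have -> : C = C * (1 - 0) by ring.
apply: (mean_value (fun s => F (plus x (scal s (minus y x))))
  (fun s => dF (plus x (scal s (minus y x))) (minus y x))) => //; first lra.
move=> t Ht.
have [H1 H2] := HF _ (HD x y t Dx Dy Ht).
by apply: frechet_segment H2 => // s; apply: HD.
Qed.

Lemma norm_segment (x y z : U) r s : 0 <= s <= 1 ->
  norm (minus x z) < r -> norm (minus y z) < r ->
  norm (minus (plus x (scal s (minus y x))) z) < r.
Proof.
move=> Hs Hx Hy.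
have -> : minus (plus x (scal s (minus y x))) z =
  plus (scal (1 - s) (minus x z)) (scal s (minus y z)) by module U.
apply: Rle_lt_trans (norm_triangle _ _) _.
rewrite !norm_scal_R !Rabs_pos_eq; try lra.
case: (Req_dec s 0) => [->|Hs0]; first lra.
have : s * norm (minus y z) < s * r by apply: Rmult_lt_compat_l => //; lra.
have : (1 - s) * norm (minus x z) <= (1 - s) * r by apply: Rmult_le_compat_l; lra.
lra.
Qed.

Lemma diff_class_pred (D : U -> Prop) n {P : Type} (w : P -> R) (F : U -> P -> V) :
  (forall p, 0 <= w p) -> diff_class D (S n) w F -> diff_class D n w F.
Proof.
elim: n P w F => [|n IH] P w F Hw; last first.
  move=> [dF [H1 [H2 H3]]]; exists dF; split=> //; split=> //.
  by apply: IH H3 => q; apply: Rmult_le_pos => //; apply: norm_ge_0.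
move=> [dF [H1 [H2 _]]] x Dx eps He.
have [Hlin [M HM]] := H1 x Dx.
have [d [Hd K]] := H2 x Dx 1 Rlt_0_1.
have HM1 : 0 < Rabs M + 1 by have := Rabs_pos M; lra.
exists (Rmin d (eps / (Rabs M + 1))); split.
  by apply: Rmin_pos => //; apply: Rdiv_lt_0_compat.
move=> y Dy Hy p.
have K' := K y Dy (Rlt_le_trans _ _ _ Hy (Rmin_l _ _)) p.
have Hy' := Rlt_le_trans _ _ _ Hy (Rmin_r _ _).
have -> : minus (F y p) (F x p) =
  plus (minus (minus (F y p) (F x p)) (dF x (minus y x, p))) (dF x (minus y x, p)) by module V.
have HMp := HM (minus y x) p.
apply: Rle_trans (norm_plus_le _ _ _ _ K' HMp) _.
have Hn := norm_ge_0 (minus y x); have Hwp := Hw p.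
have : M * norm (minus y x) * w p <= Rabs M * norm (minus y x) * w p.
  by do 2 apply: Rmult_le_compat_r => //; apply: Rle_abs.
have : (Rabs M + 1) * norm (minus y x) * w p <= eps * w p; last lra.
apply: Rmult_le_compat_r => //.
apply: (Rle_trans _ ((Rabs M + 1) * (eps / (Rabs M + 1)))).
  by apply: Rmult_le_compat_l; lra.
by apply: Req_le; field; lra.
Qed.

(** The derivative in [diff_class] carries its increment as an index. Restricting that index to the
    single increment 1 makes the derivative of a function of t a function of t again, of the next
    lower class; a general map [sg] is needed for the induction to go through. *)
Lemma diff_class_reindex (D : U -> Prop) n {P Q : Type} (w : P -> R) (w' : Q -> R)
    (F : U -> P -> V) (sg : Q -> P) C : 0 <= C -> (forall q, 0 <= w' q) ->
  (forall q, w (sg q) <= C * w' q) -> (forall p, 0 <= w p) ->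
  diff_class D n w F -> diff_class D n w' (fun x q => F x (sg q)).
Proof.
move=> HC; elim: n P Q w w' F sg => [|n IH] P Q w w' F sg Hw' Hww' Hw.
  move=> H x Dx eps He.
  have [|d [Hd K]] := H x Dx (eps / (C + 1)); first by apply: Rdiv_lt_0_compat; lra.
  exists d; split=> // y Dy Hy q; apply: Rle_trans (K y Dy Hy (sg q)) _.
  apply: Rle_trans (Rmult_le_compat_l _ _ ((C + 1) * w' q) _ _) _.
  - by apply: Rlt_le; apply: Rdiv_lt_0_compat; lra.
  - by have := Hww' q; have := Hw' q; lra.
  - by apply: Req_le; field; lra.
move=> [dF [H1 [H2 H3]]]; exists (fun x q => dF x (fst q, sg (snd q))); split; [|split].
- move=> x Dx; have [Hl [M HM]] := H1 x Dx; split=> [q|]; first exact: (Hl (sg q)).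
  exists (Rabs M * C) => h q.
  apply: Rle_trans (HM h (sg q)) _.
  apply: (Rle_trans _ (Rabs M * norm h * w (sg q))).
    do 2 (apply: Rmult_le_compat_r; first by [apply: Hw | apply: norm_ge_0]).
    exact: Rle_abs.
  have -> : Rabs M * C * norm h * w' q = Rabs M * norm h * (C * w' q) by ring.
  apply: Rmult_le_compat_l => //.
  by apply: Rmult_le_pos; [apply: Rabs_pos | apply: norm_ge_0].
- move=> x Dx eps He.
  have [|d [Hd K]] := H2 x Dx (eps / (C + 1)); first by apply: Rdiv_lt_0_compat; lra.
  exists d; split=> // y Dy Hy q; apply: Rle_trans (K y Dy Hy (sg q)) _.
  apply: Rle_trans (Rmult_le_compat_l _ _ ((C + 1) * w' q) _ _) _.
  + apply: Rmult_le_pos; last exact: norm_ge_0.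
    by apply: Rlt_le; apply: Rdiv_lt_0_compat; lra.
  + by have := Hww' q; have := Hw' q; lra.
  + by apply: Req_le; field; lra.
- apply: (IH _ _ _ _ dF (fun q : U * Q => (fst q, sg (snd q)))) H3.
  + by move=> q; apply: Rmult_le_pos => //; apply: norm_ge_0.
  + move=> q /=; have -> : C * (norm (fst q) * w' (snd q)) = norm (fst q) * (C * w' (snd q)) by ring.
    by apply: Rmult_le_compat_l => //; apply: norm_ge_0.
  + by move=> q; apply: Rmult_le_pos => //; apply: norm_ge_0.
Qed.

Lemma frechet_of_weighted (D : U -> Prop) {P : Type} (w : P -> R) (F : U -> P -> V) x dF p :
  0 <= w p ->
  (forall eps, 0 < eps -> exists delta, 0 < delta /\
     forall y, D y -> norm (minus y x) < delta -> forall p,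
     norm (minus (minus (F y p) (F x p)) (dF (minus y x) p)) <= eps * norm (minus y x) * w p) ->
  frechet D (fun y => F y p) x (fun h => dF h p).
Proof.
move=> Hw H eps He.
have [|d [Hd K]] := H (eps / (w p + 1)); first by apply: Rdiv_lt_0_compat; lra.
exists d; split=> // y Dy Hy; apply: Rle_trans (K y Dy Hy p) _.
apply: (Rle_trans _ (eps / (w p + 1) * norm (minus y x) * (w p + 1))).
  apply: Rmult_le_compat_l; last lra.
  apply: Rmult_le_pos; last exact: norm_ge_0.
  by apply: Rlt_le; apply: Rdiv_lt_0_compat; lra.
by apply: Req_le; field; lra.
Qed.

(** Near x the derivative differs from its value at x by at most 1, so Rabs M + 1 bounds it
    uniformly in [p]. The weight lets the lemma be applied to a derivative as well, and the
    Lipschitz bound is then one in operator norm. *)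
Lemma C1_locally_lipschitz (D : U -> Prop) {P : Type} (w : P -> R) (F : U -> P -> V) :
  (forall p, 0 <= w p) -> convex D -> diff_class D 1 w F -> forall x, D x ->
  exists r L, 0 < r /\ 0 <= L /\ forall y z, D y -> D z -> norm (minus y x) < r ->
    norm (minus z x) < r -> forall p, norm (minus (F z p) (F y p)) <= L * norm (minus z y) * w p.
Proof.
move=> Hw HD [dF [H1 [H2 H3]]] x Dx.
have [_ [M HM]] := H1 x Dx.
have [r [Hr K]] := H3 x Dx 1 Rlt_0_1.
exists r, (Rabs M + 1); split=> //; split; first by have := Rabs_pos M; lra.
move=> y z Dy Dz Hy Hz p.
apply: (mean_value_segment D (fun v => F v p) (fun v h => dF v (h, p))) => //.
  move=> v Dv; split; first by case: (H1 v Dv).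
  by apply: (frechet_of_weighted D w F v (fun h q => dF v (h, q))) => //; apply: H2.
move=> s Hs.
have Dv := HD y z s Dy Dz Hs.
move: (K _ Dv (norm_segment y z x r s Hs Hy Hz) (minus z y, p)) (HM (minus z y) p) => /=.
move: (plus y _) Dv => v Dv K1 K2.
have -> : dF v (minus z y, p) =
  plus (minus (dF v (minus z y, p)) (dF x (minus z y, p))) (dF x (minus z y, p)) by module V.
apply: Rle_trans (norm_plus_le _ _ _ _ K1 K2) _.
have Hn := norm_ge_0 (minus z y); have Hwp := Hw p.
have : M * norm (minus z y) * w p <= Rabs M * norm (minus z y) * w p.
  by do 2 apply: Rmult_le_compat_r => //; apply: Rle_abs.
lra.
Qed.

(** The mean value inequality is applied to F minus its linear part at y: by the Lipschitz bound on
    the derivative, the derivative of the difference along the segment is at most L s |z - y|^2. The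
    expansion point y varies in a whole ball, as is needed for constants that are uniform along a
    curve. *)
Lemma class_C2_taylor (D : U -> Prop) (F : U -> V) : convex D -> class_C 2 D F ->
  exists dF : U -> U -> V, (forall x, D x -> is_linear (dF x) /\ frechet D F x (dF x)) /\
  forall x, D x -> exists r L, 0 < r /\ 0 <= L /\ forall y z, D y -> D z ->
    norm (minus y x) < r -> norm (minus z x) < r ->
    norm (minus (minus (F z) (F y)) (dF y (minus z y))) <= L * norm (minus z y) ^ 2.
Proof.
move=> HD [dF [H1 [H2 H3]]].
have HF x : D x -> is_linear (fun h => dF x (h, tt)) /\ frechet D F x (fun h => dF x (h, tt)).
  move=> Dx; split; first by case: (H1 x Dx).
  apply: (frechet_of_weighted D (fun _ : unit => 1) (fun y _ => F y) x (fun h q => dF x (h, q)) tt).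
    lra.
  exact: H2.
exists (fun x h => dF x (h, tt)); split=> // x Dx.
have [q|r [L [Hr [HL K]]]] := C1_locally_lipschitz D _ dF _ HD H3 x Dx.
  by rewrite Rmult_1_r; apply: norm_ge_0.
exists r, L; split=> //; split=> // y z Dy Dz Hy Hz.
have [Hly _] := HF y Dy.
have -> : minus (minus (F z) (F y)) (dF y (minus z y, tt)) =
  minus (minus (F z) (dF y (z, tt))) (minus (F y) (dF y (y, tt))).
  by rewrite (linear_minus _ _ _ Hly); module V.
apply: (mean_value_segment D (fun v => minus (F v) (dF y (v, tt)))
  (fun v h => minus (dF v (h, tt)) (dF y (h, tt)))) => //.
  move=> v Dv; have [Hl Hf] := HF v Dv; split.
    exact: (is_linear_comp _ _ (is_linear_prod _ _ Hl (is_linear_comp _ _ Hly is_linear_opp))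
             is_linear_plus).
  exact: frechet_minus_linear.
move=> s Hs; have Dv := HD y z s Dy Dz Hs.
apply: Rle_trans (K y _ Dy Dv Hy (norm_segment y z x r s Hs Hy Hz) (minus z y, tt)) _ => /=.
have -> : minus (plus y (scal s (minus z y))) y = scal s (minus z y) by module U.
rewrite norm_scal_R Rabs_pos_eq; last lra.
have Hn := norm_ge_0 (minus z y); move: (norm _) Hn => n Hn.
have -> : L * (s * n) * (n * 1) = s * (L * (n * (n * 1))) by ring.
rewrite -[X in _ <= X]Rmult_1_l.
apply: Rmult_le_compat_r; last lra.
by apply: Rmult_le_pos => //; nra.
Qed.

End Segments.

Lemma class_C_deriv {V : NormedModule R_AbsRing} (D : R -> Prop) n (phi : R -> V) :
  class_C (U := R_NormedModule) (S n) D phi ->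
  exists phi' : R -> V, (forall t, D t -> deriv_within D phi t (phi' t)) /\
    class_C (U := R_NormedModule) n D phi'.
Proof.
move=> [dF [H1 [H2 H3]]]; exists (fun t => dF t (1, tt)); split.
  move=> t Dt; have [Hl _] := H1 t Dt.
  have H : frechet (U := R_NormedModule) D phi t (fun h => dF t (h, tt)).
    apply: (frechet_of_weighted (U := R_NormedModule) D (fun _ : unit => 1) (fun y _ => phi y) t
      (fun h q => dF t (h, q)) tt); first lra.
    exact: H2.
  move=> eps He; have [d [Hd K]] := H _ He; exists d; split=> // s Ds Hs.
  apply: Rle_trans _ (K s Ds Hs); apply: Req_le; congr norm; congr minus.
  rewrite -(linear_scal _ (Hl tt)); congr (dF _ (_, _)).
  by rewrite /scal /= /mult /= Rmult_1_r.
apply: (diff_class_reindex (U := R_NormedModule) D n _ (fun _ : unit => 1) dF (fun _ => (1, tt)) 1) H3.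
- lra.
- by move=> _; lra.
- by move=> q /=; rewrite /norm /= /abs /= Rabs_R1; lra.
- by move=> q; rewrite Rmult_1_r; apply: norm_ge_0.
Qed.

(** * Uniformity on compact intervals *)

(** One number serves both as the radius of the neighbourhood and as the parameter of [P]. It thus
    defines a gauge on the interval, and compactness bounds from below the gauges of tags that cover
    it; monotonicity of [P] then gives a common parameter. *)
Lemma itv_uniform (T : R) (P : R -> R -> Prop) :
  (forall t d d', P t d -> 0 < d' <= d -> P t d') ->
  (forall t, itv T t -> exists d, 0 < d /\ forall s, itv T s -> Rabs (s - t) < d -> P s d) ->
  exists d, 0 < d /\ forall s, itv T s -> P s d.
Proof.
move=> Hmono Hloc.
have Hd t : exists d : posreal, itv T t -> forall s, itv T s -> Rabs (s - t) < d -> P s d.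
  case: (classic (itv T t)) => [/Hloc [d [Hd Hs]]|Hn]; first by exists (mkposreal d Hd).
  by exists (mkposreal 1 Rlt_0_1).
pose delta t := proj1_sig (constructive_indefinite_description _ (Hd t)).
have Hdelta t : itv T t -> forall s, itv T s -> Rabs (s - t) < delta t -> P s (delta t)
  := proj2_sig (constructive_indefinite_description _ (Hd t)).
have [d Hd'] := compactness_value_1d 0 T delta.
exists d; split; first exact: cond_pos.
move=> s Hs; apply: NNPP => Hn; apply: (Hd' s Hs) => [[t [Ht [Hst Hdt]]]]; apply: Hn.
apply: Hmono (Hdelta t Ht s Hs Hst) _; split=> //; exact: cond_pos.
Qed.

Definition continuous_within {V : NormedModule R_AbsRing} (D : R -> Prop) (phi : R -> V) : Prop :=
  forall t, D t -> forall eps, 0 < eps -> exists delta, 0 < delta /\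
    forall s, D s -> Rabs (s - t) < delta -> norm (minus (phi s) (phi t)) < eps.

Lemma class_C0_continuous {V : NormedModule R_AbsRing} (D : R -> Prop) (phi : R -> V) :
  class_C (U := R_NormedModule) 0 D phi -> continuous_within D phi.
Proof.
move=> H t Dt eps He; have [|d [Hd K]] := H t Dt (eps / 2); first lra.
by exists d; split=> // s Ds Hs; have := K s Ds Hs tt; lra.
Qed.

Lemma itv_bounded {V : NormedModule R_AbsRing} T (phi : R -> V) :
  continuous_within (itv T) phi ->
  exists M, 0 <= M /\ forall t, itv T t -> norm (phi t) <= M.
Proof.
move=> H.
(* The uniformity principle produces a small positive number, so the large constant sought is
   encoded as its inverse. *)
case: (itv_uniform T (fun t d => norm (phi t) <= / d)).
- move=> t d d' Hd [Hd' Hdd']; apply: Rle_trans Hd _; exact: Rinv_le_contravar.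
- move=> t Ht; have [d [Hd K]] := H t Ht 1 Rlt_0_1.
  have Hp : 0 < norm (phi t) + 1 by have := norm_ge_0 (phi t); lra.
  exists (Rmin d (/ (norm (phi t) + 1))); split.
    by apply: Rmin_pos => //; apply: Rinv_0_lt_compat.
  move=> s Hs Hst.
  apply: (Rle_trans _ (norm (phi t) + 1)).
    have K' := K s Hs (Rlt_le_trans _ _ _ Hst (Rmin_l _ _)).
    have -> : phi s = plus (minus (phi s) (phi t)) (phi t) by module V.
    apply: Rle_trans (norm_plus_le _ _ _ _ (Rlt_le _ _ K') (Rle_refl _)) _; lra.
  rewrite -[X in X <= _]Rinv_inv; apply: Rinv_le_contravar; last exact: Rmin_r.
  by apply: Rmin_pos => //; apply: Rinv_0_lt_compat.
move=> d [Hd Hb]; exists (/ d); split=> //.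
by apply: Rlt_le; apply: Rinv_0_lt_compat.
Qed.

(** Uniformity around a curve in a space where balls are not compact. A single parameter d encodes
    both the radius d and the constant / d. The bound r / 2 on it leaves room for the motion of the
    curve, and / (L + 1) makes its inverse exceed L. *)
Lemma itv_tube {U : NormedModule R_AbsRing} T (c : R -> U) (Q : R -> U -> U -> Prop) :
  continuous_within (itv T) c ->
  (forall L L' y z, Q L y z -> L <= L' -> Q L' y z) ->
  (forall t, itv T t -> exists r L, 0 < r /\ 0 <= L /\ forall y z,
     norm (minus y (c t)) < r -> norm (minus z (c t)) < r -> Q L y z) ->
  exists r L, 0 < r /\ 0 <= L /\
    forall t, itv T t -> forall z, norm (minus z (c t)) < r -> Q L (c t) z.
Proof.
move=> Hc Hmono Hloc.
case: (itv_uniform T (fun t d => forall z, norm (minus z (c t)) < d -> Q (/ d) (c t) z)).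
- move=> t d d' H [Hd' Hdd'] z Hz; apply: Hmono (H z _) _; first lra.
  exact: Rinv_le_contravar.
- move=> t Ht; have [r [L [Hr [HL K]]]] := Hloc t Ht.
  have [|d [Hd Kc]] := Hc t Ht (r / 2); first lra.
  have HL1 : 0 < / (L + 1) by apply: Rinv_0_lt_compat; lra.
  exists (Rmin (Rmin d (r / 2)) (/ (L + 1))); split.
    by do 2 apply: Rmin_pos => //; lra.
  set m := Rmin _ _.
  have Hm1 : m <= d by apply: Rle_trans (Rmin_l _ _) (Rmin_l _ _).
  have Hm2 : m <= r / 2 by apply: Rle_trans (Rmin_l _ _) (Rmin_r _ _).
  have Hm3 : m <= / (L + 1) by apply: Rmin_r.
  have Hm0 : 0 < m by do 2 apply: Rmin_pos => //; lra.
  move=> s Hs Hst z Hz; apply: (Hmono L).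
    have Hcs : norm (minus (c s) (c t)) < r / 2 by apply: Kc => //; lra.
    apply: K; first lra.
    have -> : minus z (c t) = plus (minus z (c s)) (minus (c s) (c t)) by module U.
    by apply: Rle_lt_trans (norm_triangle _ _) _; lra.
  apply: (Rle_trans _ (L + 1)); first lra.
  by rewrite -[X in X <= _]Rinv_inv; apply: Rinv_le_contravar.
move=> d [Hd H]; exists d, (/ d); split=> //; split=> //.
by apply: Rlt_le; apply: Rinv_0_lt_compat.
Qed.

(** * Exponentially stable semigroups *)

Lemma is_RInt_linear {U V : NormedModule R_AbsRing} (L : U -> V) (phi : R -> U) a b l :
  is_linear L -> is_RInt phi a b l -> is_RInt (fun s => L (phi s)) a b (L l).
Proof.
move=> HL H.
apply: (filterlim_ext (fun ptd => L (scal (sign (b - a)) (Riemann_sum phi ptd)))).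
  move=> ptd; rewrite (linear_scal _ HL); congr scal.
  move: ptd; apply: SF_cons_ind => [x0|h s IH].
    by rewrite /Riemann_sum /= (linear_zero _ HL).
  by rewrite !Riemann_sum_cons (linear_plus _ HL) (linear_scal _ HL) IH.
exact: filterlim_comp H (linear_cont L l HL).
Qed.

Lemma filterlim_at_rightP {V : NormedModule R_AbsRing} (phi : R -> V) (l : V) :
  filterlim phi (at_right 0) (locally l) <->
  forall eps, 0 < eps -> exists d, 0 < d /\ forall h, 0 < h < d -> norm (minus (phi h) l) < eps.
Proof.
rewrite filterlim_locally_ball_norm; split=> H.
  move=> eps He; have [d Hd] := H (mkposreal eps He).
  exists d; split; first exact: cond_pos.
  move=> h Hh; apply: (Hd h); last by case: Hh.
  rewrite /ball /= /AbsRing_ball /abs /minus /plus /opp /= Ropp_0 Rplus_0_r.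
  rewrite Rabs_pos_eq; lra.
move=> eps; have [d [Hd K]] := H eps (cond_pos eps).
exists (mkposreal d Hd) => h Hh Hh0; apply: K; split=> //.
move: Hh; rewrite /ball /= /AbsRing_ball /abs /minus /plus /opp /= Ropp_0 Rplus_0_r.
by rewrite Rabs_pos_eq; lra.
Qed.

Section StableSemigroup.
Context {V : CompleteNormedModule R_AbsRing}.
Variables (E : R -> V -> V) (M a : R).

Record stable_semigroup : Prop := {
  ss_linear : forall t, 0 <= t -> is_linear (E t);
  ss_0 : forall x, E 0 x = x;
  ss_add : forall s t x, 0 <= s -> 0 <= t -> E (s + t) x = E s (E t x);
  ss_cont : forall x, filterlim (fun t => E t x) (at_right 0) (locally x);
  ss_bound : forall t x, 0 <= t -> norm (E t x) <= M * exp (a * t) * norm x;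
  ss_M : 0 <= M;
  ss_neg : a < 0
}.

Hypothesis HE : stable_semigroup.

Lemma ss_norm_le t x : 0 <= t -> norm (E t x) <= M * norm x.
Proof.
move=> Ht; apply: Rle_trans (ss_bound HE t x Ht) _.
have He : exp (a * t) <= 1.
  by rewrite -exp_0; case: (Req_dec t 0) => [->|Hn];
    [rewrite Rmult_0_r; apply: Rle_refl | apply: Rlt_le; apply: exp_increasing;
     have := ss_neg HE; nra].
rewrite -{2}(Rmult_1_r M); apply: Rmult_le_compat_r; first exact: norm_ge_0.
by apply: Rmult_le_compat_l => //; apply: ss_M HE.
Qed.

Lemma ss_comm s t x : 0 <= s -> 0 <= t -> E s (E t x) = E t (E s x).
Proof. by move=> Hs Ht; rewrite -!(ss_add HE) // Rplus_comm. Qed.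

(** [E] is only constrained at nonnegative times; composing with the absolute value gives a function
    continuous on the whole line, as integrability requires. The difference of E at p + q and p is E
    p applied to E q x - x, so right continuity at 0 and the uniform bound M give continuity from
    both sides. *)
Lemma ss_continuous_at x t : continuous (fun s => E (Rabs s) x) t.
Proof.
apply/filterlim_locally_ball_norm => eps.
have HM1 : 0 < M + 1 by have := ss_M HE; lra.
have [d [Hd K]] := proj1 (filterlim_at_rightP _ _) (ss_cont HE x) _
  (Rdiv_lt_0_compat _ _ (cond_pos eps) HM1).
exists (mkposreal d Hd) => s Hs.
have Hst : Rabs (Rabs s - Rabs t) < d.
  by apply: Rle_lt_trans (Rabs_triang_inv2 s t) _; exact: Hs.
have H p q : 0 <= p -> 0 < q < d -> norm (minus (E (p + q) x) (E p x)) < eps.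
  move=> Hp Hq.
  rewrite (ss_add HE) ?Rle_0_1 //; last lra.
  rewrite -(linear_minus _ _ _ (ss_linear HE p Hp)).
  apply: Rle_lt_trans (ss_norm_le _ _ Hp) _.
  have Kq := K q Hq; have Hn := norm_ge_0 (minus (E q x) x); have HM0 := ss_M HE.
  apply: (Rle_lt_trans _ ((M + 1) * norm (minus (E q x) x))).
    by apply: Rmult_le_compat_r; [exact: norm_ge_0 | lra].
  have -> : pos eps = (M + 1) * (eps / (M + 1)) by field; lra.
  exact: Rmult_lt_compat_l.
have Hs0 := Rabs_pos s; have Ht0 := Rabs_pos t.
rewrite /ball_norm.
case: (Rtotal_order (Rabs s) (Rabs t)) => [Hlt|[->|Hlt]].
- rewrite norm_minus_sym; have -> : Rabs t = Rabs s + (Rabs t - Rabs s) by ring.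
  by apply: H => //; split; [lra | rewrite Rabs_minus_sym Rabs_pos_eq in Hst; lra].
- by rewrite minus_eq_zero norm_zero; apply: cond_pos.
- have -> : Rabs s = Rabs t + (Rabs s - Rabs t) by ring.
  by apply: H => //; split; [lra | rewrite Rabs_pos_eq in Hst; lra].
Qed.

Lemma ss_ex_RInt x b c : 0 <= b -> 0 <= c -> ex_RInt (fun t => E t x) b c.
Proof.
move=> Hb Hc; apply: (ex_RInt_ext (fun t => E (Rabs t) x)).
  move=> t [Ht _]; rewrite Rabs_pos_eq //; have := Rmin_glb _ _ _ Hb Hc; lra.
by apply: ex_RInt_continuous => t _; apply: ss_continuous_at.
Qed.

Definition orbit_int (s : R) (x : V) : V := RInt (fun t => E t x) 0 s.

Lemma orbit_int_correct s x : 0 <= s -> is_RInt (fun t => E t x) 0 s (orbit_int s x).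
Proof. by move=> Hs; apply: RInt_correct; apply: ss_ex_RInt => //; apply: Rle_refl. Qed.

Lemma orbit_int_norm s x : 0 <= s -> norm (orbit_int s x) <= s * (M * norm x).
Proof.
move=> Hs; rewrite -[X in _ <= X * _](Rminus_0_r s).
apply: norm_RInt_le_const (orbit_int_correct s x Hs) => // t Ht.
by apply: ss_norm_le; lra.
Qed.

Lemma orbit_int_linear s : 0 <= s -> is_linear (orbit_int s).
Proof.
move=> Hs; split.
- move=> x y; rewrite /orbit_int -RInt_plus; try by apply: ss_ex_RInt => //; lra.
  apply: RInt_ext => t; rewrite Rmin_left // => -[Ht _].
  by apply: (linear_plus _ (ss_linear HE t _)); lra.
- move=> r x; rewrite /orbit_int -RInt_scal; try by apply: ss_ex_RInt => //; lra.
  apply: RInt_ext => t; rewrite Rmin_left // => -[Ht _].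
  by apply: (linear_scal _ (ss_linear HE t _)); lra.
- exists (s * M + 1); split; first by have := Rmult_le_pos _ _ Hs (ss_M HE); lra.
  move=> x; apply: Rle_trans (orbit_int_norm s x Hs) _; have := norm_ge_0 x; lra.
Qed.

Lemma orbit_int_comm h s x : 0 <= h -> 0 <= s -> E h (orbit_int s x) = orbit_int s (E h x).
Proof.
move=> Hh Hs; apply: eq_sym; apply: is_RInt_unique.
apply: (is_RInt_ext (fun t => E h (E t x))).
  by move=> t; rewrite Rmin_left // => -[Ht _]; apply: ss_comm => //; lra.
by apply: is_RInt_linear (orbit_int_correct _ _ _) => //; apply: ss_linear HE _ _.
Qed.

Lemma orbit_int_add h s x : 0 <= h -> 0 <= s ->
  orbit_int (h + s) x = plus (E h (orbit_int s x)) (orbit_int h x).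
Proof.
move=> Hh Hs.
have -> : E h (orbit_int s x) = RInt (fun t => E t x) h (h + s).
  have H := is_RInt_linear _ _ _ _ _ (ss_linear HE h Hh) (orbit_int_correct s x Hs).
  rewrite -(is_RInt_unique _ _ _ _ H).
  have Hx : ex_RInt (fun t => E t x) (1 * 0 + h) (1 * s + h) by apply: ss_ex_RInt; lra.
  have := RInt_comp_lin _ _ _ _ _ Hx.
  have -> : 1 * 0 + h = h by ring.
  have -> : 1 * s + h = h + s by ring.
  move=> <-; apply: RInt_ext => t; rewrite Rmin_left // => -[Ht _].
  rewrite (scal_one (E _ x)) -(ss_add HE) //; last lra.
  by congr (E _ x); ring.
by rewrite plus_comm; apply: eq_sym; apply: RInt_Chasles; apply: ss_ex_RInt; lra.
Qed.

(** The integral up to h + s can be split at h or at s; comparing the two splittings exchanges h and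
    s. Dividing by h and letting h tend to 0 then yields the generator on the integral, without
    differentiating an orbit. *)
Lemma orbit_int_incr h s x : 0 <= h -> 0 <= s ->
  minus (E h (orbit_int s x)) (orbit_int s x) = minus (E s (orbit_int h x)) (orbit_int h x).
Proof.
move=> Hh Hs; have := orbit_int_add h s x Hh Hs; rewrite Rplus_comm orbit_int_add //.
move=> H.
have -> : E h (orbit_int s x) =
  minus (plus (E h (orbit_int s x)) (orbit_int h x)) (orbit_int h x) by module V.
by rewrite -H; module V.
Qed.

Lemma orbit_int_mean x :
  filterlim (fun h => scal (/ h) (orbit_int h x)) (at_right 0) (locally x).
Proof.
apply/filterlim_at_rightP => eps He.
have He2 : 0 < eps / 2 by lra.
have [d [Hd K]] := proj1 (filterlim_at_rightP _ _) (ss_cont HE x) _ He2.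
exists d; split=> // h Hh.
have H : is_RInt (fun t => minus (E t x) x) 0 h (minus (orbit_int h x) (scal (h - 0) x)).
  by apply: is_RInt_minus (is_RInt_const _ _ _); apply: orbit_int_correct; lra.
have -> : minus (scal (/ h) (orbit_int h x)) x =
  scal (/ h) (minus (orbit_int h x) (scal (h - 0) x)) by module V; field; lra.
rewrite norm_scal_R Rabs_pos_eq; last by apply: Rlt_le; apply: Rinv_0_lt_compat; lra.
apply: (Rle_lt_trans _ (/ h * ((h - 0) * (eps / 2)))); last first.
  by rewrite Rminus_0_r -Rmult_assoc Rinv_l; lra.
apply: Rmult_le_compat_l; first by apply: Rlt_le; apply: Rinv_0_lt_compat; lra.
apply: norm_RInt_le_const H; first lra.
move=> t Ht; case: (Req_dec t 0) => [->|Ht0].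
  by rewrite (ss_0 HE) minus_eq_zero norm_zero; lra.
by apply: Rlt_le; apply: K; lra.
Qed.

(** * The generator, its bounded inverse and variation-of-constants integrals *)

Lemma limit_unique {S : Type} {F : (S -> Prop) -> Prop} {FF : ProperFilter' F} (phi : S -> V) x y :
  filterlim phi F (locally x) -> filterlim phi F (locally y) -> x = y.
Proof. exact: (filterlim_locally_unique (K := R_AbsRing) (V := V) phi x y). Qed.

(** The graph of the generator as a relation, so that no domain has to be carried along. *)
Definition generator (x y : V) : Prop :=
  filterlim (fun t => scal (/ t) (minus (E t x) x)) (at_right 0) (locally y).

Lemma generator_linear c x y x' y' : generator x y -> generator x' y' ->
  generator (plus x (scal c x')) (plus y (scal c y')).
Proof.
move=> /filterlim_at_rightP H /filterlim_at_rightP H'; apply/filterlim_at_rightP => eps He.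
have Hc : 0 < Rabs c + 1 by have := Rabs_pos c; lra.
have He2 : 0 < eps / 2 by lra.
have [d [Hd K]] := H _ He2.
have [d' [Hd' K']] := H' _ (Rdiv_lt_0_compat _ _ He2 Hc).
exists (Rmin d d'); split; first exact: Rmin_pos.
move=> h [Hh0 Hh].
have {}K := K h (conj Hh0 (Rlt_le_trans _ _ _ Hh (Rmin_l _ _))).
have {}K' := K' h (conj Hh0 (Rlt_le_trans _ _ _ Hh (Rmin_r _ _))).
have Hl := ss_linear HE h (Rlt_le _ _ Hh0).
rewrite (linear_plus _ Hl) (linear_scal _ Hl).
have -> : minus (scal (/ h) (minus (plus (E h x) (scal c (E h x'))) (plus x (scal c x'))))
    (plus y (scal c y')) =
  plus (minus (scal (/ h) (minus (E h x) x)) y) (scal c (minus (scal (/ h) (minus (E h x') x')) y'))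
  by module V.
have -> : eps = eps / 2 + eps / 2 by field.
apply: norm_plus_lt; first exact: K.
rewrite norm_scal_R.
apply: (Rle_trans _ ((Rabs c + 1) * (eps / 2 / (Rabs c + 1)))).
  by apply: Rmult_le_compat; [exact: Rabs_pos | exact: norm_ge_0 | lra | exact: Rlt_le].
by apply: Req_le; field; lra.
Qed.

Lemma generator_map x y (L : V -> V) : is_linear L ->
  (forall h z, 0 <= h -> E h (L z) = L (E h z)) -> generator x y -> generator (L x) (L y).
Proof.
move=> HL HC H.
apply: filterlim_ext_loc (filterlim_comp _ _ _ _ _ _ _ _ H (linear_cont L y HL)).
exists (mkposreal 1 Rlt_0_1) => h _ Hh.
by rewrite (linear_scal _ HL) (linear_minus _ _ _ HL) HC //; apply: Rlt_le.
Qed.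

(** The generator is computed at the integral of the orbit of x in two ways. Integration commutes
    with the semigroup, so it maps the graph to itself and gives the integral of the orbit of y; the
    exchange of h and s gives E s x - x. Limits are unique. *)
Lemma generator_orbit_int s x y : 0 <= s -> generator x y ->
  orbit_int s y = minus (E s x) x.
Proof.
move=> Hs H.
have H1 : generator (orbit_int s x) (orbit_int s y).
  apply: generator_map H; first exact: orbit_int_linear.
  by move=> h z Hh; apply: orbit_int_comm.
have HL : is_linear (fun z : V => minus (E s z) z).
  exact: (is_linear_comp _ _ (is_linear_prod _ _ (ss_linear HE s Hs) is_linear_opp)
            is_linear_plus).
have H2 : generator (orbit_int s x) (minus (E s x) x).
  apply: filterlim_ext_loc (filterlim_comp _ _ _ _ _ _ _ _ (orbit_int_mean x)
    (linear_cont _ x HL)).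
  exists (mkposreal 1 Rlt_0_1) => h _ Hh.
  by rewrite (linear_scal _ HL) orbit_int_incr //; apply: Rlt_le.
exact: (limit_unique (F := at_right 0) _ _ _ H1 H2).
Qed.

Lemma ss_half : exists s, 0 <= s /\ forall x, norm (E s x) <= / 2 * norm x.
Proof.
have Ha := ss_neg HE; have HM := ss_M HE.
(* At time (2 M + 1) / (- a) the exponential is e^{-(2 M + 1)} <= 1 / (2 M + 1), and M / (2 M + 1)
   <= 1/2. *)
have Hln : exp (a * ((2 * M + 1) / - a)) <= / (2 * M + 1).
  have -> : a * ((2 * M + 1) / - a) = - (2 * M + 1) by field; lra.
  rewrite exp_Ropp; apply: Rinv_le_contravar; first lra.
  by have := exp_ineq1 (2 * M + 1); lra.
exists ((2 * M + 1) / - a); have Hs : 0 <= (2 * M + 1) / - a.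
  by apply: Rlt_le; apply: Rdiv_lt_0_compat; lra.
split=> // x; apply: Rle_trans (ss_bound HE _ _ Hs) _.
apply: Rmult_le_compat_r; first exact: norm_ge_0.
apply: Rle_trans (Rmult_le_compat_l _ _ _ HM Hln) _.
apply: (Rmult_le_reg_r (2 * M + 1)); first lra.
by rewrite Rmult_assoc Rinv_l; lra.
Qed.

(** In x = E s x - (integral of the orbit of y up to s), a time s with |E s x| <= |x| / 2 lets the
    first term be absorbed on the left. This bounds the inverse and gives injectivity. *)
Lemma generator_bound : exists C, 0 <= C /\ forall x y, generator x y -> norm x <= C * norm y.
Proof.
have [s [Hs Hhalf]] := ss_half.
exists (2 * (s * M)); split.
  by apply: Rmult_le_pos; [lra | apply: Rmult_le_pos => //; apply: ss_M HE].
move=> x y H.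
have Hx : x = minus (E s x) (orbit_int s y).
  by rewrite (generator_orbit_int s x y) //; module V.
have := norm_minus_le _ _ _ _ (Hhalf x) (orbit_int_norm s y Hs); rewrite -Hx; lra.
Qed.

Lemma generator_unique x x' y : generator x y -> generator x' y -> x = x'.
Proof.
move=> H H'.
have [C [_ HC]] := generator_bound.
have := HC _ _ (generator_linear (-1) _ _ _ _ H H').
have -> : plus y (scal (-1) y) = zero by module V.
rewrite norm_zero Rmult_0_r => Hn.
have Hz : plus x (scal (-1) x') = zero.
  by apply: norm_eq_zero; apply: Rle_antisym => //; apply: norm_ge_0.
have -> : x = plus (plus x (scal (-1) x')) x' by module V.
by rewrite Hz plus_zero_l.
Qed.

Lemma orbit_int_cauchy y s t : 0 <= s <= t ->
  norm (minus (orbit_int t y) (orbit_int s y)) <= M * norm y / - a * exp (a * s).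
Proof.
move=> Hst; have Ha := ss_neg HE.
have Ec : minus (orbit_int t y) (orbit_int s y) = RInt (fun r => E r y) s t.
  rewrite /orbit_int -(RInt_Chasles (fun r => E r y) 0 s t); try by apply: ss_ex_RInt; lra.
  by rewrite -/(orbit_int s y); module V.
have HR : is_RInt (fun r => M * norm y * exp (a * r)) s t
    (minus (M * norm y / a * exp (a * t)) (M * norm y / a * exp (a * s))).
  apply: (is_RInt_derive (fun r => M * norm y / a * exp (a * r))) => r _.
    by auto_derive => //; field; lra.
  apply: (continuous_scal_r (M * norm y) (fun r => exp (a * r))).
  apply: continuous_comp; last exact: continuous_exp.
  exact: (continuous_scal_r a (fun r => r) r (continuous_id r)).
rewrite Ec; apply: Rle_trans (norm_RInt_le _ _ _ _ _ _ _ _ (RInt_correct _ _ _ _) HR) _.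
- lra.
- move=> r Hr; have -> : M * norm y * exp (a * r) = M * exp (a * r) * norm y by ring.
  by apply: ss_bound HE _ _ _; lra.
- by apply: ss_ex_RInt; lra.
have Hc : 0 <= M * norm y / - a.
  apply: Rmult_le_pos; first by apply: Rmult_le_pos (ss_M HE) (norm_ge_0 _).
  by apply: Rlt_le; apply: Rinv_0_lt_compat; lra.
have -> : minus (M * norm y / a * exp (a * t)) (M * norm y / a * exp (a * s)) =
  M * norm y / - a * exp (a * s) - M * norm y / - a * exp (a * t).
  by rewrite /minus /plus /opp /=; field; lra.
have := Rmult_le_pos _ _ Hc (Rlt_le _ _ (exp_pos (a * t))); lra.
Qed.

(** The preimage is minus the integral of E t y over the half line, convergent by the exponential
    bound. With z the full integral, z - E h z is the limit for large s of I_h - E s I_h, where I_h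
    is the integral up to h, and the second term decays; dividing by h leaves the mean value of the
    orbit, which tends to y. *)
Lemma generator_surj y : exists x, generator x y.
Proof.
have Ha := ss_neg HE.
have [z Hz] : exists z, filterlim (fun s => orbit_int s y) (Rbar_locally p_infty) (locally z).
  apply/filterlim_locally_cauchy => eps.
  have He : 0 < eps / 2 by have := cond_pos eps; lra.
  have Hc : 0 < M * norm y / - a + 1.
    have : 0 <= M * norm y / - a; last lra.
    apply: Rmult_le_pos; first by apply: Rmult_le_pos (ss_M HE) (norm_ge_0 _).
    by apply: Rlt_le; apply: Rinv_0_lt_compat; lra.
  set c := M * norm y / - a + 1 in Hc *.
  (* From this time on c e^{as} is at most eps / 2; the division by a < 0 reverses the inequality,
     and the maximum keeps the time nonnegative. *)
  pose s0 := Rmax 0 (ln (eps / 2 / c) / a).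
  have Hs0 : c * exp (a * s0) <= eps / 2.
    have Hq : 0 < eps / 2 / c by apply: Rdiv_lt_0_compat.
    have : exp (a * s0) <= eps / 2 / c.
      rewrite -(exp_ln (eps / 2 / c)) //.
      have : a * s0 <= ln (eps / 2 / c).
        have -> : ln (eps / 2 / c) = a * (ln (eps / 2 / c) / a) by field; lra.
        by have := Rmax_r 0 (ln (eps / 2 / c) / a); rewrite -/s0; nra.
      case=> [/exp_increasing/Rlt_le //|->]; exact: Rle_refl.
    move=> H; apply: Rle_trans (Rmult_le_compat_l _ _ _ (Rlt_le _ _ Hc) H) _.
    by apply: Req_le; field; lra.
  have Hs00 : 0 <= s0 by apply: Rmax_l.
  exists (fun s => s0 < s); split; first by exists s0.
  move=> s t Hs Ht; apply: (norm_compat1 (V := V)).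
  have B r : s0 < r -> norm (minus (orbit_int r y) (orbit_int s0 y)) < eps / 2.
    move=> Hr; apply: Rle_lt_trans (orbit_int_cauchy y s0 r _) _; first lra.
    apply: Rlt_le_trans Hs0; apply: Rmult_lt_compat_r; first exact: exp_pos.
    by rewrite /c; lra.
  have -> : minus (orbit_int t y) (orbit_int s y) =
    minus (minus (orbit_int t y) (orbit_int s0 y)) (minus (orbit_int s y) (orbit_int s0 y)).
    by module V.
  apply: Rle_lt_trans (norm_minus_le _ _ _ _ (Rle_refl _) (Rle_refl _)) _.
  by have := B s Hs; have := B t Ht; lra.
exists (opp z).
apply: filterlim_ext_loc (orbit_int_mean y).
exists (mkposreal 1 Rlt_0_1) => h _ Hh; congr scal.
have HL := ss_linear HE h (Rlt_le _ _ Hh).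
have HL' : is_linear (fun z : V => minus z (E h z)).
  exact: (is_linear_comp _ _ (is_linear_prod _ _ is_linear_id (is_linear_comp _ _ HL is_linear_opp))
            is_linear_plus).
have -> : minus (E h (opp z)) (opp z) = minus z (E h z).
  by rewrite (linear_opp _ _ HL); module V.
have H1 := filterlim_comp _ _ _ _ _ _ _ _ Hz (linear_cont _ z HL').
have H2 : filterlim (fun s => minus (orbit_int h y) (E s (orbit_int h y))) (Rbar_locally p_infty)
    (locally (orbit_int h y)).
  apply/filterlim_locally_ball_norm => eps.
  have Hc : 0 < M * norm (orbit_int h y) + 1.
    by have := Rmult_le_pos _ _ (ss_M HE) (norm_ge_0 (orbit_int h y)); lra.
  set c := M * norm (orbit_int h y) + 1 in Hc *.
  exists (Rmax 0 (ln (eps / c) / a)) => s Hs; rewrite /ball_norm.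
  have -> : minus (minus (orbit_int h y) (E s (orbit_int h y))) (orbit_int h y) =
    opp (E s (orbit_int h y)) by module V.
  have Hs0 : 0 < s by apply: Rle_lt_trans (Rmax_l _ _) Hs.
  have Hs1 : ln (eps / c) / a < s by apply: Rle_lt_trans (Rmax_r _ _) Hs.
  rewrite norm_opp; apply: Rle_lt_trans (ss_bound HE _ _ (Rlt_le _ _ Hs0)) _.
  have Hq : 0 < eps / c by apply: Rdiv_lt_0_compat => //; apply: cond_pos.
  have Hexp : exp (a * s) < eps / c.
    rewrite -(exp_ln (eps / c)) //; apply: exp_increasing.
    have -> : ln (eps / c) = a * (ln (eps / c) / a) by field; lra.
    by nra.
  have -> : pos eps = eps / c * c by field; lra.
  apply: (Rle_lt_trans _ (exp (a * s) * c)).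
    by rewrite /c; have := exp_pos (a * s); lra.
  exact: Rmult_lt_compat_r.
apply: eq_sym; apply: (limit_unique (F := Rbar_locally p_infty) _ _ _ H1).
apply: filterlim_ext_loc H2.
exists 0 => s Hs; have Hs' := Rlt_le _ _ Hs.
have := orbit_int_incr h s y (Rlt_le _ _ Hh) Hs' => He.
have -> : minus (orbit_int s y) (E h (orbit_int s y)) =
  opp (minus (E h (orbit_int s y)) (orbit_int s y)) by module V.
by rewrite He; module V.
Qed.

Variable B : V -> V.
Hypothesis HB : forall y, generator (B y) y.

Lemma geninv_linear : is_linear B.
Proof.
have [C [HC0 HC]] := generator_bound.
have H0 : B zero = zero.
  apply: norm_eq_zero; apply: Rle_antisym; last exact: norm_ge_0.
  by have := HC _ _ (HB zero); rewrite norm_zero Rmult_0_r.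
split.
- move=> x y; apply: generator_unique (HB _) _.
  have := generator_linear 1 _ _ _ _ (HB x) (HB y).
  by rewrite (scal_one y) (scal_one (B y)).
- move=> c x; apply: generator_unique (HB _) _.
  have := generator_linear c _ _ _ _ (HB zero) (HB x).
  by rewrite H0 !plus_zero_l.
- exists (C + 1); split; first lra.
  by move=> x; have := HC _ _ (HB x); have := norm_ge_0 x; lra.
Qed.

Lemma geninv_comm s y : 0 <= s -> B (E s y) = E s (B y).
Proof.
move=> Hs; apply: generator_unique (HB _) _.
apply: generator_map (HB y); first exact: ss_linear HE _ _.
by move=> h z Hh; apply: ss_comm.
Qed.

Lemma geninv_incr s y : 0 <= s -> norm (minus (E s (B y)) (B y)) <= s * (M * norm y).
Proof.
move=> Hs; rewrite -(generator_orbit_int s (B y) y) //; exact: orbit_int_norm.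
Qed.

(** Every inhomogeneity in a step is a scalar function of time, 1 or tau, times a fixed vector.
    Keeping the scalar factor apart reduces integrability to the continuity of single orbits. *)
Definition duhamel (phi : R -> R) (s : R) (w : V) : V :=
  RInt (fun tau => E (s - tau) (scal (phi tau) w)) 0 s.

Lemma duhamel_correct (phi : R -> R) s (w : V) : 0 <= s -> (forall t, continuous phi t) ->
  is_RInt (fun tau => E (s - tau) (scal (phi tau) w)) 0 s (duhamel phi s w).
Proof.
move=> Hs Hphi; apply: RInt_correct.
apply: (ex_RInt_ext (fun tau => scal (phi tau) (E (Rabs (s - tau)) w))).
  move=> t; rewrite Rmin_left // Rmax_right // => Ht.
  rewrite Rabs_pos_eq; last lra.
  by rewrite (linear_scal _ (ss_linear HE (s - t) _)) //; lra.
apply: ex_RInt_continuous => t _; apply: continuous_scal; first exact: Hphi.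
apply: (continuous_comp (fun tau => s - tau) (fun r => E (Rabs r) w)); last exact: ss_continuous_at.
by apply: (continuous_minus (V := R_NormedModule) (fun _ => s) (fun r => r));
  [apply: continuous_const | apply: continuous_id].
Qed.

Lemma duhamel_norm (phi : R -> R) s (w : V) c : 0 <= s -> (forall t, continuous phi t) ->
  (forall t, 0 <= t <= s -> Rabs (phi t) <= c) ->
  norm (duhamel phi s w) <= s * (c * (M * norm w)).
Proof.
move=> Hs Hphi Hc; rewrite -[X in _ <= X * _](Rminus_0_r s).
apply: norm_RInt_le_const (duhamel_correct phi s w Hs Hphi) => // t Ht.
apply: Rle_trans (ss_norm_le _ _ _) _; first lra.
rewrite norm_scal_R.
have := Rmult_le_compat_r _ _ _ (Rmult_le_pos _ _ (ss_M HE) (norm_ge_0 w)) (Hc t Ht); lra.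
Qed.

(** [B] passes through the integral and commutes with the semigroup, and |E (s - t) (B w) - B w| <=
    (s - t) M |w|. Replacing E by the identity under the integral therefore costs one more factor s
    and leaves the scalar integral l. *)
Lemma geninv_duhamel (phi : R -> R) s (w : V) c l : 0 <= s -> (forall t, continuous phi t) ->
  (forall t, 0 <= t <= s -> Rabs (phi t) <= c) -> is_RInt phi 0 s l ->
  norm (minus (B (duhamel phi s w)) (scal l (B w))) <= s * (c * (s * (M * norm w))).
Proof.
move=> Hs Hphi Hc Hl; rewrite -[X in _ <= X * _](Rminus_0_r s).
have H1 := is_RInt_linear _ _ _ _ _ geninv_linear (duhamel_correct phi s w Hs Hphi).
have H2 := is_RInt_linear _ _ _ _ _ (is_linear_scal_l (B w)) Hl.
apply: norm_RInt_le_const (is_RInt_minus _ _ _ _ _ _ H1 H2) => // t Ht.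
rewrite geninv_comm; last lra.
rewrite (linear_scal _ geninv_linear) (linear_scal _ (ss_linear HE (s - t) _)); last lra.
have -> : minus (scal (phi t) (E (s - t) (B w))) (scal (phi t) (B w)) =
  scal (phi t) (minus (E (s - t) (B w)) (B w)) by module V.
rewrite norm_scal_R.
apply: Rmult_le_compat; [exact: Rabs_pos | exact: norm_ge_0 | exact: Hc |].
apply: Rle_trans (geninv_incr (s - t) w _) _; first lra.
apply: Rmult_le_compat_r; last lra.
exact: Rmult_le_pos (ss_M HE) (norm_ge_0 w).
Qed.

End StableSemigroup.

(** * Uniform orders in the step size *)

Section UniformOrder.
Variable T : R.

Definition valid_step (k : R) (n : nat) : Prop := 0 < k /\ INR (S n) * k <= T.

Lemma valid_step_end k n : INR (S n) * k = INR n * k + k.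
Proof. by rewrite S_INR; ring. Qed.

Lemma valid_step_itv k n c : valid_step k n -> 0 <= c <= 1 -> itv T (INR n * k + c * k).
Proof.
move=> [Hk]; rewrite valid_step_end => HT Hc.
have Hn : 0 <= INR n * k by apply: Rmult_le_pos; [apply: pos_INR | lra].
by split; nra.
Qed.

Lemma valid_step_itv0 k n : valid_step k n -> itv T (INR n * k).
Proof.
move=> H; have -> : INR n * k = INR n * k + 0 * k by ring.
by apply: valid_step_itv => //; lra.
Qed.

(** The same condition as [step_bigO] over a real space; after restriction of scalars the two are
    convertible. *)
Definition bigO {V : NormedModule R_AbsRing} (e : R -> nat -> V) (p : nat) : Prop :=
  exists C k0, 0 < k0 /\ forall k n, 0 < k <= k0 -> INR (S n) * k <= T ->
    norm (e k n) <= C * k ^ p.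

Context {V W : NormedModule R_AbsRing}.
Implicit Types e : R -> nat -> V.

Lemma bigO_bound e p C : (forall k n, valid_step k n -> norm (e k n) <= C * k ^ p) -> bigO e p.
Proof. by move=> H; exists C, 1; split=> [|k n Hk HT]; [lra | apply: H; split; lra]. Qed.

Lemma bigO_eq e e' p : (forall k n, valid_step k n -> e k n = e' k n) -> bigO e' p -> bigO e p.
Proof.
move=> H [C [k0 [Hk0 K]]]; exists C, k0; split=> // k n Hk HT.
by rewrite H; [apply: K | split; lra].
Qed.

Lemma bigO_pos e p : bigO e p -> exists C k0, 0 <= C /\ 0 < k0 /\
  forall k n, 0 < k <= k0 -> INR (S n) * k <= T -> norm (e k n) <= C * k ^ p.
Proof.
move=> [C [k0 [Hk0 K]]]; exists (Rabs C), k0; split; first exact: Rabs_pos.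
split=> // k n Hk HT; apply: Rle_trans (K k n Hk HT) _.
by apply: Rmult_le_compat_r; [apply: pow_le; lra | apply: Rle_abs].
Qed.

Lemma bigO_dom (e' : R -> nat -> W) e p C : 0 <= C ->
  (forall k n, valid_step k n -> norm (e' k n) <= C * norm (e k n)) ->
  bigO e p -> bigO (V := W) e' p.
Proof.
move=> HC H [D [k0 [Hk0 K]]]; exists (C * D), k0; split=> // k n Hk HT.
apply: Rle_trans (H k n _) _; first by split; lra.
by rewrite Rmult_assoc; apply: Rmult_le_compat_l => //; apply: K.
Qed.
End UniformOrder.

Section UniformOrderAlgebra.
Variable T : R.
Context {V W : NormedModule R_AbsRing}.
Implicit Types e : R -> nat -> V.

Lemma bigO_plus e e' p : bigO T e p -> bigO T e' p -> bigO T (fun k n => plus (e k n) (e' k n)) p.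
Proof.
move=> [C [k0 [Hk0 K]]] [C' [k0' [Hk0' K']]]; exists (C + C'), (Rmin k0 k0').
split=> [|k n [Hk Hk'] HT]; first exact: Rmin_pos.
rewrite Rmult_plus_distr_r; apply: norm_plus_le.
  by apply: K => //; have := Rmin_l k0 k0'; lra.
by apply: K' => //; have := Rmin_r k0 k0'; lra.
Qed.

Lemma bigO_scal e p c : bigO T e p -> bigO T (fun k n => scal c (e k n)) p.
Proof.
apply: (bigO_dom T _ _ p (Rabs c)); first exact: Rabs_pos.
by move=> k n _; apply: Req_le; apply: norm_scal_R.
Qed.

Lemma bigO_minus e e' p : bigO T e p -> bigO T e' p ->
  bigO T (fun k n => minus (e k n) (e' k n)) p.
Proof.
move=> H H'; apply: bigO_eq (bigO_plus _ _ _ H (bigO_scal _ _ (-1) H')).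
by move=> k n _; module V.
Qed.

Lemma bigO_linear (L : V -> W) e p : is_linear L -> bigO T e p -> bigO T (fun k n => L (e k n)) p.
Proof.
move=> HL; have [M [HM K]] := linear_norm _ HL.
by apply: (bigO_dom T _ _ p M); [lra | move=> k n _; apply: K].
Qed.

Lemma bigO_step e p : bigO T e p -> bigO T (fun k n => scal k (e k n)) (S p).
Proof.
move=> [C [k0 [Hk0 K]]]; exists C, k0; split=> // k n Hk HT.
rewrite norm_scal_R Rabs_pos_eq; last lra.
have -> : C * k ^ S p = k * (C * k ^ p) by rewrite /=; ring.
by apply: Rmult_le_compat_l; [lra | apply: K].
Qed.

Lemma bigO_weaken e p : bigO T e (S p) -> bigO T e p.
Proof.
move=> /bigO_pos [C [k0 [HC [Hk0 K]]]]; exists C, (Rmin k0 1).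
split=> [|k n [Hk Hk'] HT]; first by apply: Rmin_pos; lra.
apply: Rle_trans (K k n _ HT) _; first by have := Rmin_l k0 1; lra.
apply: Rmult_le_compat_l => //=; rewrite -[X in _ <= X]Rmult_1_l.
by apply: Rmult_le_compat_r; [apply: pow_le; lra | have := Rmin_r k0 1; lra].
Qed.

Lemma bigO_zero p : bigO T (fun _ _ => zero : V) p.
Proof.
apply: (bigO_bound T _ p 0) => k n _; rewrite norm_zero; lra.
Qed.

Lemma bigO_sum (e : nat -> R -> nat -> V) p a b :
  (forall i, (a <= i <= b)%nat -> bigO T (e i) p) ->
  bigO T (fun k n => sum_n_m (fun i => e i k n) a b) p.
Proof.
elim: b => [|b IH] H.
  case: a H => [|a] H; last by apply: bigO_eq (bigO_zero p) => k n _; rewrite sum_n_m_zero //; lia.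
  by apply: bigO_eq (H 0%nat _) => [k n _|]; [rewrite sum_n_n | lia].
case: (Compare_dec.le_lt_dec a (S b)) => Hab; last first.
  by apply: bigO_eq (bigO_zero p) => k n _; rewrite sum_n_m_zero //; lia.
apply: bigO_eq (bigO_plus _ _ _ (IH _) (H (S b) _)); last lia.
  by move=> k n _; rewrite sum_n_Sm.
by move=> i Hi; apply: H; lia.
Qed.

Lemma linear_sum_n_m (L : V -> W) (x : nat -> V) a b : is_linear L ->
  L (sum_n_m x a b) = sum_n_m (fun i => L (x i)) a b.
Proof.
move=> HL; elim: b => [|b IH].
  by case: a => [|a]; [rewrite !sum_n_n | rewrite !sum_n_m_zero ?(linear_zero _ HL) //; lia].
case: (Compare_dec.le_lt_dec a (S b)) => Hab; last first.
  by rewrite !sum_n_m_zero ?(linear_zero _ HL).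
by rewrite !sum_n_Sm // (linear_plus _ HL) IH.
Qed.

Lemma sum_n_m_minus (x y : nat -> V) a b :
  minus (sum_n_m x a b) (sum_n_m y a b) = sum_n_m (fun i => minus (x i) (y i)) a b.
Proof.
rewrite sum_n_m_plus; congr plus.
elim: b => [|b IH].
  case: a => [|a]; first by rewrite !sum_n_n.
  by rewrite !sum_n_m_zero ?opp_zero //; lia.
case: (Compare_dec.le_lt_dec a (S b)) => Hab; last by rewrite !sum_n_m_zero ?opp_zero.
by rewrite !sum_n_Sm // opp_plus IH.
Qed.

(** Terms of weight zero are exempt from the estimate: when a_ij = 0 the order c_j <= c_i is not
    guaranteed, and the semigroup could be evaluated at a negative time. *)
Lemma bigO_sum_diff (x y : nat -> R -> nat -> V) (c : nat -> R) p a b :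
  (forall i, (a <= i <= b)%nat -> c i <> 0 -> bigO T (fun k n => minus (x i k n) (y i k n)) p) ->
  bigO T (fun k n => minus (sum_n_m (fun i => scal (c i) (x i k n)) a b)
                       (sum_n_m (fun i => scal (c i) (y i k n)) a b)) p.
Proof.
move=> H.
apply: (bigO_eq T _ (fun k n => sum_n_m (fun i => scal (c i) (minus (x i k n) (y i k n))) a b)).
  move=> k n _; rewrite sum_n_m_minus; apply: sum_n_m_ext => i; by module V.
apply: bigO_sum => i Hi; case: (Req_dec (c i) 0) => [->|Hc].
  by apply: bigO_eq (bigO_zero p) => k n _; module V.
by apply: bigO_scal; apply: H.
Qed.

Lemma sum_n_m_scal_cst (c : nat -> R) (x : V) a b :
  sum_n_m (fun i => scal (c i) x) a b = scal (sum_n_m c a b) x.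
Proof.
elim: b => [|b IH].
  case: a => [|a]; first by rewrite !sum_n_n.
  by rewrite !sum_n_m_zero; [rewrite (scal_zero_l x) | lia | lia].
case: (Compare_dec.le_lt_dec a (S b)) => Hab.
  by rewrite !sum_n_Sm // IH (scal_distr_r _ _ x).
by rewrite !sum_n_m_zero // (scal_zero_l x).
Qed.

End UniformOrderAlgebra.

(** * One step of the method *)

Section OneStep.
Context {V : CompleteNormedModule R_AbsRing}.
Variables (T M a : R) (E : R -> V -> V) (B : V -> V) (rk : tableau).
Variables (f : R -> V -> V) (u Au A2u Af u1 : R -> V).
Variables (K : R -> nat -> nat -> V) (rho : R -> nat -> V).

Let f0 t := f t (u t).
(** In this section A occurs only through its values [Au], [A2u] and [Af] along the solution, and
    stages and local error are assumed in Duhamel form, so that no question of domain arises. [q] is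
    the increment of [f] at a stage, the quantity on which the orders rest. *)
Let q (k : R) (n i : nat) : V := minus (f (INR n * k + rk_c rk i * k) (K k n i)) (f0 (INR n * k)).

Hypothesis HE : stable_semigroup E M a.
Hypothesis HB : forall y, generator E (B y) y.
Hypothesis Hrk : tableau_hyp rk.

Hypothesis bounded_Au : exists C, 0 <= C /\ forall t, itv T t -> norm (Au t) <= C.
Hypothesis bounded_A2u : exists C, 0 <= C /\ forall t, itv T t -> norm (A2u t) <= C.
Hypothesis bounded_f0 : exists C, 0 <= C /\ forall t, itv T t -> norm (f0 t) <= C.
Hypothesis bounded_Af : exists C, 0 <= C /\ forall t, itv T t -> norm (Af t) <= C.
Hypothesis u1E : forall t, itv T t -> u1 t = plus (Au t) (f0 t).

Hypothesis f_lipschitz : exists r L, 0 < r /\ 0 <= L /\ forall t, itv T t -> forall s v, itv T s ->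
  Rabs (s - t) < r -> norm (minus v (u t)) < r ->
  norm (minus (f s v) (f0 t)) <= L * (Rabs (s - t) + norm (minus v (u t))).

Hypothesis KE : forall k n, valid_step T k n -> forall i, (1 <= i <= rk_s rk)%nat ->
  K k n i = plus (plus (u (INR n * k)) (duhamel E (fun _ => 1) (rk_c rk i * k) (Au (INR n * k))))
    (scal k (sum_n_m (fun j => scal (rk_a rk i j)
       (E ((rk_c rk i - rk_c rk j) * k) (f (INR n * k + rk_c rk j * k) (K k n j)))) 1 (i - 1))).

Hypothesis rhoE : forall k n, valid_step T k n ->
  rho k n = minus
    (plus (plus (plus (u (INR n * k)) (scal k (Au (INR n * k))))
                (duhamel E (fun tau => tau) k (A2u (INR n * k))))
      (scal k (sum_n_m (fun i => scal (rk_b rk i)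
         (plus (plus (f0 (INR n * k)) (E ((1 - rk_c rk i) * k) (q k n i)))
               (duhamel E (fun _ => 1) ((1 - rk_c rk i) * k) (Af (INR n * k))))) 1 (rk_s rk))))
    (u (INR (S n) * k)).

Lemma bigO_curve (phi : R -> V) : (exists C, 0 <= C /\ forall t, itv T t -> norm (phi t) <= C) ->
  bigO T (fun k n => phi (INR n * k)) 0.
Proof.
move=> [C [_ HC]]; apply: (bigO_bound T _ 0 C) => k n Hv.
by rewrite Rmult_1_r; apply: HC; apply: valid_step_itv0 Hv.
Qed.

Lemma bigO_semigroup (e : R -> nat -> V) p c : 0 <= c -> bigO T e p ->
  bigO T (fun k n => E (c * k) (e k n)) p.
Proof.
move=> Hc; apply: (bigO_dom T (V := V) (W := V) _ _ p M); first exact: ss_M HE.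
move=> k n [Hk _]; apply: (ss_norm_le _ _ _ HE); exact: Rmult_le_pos Hc (Rlt_le _ _ Hk).
Qed.

Lemma continuous_cst_id : (forall t : R, continuous (fun _ : R => 1 : R) t) /\
  (forall t : R, continuous (fun t : R => t : R) t).
Proof. by split=> t; [apply: continuous_const | apply: continuous_id]. Qed.

Lemma bigO_duhamel1 (w : R -> V) c : 0 <= c ->
  (exists C, 0 <= C /\ forall t, itv T t -> norm (w t) <= C) ->
  bigO T (fun k n => duhamel E (fun _ => 1) (c * k) (w (INR n * k))) 1.
Proof.
move=> Hc [C [HC Hw]]; apply: (bigO_bound T _ 1 (c * (M * C))) => k n Hv.
have Hck : 0 <= c * k by apply: Rmult_le_pos => //; case: Hv => Hk _; lra.
apply: Rle_trans (duhamel_norm _ _ _ HE (fun _ => 1) (c * k) _ 1 Hck (proj1 continuous_cst_id) _) _.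
  by move=> t _; rewrite Rabs_R1; lra.
have H := Rmult_le_compat_l _ _ _ (ss_M _ _ _ HE) (Hw _ (valid_step_itv0 _ _ _ Hv)).
have := Rmult_le_compat_l _ _ _ Hck H; rewrite pow_1.
by move=> H'; apply: Rle_trans (Req_le _ _ _) (Rle_trans _ _ _ H' (Req_le _ _ _)); ring.
Qed.

Lemma bigO_duhamel2 (w : R -> V) :
  (exists C, 0 <= C /\ forall t, itv T t -> norm (w t) <= C) ->
  bigO T (fun k n => duhamel E (fun tau => tau) k (w (INR n * k))) 2.
Proof.
move=> [C [HC Hw]]; apply: (bigO_bound T _ 2 (M * C)) => k n Hv.
have Hk : 0 <= k by case: Hv; lra.
apply: Rle_trans (duhamel_norm _ _ _ HE (fun t => t) k _ k Hk (proj2 continuous_cst_id) _) _.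
  by move=> t Ht; rewrite Rabs_pos_eq; lra.
have H := Rmult_le_compat_l _ _ _ (ss_M _ _ _ HE) (Hw _ (valid_step_itv0 _ _ _ Hv)).
have := Rmult_le_compat_l _ _ _ (Rmult_le_pos _ _ Hk Hk) H.
by move=> H'; apply: Rle_trans (Req_le _ _ _) (Rle_trans _ _ _ H' (Req_le _ _ _)); ring.
Qed.

Lemma stage_values_bigO i : (1 <= i <= rk_s rk)%nat ->
  bigO T (fun k n => minus (K k n i) (u (INR n * k))) 1 -> bigO T (fun k n => q k n i) 1.
Proof.
move=> Hi /bigO_pos [C [k0 [HC [Hk0 H]]]].
have [r [L [Hr [HL Hlip]]]] := f_lipschitz.
have Hc := rk_c_range _ Hrk i Hi.
(* The threshold keeps both the time shift, at most k, and the distance C k of the stage to u(t_n)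
   below the radius r of the tube; C + 1 avoids a division by zero. *)
exists (L * (1 + C)), (Rmin (Rmin k0 (r / 2)) (r / (2 * (C + 1)))).
have Hr2 : 0 < r / (2 * (C + 1)) by apply: Rdiv_lt_0_compat; lra.
split; first by do 2 apply: Rmin_pos => //; lra.
move=> k n [Hk Hk'] HT.
have Hv : valid_step T k n by [].
have Hk1 : k <= k0.
  by apply: Rle_trans Hk' _; apply: Rle_trans (Rmin_l _ _) (Rmin_l _ _).
have Hk2 : k <= r / 2.
  by apply: Rle_trans Hk' _; apply: Rle_trans (Rmin_l _ _) (Rmin_r _ _).
have Hk3 : k <= r / (2 * (C + 1)) by apply: Rle_trans Hk' (Rmin_r _ _).
have HK := H k n (conj Hk Hk1) HT; rewrite pow_1 in HK.
have HCk : C * k <= r / 2.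
  have : (C + 1) * k <= (C + 1) * (r / (2 * (C + 1))) by apply: Rmult_le_compat_l; lra.
  have -> : (C + 1) * (r / (2 * (C + 1))) = r / 2 by field; lra.
  lra.
have Hdt : Rabs (INR n * k + rk_c rk i * k - INR n * k) <= k.
  have -> : INR n * k + rk_c rk i * k - INR n * k = rk_c rk i * k by ring.
  by rewrite Rabs_pos_eq; nra.
apply: Rle_trans (Hlip _ (valid_step_itv0 _ _ _ Hv) _ _ (valid_step_itv _ _ _ _ Hv Hc) _ _) _.
- lra.
- by apply: Rle_lt_trans HK _; lra.
rewrite Rmult_assoc pow_1; apply: Rmult_le_compat_l => //.
apply: Rle_trans (Rplus_le_compat _ _ _ _ Hdt HK) _; lra.
Qed.

Lemma rk_c_sub_ge0 i j : (1 <= i <= rk_s rk)%nat -> (1 <= j <= i - 1)%nat -> rk_a rk i j <> 0 ->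
  0 <= rk_c rk i - rk_c rk j.
Proof.
move=> Hi Hj Ha; have : rk_c rk j <= rk_c rk i; last lra.
by apply: (rk_c_mono _ Hrk) => //; lia.
Qed.

(** Strong induction along the explicit tableau: stages before i are O(k)-close to u(t_n), so [f] at
    them stays bounded, and the factor k in front of the sum gives the order at i. *)
Lemma stages_bigO i : (1 <= i <= rk_s rk)%nat ->
  bigO T (fun k n => minus (K k n i) (u (INR n * k))) 1.
Proof.
elim/(well_founded_induction Wf_nat.lt_wf): i => i IH Hi.
apply: (bigO_eq T _ (fun k n => plus (duhamel E (fun _ => 1) (rk_c rk i * k) (Au (INR n * k)))
  (scal k (sum_n_m (fun j => scal (rk_a rk i j)
       (E ((rk_c rk i - rk_c rk j) * k) (f (INR n * k + rk_c rk j * k) (K k n j)))) 1 (i - 1))))).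
  by move=> k n Hv; rewrite (KE k n Hv i Hi); module V.
apply: bigO_plus.
  by apply: bigO_duhamel1 => //; case: (rk_c_range _ Hrk i Hi).
apply: bigO_step.
apply: (bigO_sum T (fun j k n => scal (rk_a rk i j)
       (E ((rk_c rk i - rk_c rk j) * k) (f (INR n * k + rk_c rk j * k) (K k n j))))) => j Hj.
case: (Req_dec (rk_a rk i j) 0) => [->|Ha].
  by apply: bigO_eq (bigO_zero T 0) => k n _; module V.
apply: bigO_scal; apply: bigO_semigroup; first exact: rk_c_sub_ge0.
apply: (bigO_eq T _ (fun k n => plus (q k n j) (f0 (INR n * k)))).
  by move=> k n _; rewrite /q; module V.
apply: bigO_plus; last exact: bigO_curve.
apply: bigO_weaken; apply: stage_values_bigO; first lia.
by apply: IH; lia.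
Qed.

Lemma stage_increments_bigO i : (1 <= i <= rk_s rk)%nat -> bigO T (fun k n => q k n i) 1.
Proof. by move=> Hi; apply: stage_values_bigO => //; apply: stages_bigO. Qed.

(** Since the weights sum to 1, k f(t_n, u(t_n)) separates from the sum; together with k A u it is k
    u', and what remains is a sum of terms of order 2 and the Taylor remainder of u. *)
Theorem local_error_order2 :
  bigO T (fun k n => minus (minus (u (INR n * k + k)) (u (INR n * k))) (scal k (u1 (INR n * k)))) 2 ->
  bigO T rho 2.
Proof.
move=> Hu.
apply: (bigO_eq T _ (fun k n => minus (plus (duhamel E (fun tau => tau) k (A2u (INR n * k)))
  (scal k (minus (sum_n_m (fun i => scal (rk_b rk i)
         (plus (plus (f0 (INR n * k)) (E ((1 - rk_c rk i) * k) (q k n i)))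
               (duhamel E (fun _ => 1) ((1 - rk_c rk i) * k) (Af (INR n * k))))) 1 (rk_s rk))
     (sum_n_m (fun i => scal (rk_b rk i) (f0 (INR n * k))) 1 (rk_s rk)))))
  (minus (minus (u (INR n * k + k)) (u (INR n * k))) (scal k (u1 (INR n * k)))))).
  move=> k n Hv; rewrite (rhoE k n Hv) sum_n_m_scal_cst (rk_sum_b _ Hrk) valid_step_end.
  by rewrite (u1E _ (valid_step_itv0 _ _ _ Hv)); module V.
apply: bigO_minus => //; apply: bigO_plus; first exact: bigO_duhamel2.
apply: bigO_step.
apply: (bigO_sum_diff T (fun i k n =>
         (plus (plus (f0 (INR n * k)) (E ((1 - rk_c rk i) * k) (q k n i)))
               (duhamel E (fun _ => 1) ((1 - rk_c rk i) * k) (Af (INR n * k)))))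
  (fun _ k n => f0 (INR n * k))) => i Hi _.
have Hc := rk_c_range _ Hrk i Hi.
apply: (bigO_eq T _ (fun k n => plus (E ((1 - rk_c rk i) * k) (q k n i))
               (duhamel E (fun _ => 1) ((1 - rk_c rk i) * k) (Af (INR n * k))))).
  by move=> k n _; module V.
apply: bigO_plus; last by apply: bigO_duhamel1 => //; lra.
apply: bigO_semigroup; first lra.
exact: stage_increments_bigO.
Qed.

(** * Third order after applying the inverse of the generator *)

Section OrderThree.
Variables (ft u2 : R -> V) (fu : R -> V -> V).

Let fdot t := plus (ft t) (fu t (u1 t)).

Hypothesis fu_linear : forall t, itv T t -> is_linear (fu t).
Hypothesis fu_bound : exists C, 0 <= C /\ forall t y, itv T t -> norm (B (fu t y)) <= C * norm (B y).
Hypothesis f_taylor : exists r L, 0 < r /\ 0 <= L /\ forall t, itv T t -> forall s v, itv T s ->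
  Rabs (s - t) < r -> norm (minus v (u t)) < r ->
  norm (minus (minus (f s v) (f0 t)) (plus (scal (s - t) (ft t)) (fu t (minus v (u t)))))
    <= L * (Rabs (s - t) + norm (minus v (u t))) ^ 2.
Hypothesis u2E : forall t, itv T t -> u2 t = plus (plus (A2u t) (Af t)) (fdot t).
Hypothesis sum_bc : sum_n_m (fun i => rk_b rk i * rk_c rk i) 1 (rk_s rk) = / 2.

Lemma bigO_inv (e : R -> nat -> V) p : bigO T e p -> bigO T (fun k n => B (e k n)) p.
Proof. by apply: bigO_linear; apply: (geninv_linear _ _ _ HE _ HB). Qed.

Lemma bigO_inv_semigroup (e : R -> nat -> V) p c : 0 <= c -> bigO T e p ->
  bigO T (fun k n => minus (B (E (c * k) (e k n))) (B (e k n))) (S p).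
Proof.
move=> Hc [C [k0 [Hk0 H]]]; exists (c * (M * C)), k0; split=> // k n Hk HT.
have Hck : 0 <= c * k by apply: Rmult_le_pos; lra.
rewrite (geninv_comm _ _ _ HE _ HB) //.
apply: Rle_trans (geninv_incr _ _ _ HE _ HB _ _ Hck) _.
have H' := Rmult_le_compat_l _ _ _ (ss_M _ _ _ HE) (H k n Hk HT).
have H'' := Rmult_le_compat_l _ _ _ Hck H'.
apply: Rle_trans H'' _; apply: Req_le; rewrite /=; ring.
Qed.

Lemma bigO_inv_duhamel1 (w : R -> V) c : 0 <= c ->
  (exists C, 0 <= C /\ forall t, itv T t -> norm (w t) <= C) ->
  bigO T (fun k n => minus (B (duhamel E (fun _ => 1) (c * k) (w (INR n * k))))
    (scal (c * k) (B (w (INR n * k))))) 2.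
Proof.
move=> Hc [C [HC Hw]]; apply: (bigO_bound T _ 2 (c * c * (M * C))) => k n Hv.
have Hck : 0 <= c * k by apply: Rmult_le_pos => //; case: Hv => Hk _; lra.
have Hint : is_RInt (fun _ : R => 1) 0 (c * k) (c * k).
  have := is_RInt_const (V := R_NormedModule) 0 (c * k) 1.
  by rewrite /scal /= /mult /= Rmult_1_r Rminus_0_r.
apply: Rle_trans (geninv_duhamel _ _ _ HE _ HB (fun _ => 1) (c * k) _ 1 (c * k) Hck
  (proj1 continuous_cst_id) _ Hint) _.
  by move=> t _; rewrite Rabs_R1; lra.
have H := Rmult_le_compat_l _ _ _ (ss_M _ _ _ HE) (Hw _ (valid_step_itv0 _ _ _ Hv)).
have := Rmult_le_compat_l _ _ _ (Rmult_le_pos _ _ Hck Hck) H.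
by move=> H'; apply: Rle_trans (Req_le _ _ _) (Rle_trans _ _ _ H' (Req_le _ _ _)); ring.
Qed.

Lemma bigO_inv_duhamel2 (w : R -> V) :
  (exists C, 0 <= C /\ forall t, itv T t -> norm (w t) <= C) ->
  bigO T (fun k n => minus (B (duhamel E (fun tau => tau) k (w (INR n * k))))
    (scal (k ^ 2 / 2) (B (w (INR n * k))))) 3.
Proof.
move=> [C [HC Hw]]; apply: (bigO_bound T _ 3 (M * C)) => k n Hv.
have Hk : 0 <= k by case: Hv; lra.
have Hint : is_RInt (fun t : R => t) 0 k (k ^ 2 / 2).
  have -> : k ^ 2 / 2 = minus (k ^ 2 / 2) (0 ^ 2 / 2).
    by rewrite /minus /plus /opp /=; field.
  apply: (is_RInt_derive (fun t : R => t ^ 2 / 2)) => t _; last exact: continuous_id.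
  by auto_derive => //; field.
apply: Rle_trans (geninv_duhamel _ _ _ HE _ HB (fun t => t) k _ k (k ^ 2 / 2) Hk
  (proj2 continuous_cst_id) _ Hint) _.
  by move=> t Ht; rewrite Rabs_pos_eq; lra.
have H := Rmult_le_compat_l _ _ _ (ss_M _ _ _ HE) (Hw _ (valid_step_itv0 _ _ _ Hv)).
have := Rmult_le_compat_l _ _ _ (Rmult_le_pos _ _ (Rmult_le_pos _ _ Hk Hk) Hk) H.
by move=> H'; apply: Rle_trans (Req_le _ _ _) (Rle_trans _ _ _ H' (Req_le _ _ _)); ring.
Qed.

(** The row sums turn k sum_j a_ij f into c_i k f, which completes c_i k A u to c_i k u'. In each
    remaining term the semigroup acts on [q], of order 1 already, or on f(t_n, u(t_n)), where its
    distance to the identity is O(k) after [B]. *)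
Lemma inv_stages_bigO i : (1 <= i <= rk_s rk)%nat ->
  bigO T (fun k n => B (minus (minus (K k n i) (u (INR n * k)))
                         (scal (rk_c rk i * k) (u1 (INR n * k))))) 2.
Proof.
move=> Hi; have HL := geninv_linear _ _ _ HE _ HB.
apply: (bigO_eq T _ (fun k n => plus
  (minus (B (duhamel E (fun _ => 1) (rk_c rk i * k) (Au (INR n * k))))
    (scal (rk_c rk i * k) (B (Au (INR n * k)))))
  (scal k (minus (sum_n_m (fun j => scal (rk_a rk i j)
       (B (E ((rk_c rk i - rk_c rk j) * k) (f (INR n * k + rk_c rk j * k) (K k n j))))) 1 (i - 1))
     (sum_n_m (fun j => scal (rk_a rk i j) (B (f0 (INR n * k)))) 1 (i - 1)))))).
  move=> k n Hv; rewrite (KE k n Hv i Hi) sum_n_m_scal_cst (rk_sum_a _ Hrk) //.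
  rewrite (u1E _ (valid_step_itv0 _ _ _ Hv)).
  rewrite !((linear_minus _ _ _ HL), (linear_plus _ HL), (linear_scal _ HL)).
  rewrite (linear_sum_n_m B) //.
  rewrite (sum_n_m_ext (fun j => B (scal _ _)) (fun j => scal (rk_a rk i j)
       (B (E ((rk_c rk i - rk_c rk j) * k) (f (INR n * k + rk_c rk j * k) (K k n j)))))).
    by set S := sum_n_m _ _ _; module V.
  by move=> j; rewrite (linear_scal _ HL).
apply: bigO_plus.
  by apply: bigO_inv_duhamel1 => //; case: (rk_c_range _ Hrk i Hi).
apply: bigO_step.
apply: (bigO_sum_diff T (fun j k n => B (E ((rk_c rk i - rk_c rk j) * k)
  (f (INR n * k + rk_c rk j * k) (K k n j)))) (fun _ k n => B (f0 (INR n * k)))) => j Hj Ha.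
have Hc : 0 <= rk_c rk i - rk_c rk j by apply: rk_c_sub_ge0.
apply: (bigO_eq T _ (fun k n => plus (B (E ((rk_c rk i - rk_c rk j) * k) (q k n j)))
  (minus (B (E ((rk_c rk i - rk_c rk j) * k) (f0 (INR n * k)))) (B (f0 (INR n * k)))))).
  move=> k n [Hk _]; rewrite /q.
  have HEl : is_linear (E ((rk_c rk i - rk_c rk j) * k)).
    by apply: (ss_linear _ _ _ HE); apply: Rmult_le_pos => //; lra.
  by rewrite !((linear_minus _ _ _ HEl), (linear_minus _ _ _ HL)); module V.
apply: bigO_plus.
  by apply: bigO_inv; apply: bigO_semigroup => //; apply: stage_increments_bigO; lia.
by apply: (bigO_inv_semigroup (fun k n => f0 (INR n * k))) => //; apply: bigO_curve.
Qed.

Lemma stage_taylor_bigO i : (1 <= i <= rk_s rk)%nat ->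
  bigO T (fun k n => minus (q k n i) (plus (scal (rk_c rk i * k) (ft (INR n * k)))
    (fu (INR n * k) (minus (K k n i) (u (INR n * k)))))) 2.
Proof.
move=> Hi; have /bigO_pos [C [k0 [HC [Hk0 H]]]] := stages_bigO i Hi.
have [r [L [Hr [HL Hlip]]]] := f_taylor.
have Hc := rk_c_range _ Hrk i Hi.
exists (L * (1 + C) ^ 2), (Rmin (Rmin k0 (r / 2)) (r / (2 * (C + 1)))).
have Hr2 : 0 < r / (2 * (C + 1)) by apply: Rdiv_lt_0_compat; lra.
split; first by do 2 apply: Rmin_pos => //; lra.
move=> k n [Hk Hk'] HT.
have Hv : valid_step T k n by [].
have Hk1 : k <= k0.
  by apply: Rle_trans Hk' _; apply: Rle_trans (Rmin_l _ _) (Rmin_l _ _).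
have Hk2 : k <= r / 2.
  by apply: Rle_trans Hk' _; apply: Rle_trans (Rmin_l _ _) (Rmin_r _ _).
have Hk3 : k <= r / (2 * (C + 1)) by apply: Rle_trans Hk' (Rmin_r _ _).
have HK := H k n (conj Hk Hk1) HT; rewrite pow_1 in HK.
have HCk : C * k <= r / 2.
  have : (C + 1) * k <= (C + 1) * (r / (2 * (C + 1))) by apply: Rmult_le_compat_l; lra.
  have -> : (C + 1) * (r / (2 * (C + 1))) = r / 2 by field; lra.
  lra.
have Edt : INR n * k + rk_c rk i * k - INR n * k = rk_c rk i * k by ring.
have Hdt : Rabs (INR n * k + rk_c rk i * k - INR n * k) <= k.
  by rewrite Edt Rabs_pos_eq; nra.
have := Hlip _ (valid_step_itv0 _ _ _ Hv) _ (K k n i) (valid_step_itv _ _ _ _ Hv Hc).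
move=> /(_ (Rle_lt_trans _ _ _ Hdt _) (Rle_lt_trans _ _ _ HK _)).
rewrite {1}Edt => H'; apply: Rle_trans (H' _ _) _; try lra.
have -> : L * (1 + C) ^ 2 * k ^ 2 = L * (k + C * k) ^ 2 by ring.
apply: Rmult_le_compat_l => //; apply: pow_incr; split; last exact: Rplus_le_compat.
by apply: Rplus_le_le_0_compat; [exact: Rabs_pos | exact: norm_ge_0].
Qed.

(** The Taylor remainder is O(k^2) before [B] is applied. In the linear part, [fu_bound] replaces B
    fu of the stage defect by B of that defect, for which the weak estimate is available. *)
Lemma inv_increments_bigO i : (1 <= i <= rk_s rk)%nat ->
  bigO T (fun k n => minus (B (q k n i)) (scal (rk_c rk i * k) (B (fdot (INR n * k))))) 2.
Proof.
move=> Hi; have HL := geninv_linear _ _ _ HE _ HB.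
have [C [HC Hfu]] := fu_bound.
apply: (bigO_eq T _ (fun k n => plus
  (B (minus (q k n i) (plus (scal (rk_c rk i * k) (ft (INR n * k)))
    (fu (INR n * k) (minus (K k n i) (u (INR n * k)))))))
  (B (fu (INR n * k) (minus (minus (K k n i) (u (INR n * k)))
                         (scal (rk_c rk i * k) (u1 (INR n * k)))))))).
  move=> k n Hv; have Hl := fu_linear _ (valid_step_itv0 _ _ _ Hv).
  rewrite (linear_minus (fu _) _ (scal _ _) Hl) (linear_scal _ Hl) /fdot.
  rewrite !((linear_minus _ _ _ HL), (linear_plus _ HL), (linear_scal _ HL)).
  by module V.
apply: bigO_plus; first by apply: bigO_inv; apply: stage_taylor_bigO.
apply: (bigO_dom T (V := V) (W := V) _ _ 2 C HC _ (inv_stages_bigO i Hi)).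
by move=> k n Hv; apply: Hfu; apply: valid_step_itv0 Hv.
Qed.

Theorem inv_local_error_order3 :
  bigO T (fun k n => minus (minus (u (INR n * k + k)) (u (INR n * k)))
    (plus (scal k (u1 (INR n * k))) (scal (k ^ 2 / 2) (u2 (INR n * k))))) 3 ->
  bigO T (fun k n => B (rho k n)) 3.
Proof.
move=> Hu; have HL := geninv_linear _ _ _ HE _ HB.
pose x i k n := B (plus (plus (f0 (INR n * k)) (E ((1 - rk_c rk i) * k) (q k n i)))
               (duhamel E (fun _ => 1) ((1 - rk_c rk i) * k) (Af (INR n * k)))).
(* First-order expansion of [x]. As sum b_i = 1 and sum b_i c_i = 1/2, also sum b_i (1 - c_i) = 1/2,
   so its weighted sum is B f plus k/2 times B of the sum of [fdot] and [Af]. The factor k in front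
   makes an O(k^2) difference between [x] and [y] sufficient. *)
pose y i k n := plus (plus (B (f0 (INR n * k))) (scal (rk_c rk i * k) (B (fdot (INR n * k)))))
               (scal ((1 - rk_c rk i) * k) (B (Af (INR n * k)))).
apply: (bigO_eq T _ (fun k n => minus (plus
  (minus (B (duhamel E (fun tau => tau) k (A2u (INR n * k))))
     (scal (k ^ 2 / 2) (B (A2u (INR n * k)))))
  (scal k (minus (sum_n_m (fun i => scal (rk_b rk i) (x i k n)) 1 (rk_s rk))
                 (sum_n_m (fun i => scal (rk_b rk i) (y i k n)) 1 (rk_s rk)))))
  (B (minus (minus (u (INR n * k + k)) (u (INR n * k)))
    (plus (scal k (u1 (INR n * k))) (scal (k ^ 2 / 2) (u2 (INR n * k)))))))).
  move=> k n Hv.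
  have -> : sum_n_m (fun i => scal (rk_b rk i) (y i k n)) 1 (rk_s rk) =
    plus (B (f0 (INR n * k))) (scal (k / 2) (plus (B (fdot (INR n * k))) (B (Af (INR n * k))))).
    rewrite (sum_n_m_ext _ (fun i => plus (scal (rk_b rk i) (plus (B (f0 (INR n * k)))
        (scal k (B (Af (INR n * k))))))
      (scal (rk_b rk i * rk_c rk i) (scal k (minus (B (fdot (INR n * k))) (B (Af (INR n * k)))))))).
      rewrite sum_n_m_plus !sum_n_m_scal_cst (rk_sum_b _ Hrk) sum_bc.
      by module V; field.
    by move=> i; rewrite /y; module V.
  rewrite (rhoE k n Hv) valid_step_end (u1E _ (valid_step_itv0 _ _ _ Hv)).
  rewrite (u2E _ (valid_step_itv0 _ _ _ Hv)).
  rewrite !((linear_minus _ _ _ HL), (linear_plus _ HL), (linear_scal _ HL)).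
  rewrite (linear_sum_n_m B) //.
  rewrite (sum_n_m_ext (fun i => B (scal _ _)) (fun i => scal (rk_b rk i) (x i k n))); last first.
    by move=> i; rewrite (linear_scal _ HL).
  by set S := sum_n_m _ _ _; module V; field.
apply: bigO_minus; last exact: bigO_inv.
apply: bigO_plus; first exact: bigO_inv_duhamel2.
apply: bigO_step; apply: (bigO_sum_diff T x y) => i Hi _.
have Hc := rk_c_range _ Hrk i Hi.
apply: (bigO_eq T _ (fun k n => plus (plus
   (minus (B (E ((1 - rk_c rk i) * k) (q k n i))) (B (q k n i)))
   (minus (B (q k n i)) (scal (rk_c rk i * k) (B (fdot (INR n * k))))))
   (minus (B (duhamel E (fun _ => 1) ((1 - rk_c rk i) * k) (Af (INR n * k))))
     (scal ((1 - rk_c rk i) * k) (B (Af (INR n * k))))))).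
  by move=> k n _; rewrite /x /y !(linear_plus _ HL); module V.
apply: bigO_plus; last by apply: bigO_inv_duhamel1 => //; lra.
apply: bigO_plus; last exact: inv_increments_bigO.
apply: (bigO_inv_semigroup (fun k n => q k n i)); first lra.
exact: stage_increments_bigO.
Qed.

End OrderThree.
End OneStep.

(** * Derivatives along the solution *)

Lemma frechet_of_filterdiff {U V : NormedModule R_AbsRing} (D : U -> Prop) (F L : U -> V) x :
  filterdiff F (within D (locally x)) L -> frechet D F x L.
Proof.
move=> [_ H] eps He.
have [|d Hd] := H x _ (mkposreal eps He).
  by move=> P; apply: filter_imp.
exists d; split=> [|y Dy Hy]; first exact: cond_pos.
by apply: (Hd y) => //; apply: norm_compat1.
Qed.

Lemma frechet_of_filterdiff_locally {U V : NormedModule R_AbsRing} (F L : U -> V) x :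
  filterdiff F (locally x) L -> frechet (fun _ => True) F x L.
Proof.
move=> [HL H]; apply: frechet_of_filterdiff; split=> // y Hy eps.
have -> : y = x.
  apply: eq_sym; apply: (is_filter_lim_locally_unique (V := U)) => P /Hy.
  by apply: (filter_imp (F := locally x)) => z H0; exact: H0.
by apply: (filter_imp (F := locally x)) (H x (fun P HP => HP) eps).
Qed.

(** Restriction to a line reduces the claim to uniqueness in one variable. It identifies a given
    partial derivative of [f] with the one read off from a total derivative. *)
Lemma frechet_linear_unique {U V : NormedModule R_AbsRing} (F L N : U -> V) x :
  is_linear L -> is_linear N -> frechet (fun _ => True) F x L -> frechet (fun _ => True) F x N ->
  forall h, L h = N h.
Proof.
move=> HL HN H1 H2 h.
have E0 : plus x (scal 0 h) = x by module U.
rewrite -E0 in H1 H2.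
apply: (deriv_within_unique 0 1 (fun s => F (plus x (scal s h))) 0); try lra.
  exact: frechet_segment H1.
exact: frechet_segment H2.
Qed.

Lemma deriv_within_comp {U V : NormedModule R_AbsRing} (D : U -> Prop) (I : R -> Prop)
    (F L : U -> V) (c : R -> U) t l :
  (forall s, I s -> D (c s)) -> is_linear L -> frechet D F (c t) L -> deriv_within I c t l ->
  deriv_within I (fun s => F (c s)) t (L l).
Proof.
move=> HD HL HF Hc; apply/deriv_withinE => eps He.
have [M [HM HLM]] := linear_norm _ HL.
have Hl : 0 < norm l + 1 by have := norm_ge_0 l; lra.
have He2 : 0 < eps / 2 by lra.
have [d1 [Hd1 K1]] := HF _ (Rdiv_lt_0_compat _ _ He2 Hl).
have [d2 [Hd2 K2]] := deriv_within_continuous _ _ _ _ Hc _ Hd1.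
have [d3 [Hd3 K3]] := proj1 (deriv_withinE _ _ _ _) Hc _ (Rdiv_lt_0_compat _ _ He2 HM).
have [d4 [Hd4 K4]] := proj1 (deriv_withinE _ _ _ _) Hc _ Rlt_0_1.
exists (Rmin d2 (Rmin d3 d4)); split; first by do 2 apply: Rmin_pos => //.
move=> s Is Hs.
have Hs2 := Rlt_le_trans _ _ _ Hs (Rmin_l _ _).
have Hs34 := Rlt_le_trans _ _ _ Hs (Rmin_r _ _).
have Hs3 := Rlt_le_trans _ _ _ Hs34 (Rmin_l _ _).
have Hs4 := Rlt_le_trans _ _ _ Hs34 (Rmin_r _ _).
have {}K1 := K1 _ (HD s Is) (K2 s Is Hs2).
have {}K3 := K3 s Is Hs3; have {}K4 := K4 s Is Hs4.
have -> : minus (minus (F (c s)) (F (c t))) (scal (s - t) (L l)) =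
  plus (minus (minus (F (c s)) (F (c t))) (L (minus (c s) (c t))))
       (L (minus (minus (c s) (c t)) (scal (s - t) l))).
  by rewrite (linear_minus _ (minus _ _) _ HL) (linear_scal _ HL); module V.
have Hcs : norm (minus (c s) (c t)) <= Rabs (s - t) * (norm l + 1).
  have -> : minus (c s) (c t) =
    plus (minus (minus (c s) (c t)) (scal (s - t) l)) (scal (s - t) l) by module U.
  apply: Rle_trans (norm_plus_le _ _ _ _ K4 (norm_scal _ _)) _.
  by rewrite /abs /=; lra.
have -> : eps * Rabs (s - t) = eps / 2 / (norm l + 1) * (Rabs (s - t) * (norm l + 1)) +
  M * (eps / 2 / M * Rabs (s - t)) by field; lra.
apply: norm_plus_le.
  apply: Rle_trans K1 _; apply: Rmult_le_compat_l => //.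
  by apply: Rlt_le; apply: Rdiv_lt_0_compat.
apply: Rle_trans (HLM _) _; apply: Rmult_le_compat_l => //; lra.
Qed.

(** The factor sqrt 2 of the product norm is rounded up to 2; this is the origin of r / 2, 2 L and 4
    L in the estimates near the curve. *)
Lemma norm_pair_le {V : NormedModule R_AbsRing} (r : R) (v : V) :
  norm ((r, v) : prod_NormedModule R_AbsRing R_NormedModule V) <= 2 * Rmax (Rabs r) (norm v).
Proof.
have [_ H] := norm_prod (U := R_NormedModule) r v.
apply: Rle_trans H _; apply: Rmult_le_compat_r.
  by apply: Rle_trans (Rmax_r _ _); apply: norm_ge_0.
rewrite -[X in _ <= X]sqrt_square; last lra.
by apply: sqrt_le_1_alt; lra.
Qed.

Lemma Rmax_le_sum x y : 0 <= x -> 0 <= y -> Rmax x y <= x + y.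
Proof. by move=> Hx Hy; apply: Rmax_lub; lra. Qed.

Lemma deriv_within_graph {V : NormedModule R_AbsRing} (I : R -> Prop) (u : R -> V) t l :
  deriv_within I u t l ->
  deriv_within (V := prod_NormedModule R_AbsRing R_NormedModule V) I (fun s => (s, u s)) t (1, l).
Proof.
move=> Hu; apply/deriv_withinE => eps He.
have He2 : 0 < eps / 2 by lra.
have [d [Hd K]] := proj1 (deriv_withinE _ _ _ _) Hu _ He2.
exists d; split=> // s Is Hs; have {}K := K s Is Hs.
set x := minus _ _.
have -> : x = (0, minus (minus (u s) (u t)) (scal (s - t) l)).
  by rewrite /x /minus /plus /opp /scal /= /prod_plus /prod_opp /prod_scal /= /scal /plus /opp /=
    /mult /=; congr (_, _); ring.
apply: Rle_trans (norm_pair_le _ _) _.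
rewrite Rabs_R0 Rmax_right; last exact: norm_ge_0.
by move: (norm _) K => y; lra.
Qed.

Lemma deriv_within_continuous_within {V : NormedModule R_AbsRing} (I : R -> Prop) (u u' : R -> V) :
  (forall t, I t -> deriv_within I u t (u' t)) -> continuous_within I u.
Proof. by move=> H t It; apply: deriv_within_continuous (H t It). Qed.

Lemma itv_convex {V : NormedModule R_AbsRing} T :
  convex (V := prod_NormedModule R_AbsRing R_NormedModule V) (fun q => itv T (fst q)).
Proof.
move=> [r v] [s w] x [H1 H2] [H3 H4] Hx.
rewrite /itv /= /plus /minus /scal /opp /= /mult /plus /opp /=.
by move: H1 H2 H3 H4 => /= *; split; nra.
Qed.

(** * The second order condition *)

Lemma diff_class_constant {U V : NormedModule R_AbsRing} (D : U -> Prop) n {P : Type}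
    (w : P -> R) (c : P -> V) : (forall p, 0 <= w p) -> diff_class D n w (fun _ p => c p).
Proof.
elim: n P w c => [|n IH] P w c Hw.
  move=> x _ eps He; exists 1; split=> [|y _ _ p]; first lra.
  by rewrite minus_eq_zero norm_zero; apply: Rmult_le_pos => //; lra.
exists (fun _ _ => zero); split; [|split].
- move=> x _; split=> [p|]; first exact: is_linear_zero.
  by exists 0 => h p; rewrite norm_zero; lra.
- move=> x _ eps He; exists 1; split=> [|y _ _ p]; first lra.
  rewrite minus_eq_zero minus_eq_zero norm_zero.
  by apply: Rmult_le_pos => //; apply: Rmult_le_pos; [lra | apply: norm_ge_0].
- by apply: (IH _ _ (fun _ => zero)) => q; apply: Rmult_le_pos => //; apply: norm_ge_0.
Qed.

Lemma class_C_linear {U V : NormedModule R_AbsRing} (D : U -> Prop) n (L : U -> V) :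
  is_linear L -> class_C n D L.
Proof.
move=> HL; have [M [HM HLM]] := linear_norm _ HL.
(* Proving one class more gives a derivative to exhibit even when n = 0. *)
suff H : class_C (S n) D L by apply: diff_class_pred H => _; lra.
exists (fun _ q => L (fst q)); split; [|split].
- move=> x _; split=> [p|] //=; exists M => h p; rewrite Rmult_1_r; exact: HLM.
- move=> x _ eps He; exists 1; split=> [|y _ _ p] /=; first lra.
  rewrite (linear_minus _ _ _ HL) minus_eq_zero norm_zero Rmult_1_r.
  by apply: Rmult_le_pos; [lra | apply: norm_ge_0].
- by apply: diff_class_constant => q; rewrite Rmult_1_r; apply: norm_ge_0.
Qed.

(** The condition is read off from the equation [y' = t], [y 0 = 0]. *)
Lemma classical_order2_condition rk : classical_order_ge rk 2 ->
  sum_n_m (fun i => rk_b rk i * rk_c rk i) 1 (rk_s rk) = / 2.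
Proof.
set s := sum_n_m _ _ _.
pose e : Defs.Rn 1 := fun _ => 1.
move=> /(_ 1%nat (fun t _ => scal t e) 0 1 (fun t => scal (t ^ 2 / 2) e)) [||t Ht|M [k0 [Hk0 H]]].
- move=> n; apply: class_C_linear.
  exact: (is_linear_comp _ _ is_linear_fst (is_linear_scal_l e)).
- lra.
- have Hd : is_derive (fun s : R => scal (s ^ 2 / 2) e) t (scal t e).
    by apply: (is_derive_scal_l (fun s : R => s ^ 2 / 2) t t e); auto_derive => //; field.
  apply: filterdiff_locally Hd.
    apply: Build_ProperFilter => P [d Hd'].
    by exists t; apply: Hd' => //; apply: ball_center.
  by move=> P HP; apply: (filter_imp (F := locally t)) HP.
(* For this equation a step is a quadrature of t, and its error is exactly k^2 (s - 1/2); a bound of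
   order k^3 for arbitrarily small k forces s = 1/2. *)
have Estep k : minus (rk_step rk (fun t _ => scal t e) k 0 (scal (0 ^ 2 / 2) e))
    (scal ((0 + k) ^ 2 / 2) e) = scal (k ^ 2 * (s - / 2)) e.
  rewrite /rk_step (sum_n_m_ext _ (fun i => scal (k * (rk_b rk i * rk_c rk i)) e)); last first.
    by move=> i; module (Defs.Rn 1).
  rewrite sum_n_m_scal_cst (sum_n_m_mult_l (K := R_Ring) k).
  by rewrite -/s /mult /=; module (Defs.Rn 1); field.
have He : norm e = 1.
  have H1 (i : fintype.ordinal 1) : norm (e i) = 1 by apply: Rabs_R1.
  apply: Rle_antisym; first by apply: fin_norm_le => [|i]; [lra | rewrite H1; lra].
  by rewrite -(H1 fintype.ord0); apply: fin_norm_ub.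
apply: Rminus_diag_uniq; apply: (norm_eq_0_of_le (V := R_NormedModule) _ (Rabs M)) => eps Heps.
set k := Rmin k0 eps.
have Hk : 0 < k by apply: Rmin_pos; lra.
have := H k (conj Hk (Rmin_l _ _)).
rewrite Estep norm_scal_R He Rmult_1_r Rabs_mult (Rabs_pos_eq (k ^ 2)); last exact: pow2_ge_0.
rewrite (_ : k ^ (2 + 1) = k ^ 2 * k) => [H'|]; last by rewrite pow_add pow_1.
have Hk2 : 0 < k ^ 2 by apply: pow_lt.
apply: (Rmult_le_reg_l (k ^ 2)) => //; apply: Rle_trans H' _.
have := Rmin_r k0 eps; rewrite -/k => Hke.
have := Rle_abs M; have := Rabs_pos M => HM0 HM1.
have : M * k <= eps * Rabs M by nra.
nra.
Qed.

(** * Estimates near the solution curve *)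

Section NearCurve.
Context {V : NormedModule R_AbsRing}.
Variables (T : R) (f : R -> V -> V) (u u1 : R -> V).

Let VT := prod_NormedModule R_AbsRing R_NormedModule V.
Let D (q : VT) := itv T (fst q).
Let F (q : VT) := f (fst q) (snd q).

Hypothesis Hu : forall t, itv T t -> deriv_within (itv T) u t (u1 t).

(** The tube is taken around the graph of the solution, since stages evaluate [f] at shifted times
    as well as at shifted states. *)
Lemma near_curve (Q : R -> VT -> VT -> Prop) :
  (forall L L' y z, Q L y z -> L <= L' -> Q L' y z) ->
  (forall x, D x -> exists r L, 0 < r /\ 0 <= L /\ forall y z,
     norm (minus y x) < r -> norm (minus z x) < r -> Q L y z) ->
  exists r L, 0 < r /\ 0 <= L /\ forall t, itv T t -> forall s v,
    Rabs (s - t) < r -> norm (minus v (u t)) < r -> Q L (t, u t) (s, v).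
Proof.
move=> Hmono Hloc.
have Hc : continuous_within (V := VT) (itv T) (fun s => (s, u s)).
  by apply: deriv_within_continuous_within => t Ht; apply: deriv_within_graph; apply: Hu.
have [r [L [Hr [HL K]]]] := itv_tube (U := VT) T _ Q Hc Hmono (fun t Ht => Hloc (t, u t) Ht).
exists (r / 2), L; split; first lra; split=> // t Ht s v Hs Hv.
apply: K => //; apply: Rle_lt_trans (norm_pair_le (s - t) (minus v (u t))) _.
by have := Rmax_lub_lt _ _ _ Hs Hv; lra.
Qed.

Lemma class_C1_near_curve : class_C 1 D F ->
  exists r L, 0 < r /\ 0 <= L /\ forall t, itv T t -> forall s v, itv T s ->
  Rabs (s - t) < r -> norm (minus v (u t)) < r ->
  norm (minus (f s v) (f t (u t))) <= L * (Rabs (s - t) + norm (minus v (u t))).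
Proof.
move=> HF.
case: (near_curve (fun L y z => D y -> D z -> norm (minus (F z) (F y)) <= L * norm (minus z y))).
- move=> L L' y z H HLL Dy Dz; apply: Rle_trans (H Dy Dz) _.
  by apply: Rmult_le_compat_r => //; apply: norm_ge_0.
- move=> x Dx.
  have [_|r [L [Hr [HL K]]]] := C1_locally_lipschitz D (fun _ : unit => 1) (fun x _ => F x) _
    (itv_convex T) HF x Dx; first lra.
  exists r, L; split=> //; split=> // y z Hy Hz Dy Dz.
  by apply: Rle_trans (K y z Dy Dz Hy Hz tt) _; rewrite Rmult_1_r; apply: Rle_refl.
move=> r [L [Hr [HL K]]]; exists r, (2 * L); split=> //; split; first lra.
move=> t Ht s v Hs Hst Hv.
apply: Rle_trans (K t Ht s v Hst Hv Ht Hs) _.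
have H1 := norm_pair_le (s - t) (minus v (u t)).
have H2 := Rmax_le_sum _ _ (Rabs_pos (s - t)) (norm_ge_0 (minus v (u t))).
apply: Rle_trans (Rmult_le_compat_l _ _ _ HL H1) _.
have := Rmult_le_compat_l _ _ _ HL H2; lra.
Qed.

Lemma class_C2_near_curve : class_C 2 D F ->
  exists dF : VT -> VT -> V, (forall x, D x -> is_linear (dF x) /\ frechet D F x (dF x)) /\
  exists r L, 0 < r /\ 0 <= L /\ forall t, itv T t -> forall s v, itv T s ->
  Rabs (s - t) < r -> norm (minus v (u t)) < r ->
  norm (minus (minus (f s v) (f t (u t))) (dF (t, u t) (s - t, minus v (u t))))
    <= L * (Rabs (s - t) + norm (minus v (u t))) ^ 2.
Proof.
move=> HF; have [dF [HdF Htay]] := class_C2_taylor D F (itv_convex T) HF.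
exists dF; split=> //.
case: (near_curve (fun L y z => D y -> D z ->
  norm (minus (minus (F z) (F y)) (dF y (minus z y))) <= L * norm (minus z y) ^ 2)).
- move=> L L' y z H HLL Dy Dz; apply: Rle_trans (H Dy Dz) _.
  by apply: Rmult_le_compat_r => //; apply: pow2_ge_0.
- move=> x Dx; have [r [L [Hr [HL K]]]] := Htay x Dx.
  by exists r, L; split=> //; split=> // y z Hy Hz Dy Dz; apply: K.
move=> r [L [Hr [HL K]]]; exists r, (4 * L); split=> //; split; first lra.
move=> t Ht s v Hs Hst Hv.
apply: Rle_trans (K t Ht s v Hst Hv Ht Hs) _.
have H1 := norm_pair_le (s - t) (minus v (u t)).
have H2 := Rmax_le_sum _ _ (Rabs_pos (s - t)) (norm_ge_0 (minus v (u t))).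
have -> : 4 * L * (Rabs (s - t) + norm (minus v (u t))) ^ 2 =
  L * (2 * (Rabs (s - t) + norm (minus v (u t)))) ^ 2 by ring.
apply: Rmult_le_compat_l => //; apply: pow_incr; split; first exact: norm_ge_0.
by apply: Rle_trans H1 (Rmult_le_compat_l _ _ _ _ H2); lra.
Qed.

Lemma frechet_partial (dF : VT -> V) t v : itv T t -> frechet D F (t, v) dF ->
  frechet (fun _ => True) (f t) v (fun w => dF (0, w)).
Proof.
move=> Ht H eps He; have [|d [Hd K]] := H (eps / 2); first lra.
exists (d / 2); split=> [|w _ Hw]; first lra.
have E : minus ((t, w) : VT) (t, v) = (0, minus w v).
  by rewrite /minus /plus /opp /= /prod_plus /prod_opp /= /plus /opp /=; congr (_, _); ring.
have Hn := norm_pair_le 0 (minus w v).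
rewrite Rabs_R0 Rmax_right in Hn; last exact: norm_ge_0.
have := K (t, w) Ht; rewrite E => K'; apply: Rle_trans (K' _) _.
  by apply: Rle_lt_trans Hn _; lra.
have Hp : 0 <= eps / 2 by lra.
apply: Rle_trans (Rmult_le_compat_l _ _ _ Hp Hn) _.
by apply: Req_le; field.
Qed.

End NearCurve.

(** * Taylor expansions of the solution *)

Section TaylorInTime.
Context {V : NormedModule R_AbsRing}.
Variables (T : R) (u u1 u2 : R -> V).
Hypothesis Hu : forall t, itv T t -> deriv_within (itv T) u t (u1 t).
Hypothesis Hu1 : forall t, itv T t -> deriv_within (itv T) u1 t (u2 t).

Lemma deriv_within_sub_itv (phi : R -> V) phi' a b : itv T a -> itv T b ->
  (forall t, itv T t -> deriv_within (itv T) phi t (phi' t)) ->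
  forall t, a <= t <= b -> deriv_within (fun s => a <= s <= b) phi t (phi' t).
Proof.
move=> [Ha _] [_ Hb] H t Ht; apply: (deriv_within_subset (itv T)); first by move=> s Hs; split; lra.
by apply: H; split; lra.
Qed.

Lemma taylor_order2 : (exists C, 0 <= C /\ forall t, itv T t -> norm (u2 t) <= C) ->
  bigO T (fun k n => minus (minus (u (INR n * k + k)) (u (INR n * k))) (scal k (u1 (INR n * k)))) 2.
Proof.
move=> [C [HC Hb]]; apply: (bigO_bound T _ 2 C) => k n Hv.
have Ha := valid_step_itv0 _ _ _ Hv.
have Hb' : itv T (INR n * k + k).
  by have := valid_step_itv T k n 1 Hv; rewrite Rmult_1_l; apply; lra.
have Hk : 0 < k by case: Hv.
have := mean_value_linear u u1 (u1 (INR n * k)) (INR n * k) (INR n * k + k) (C * k).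
have -> : INR n * k + k - INR n * k = k by ring.
move=> H; rewrite (_ : C * k ^ 2 = C * k * k); last by ring.
apply: H; first lra; first exact: deriv_within_sub_itv.
move=> t Ht; apply: (Rle_trans _ (C * (t - INR n * k))); last by apply: Rmult_le_compat_l; lra.
have Ht' : itv T t by split; [case: Ha | case: Hb']; lra.
apply: (mean_value _ u2); first lra; first by apply: deriv_within_sub_itv.
by move=> s Hs; apply: Hb; split; [case: Ha | case: Hb']; lra.
Qed.

Variable u3 : R -> V.
Hypothesis Hu2 : forall t, itv T t -> deriv_within (itv T) u2 t (u3 t).

Lemma taylor_order3 : (exists C, 0 <= C /\ forall t, itv T t -> norm (u3 t) <= C) ->
  bigO T (fun k n => minus (minus (u (INR n * k + k)) (u (INR n * k)))
    (plus (scal k (u1 (INR n * k))) (scal (k ^ 2 / 2) (u2 (INR n * k))))) 3.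
Proof.
move=> [C [HC Hb]]; apply: (bigO_bound T _ 3 C) => k n Hv.
have Ha := valid_step_itv0 _ _ _ Hv.
have Hb' : itv T (INR n * k + k).
  by have := valid_step_itv T k n 1 Hv; rewrite Rmult_1_l; apply; lra.
have Hk : 0 < k by case: Hv.
set t0 := INR n * k in Ha Hb' *.
have Hin t : t0 <= t <= t0 + k -> itv T t by split; [case: Ha | case: Hb']; lra.
(* Without its quadratic term at t0, u has the derivative u' - (s - t0) u''(t0), so three nested
   mean value inequalities give C k^3; the factor 1/6 is given away. *)
pose phi s := minus (u s) (scal ((s - t0) ^ 2 / 2) (u2 t0)).
have Hphi t : itv T t -> deriv_within (itv T) phi t (minus (u1 t) (scal (t - t0) (u2 t0))).
  by move=> Ht; apply: deriv_within_minus (Hu t Ht) _; apply: deriv_within_sqr.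
have := mean_value_linear phi _ (u1 t0) t0 (t0 + k) (C * k * k) _
  (deriv_within_sub_itv _ _ _ _ Ha Hb' Hphi).
have -> : t0 + k - t0 = k by ring.
rewrite {1 2}/phi.
have -> : minus (minus (minus (u (t0 + k)) (scal ((t0 + k - t0) ^ 2 / 2) (u2 t0)))
   (minus (u t0) (scal ((t0 - t0) ^ 2 / 2) (u2 t0)))) (scal k (u1 t0)) =
  minus (minus (u (t0 + k)) (u t0)) (plus (scal k (u1 t0)) (scal (k ^ 2 / 2) (u2 t0))).
  by module V; field.
move=> H; rewrite (_ : C * k ^ 3 = C * k * k * k); last by ring.
apply: H; first lra.
move=> t Ht.
have -> : minus (minus (u1 t) (scal (t - t0) (u2 t0))) (u1 t0) =
  minus (minus (u1 t) (u1 t0)) (scal (t - t0) (u2 t0)) by module V.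
apply: (Rle_trans _ (C * k * (t - t0))); last first.
  by apply: Rmult_le_compat_l; [apply: Rmult_le_pos; lra | lra].
have Ht' := Hin t Ht.
apply: (mean_value_linear _ u2); first lra; first exact: deriv_within_sub_itv.
move=> s Hs; apply: (Rle_trans _ (C * (s - t0))); last by apply: Rmult_le_compat_l; lra.
have Hs' : itv T s by apply: Hin; lra.
apply: (mean_value _ u3); first lra; first exact: deriv_within_sub_itv.
by move=> r Hr; apply: Hb; apply: Hin; lra.
Qed.

End TaylorInTime.

(** * The boundary value problem *)

Lemma is_linear_re {X Y : CompleteNormedModule C_AbsRing} (L : X -> Y) :
  is_linear L -> is_linear (U := re_Banach X) (V := re_Banach Y) L.
Proof.
move=> HL; split.
- exact: (linear_plus _ HL).
- by move=> r x; apply: (linear_scal _ HL (RtoC r)).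
- exact: (linear_norm _ HL).
Qed.

Section BoundaryProblem.
Variables X Y : CompleteNormedModule C_AbsRing.
Variables (T : R) (DA : X -> Prop) (A : X -> X) (bd : X -> Y) (E : R -> X -> X) (omega : Rbar).
Variables (f : R -> X -> X) (g : R -> Y) (u0 : X) (u : R -> X).

Let XR := re_Banach X.
Let YR := re_Banach Y.

Hypothesis Hc : continuous_hyp T DA A bd E f u omega g u0.

Let HDA := hp_DA _ _ _ _ _ _ _ _ _ _ _ _ Hc.
Let HA := hp_A _ _ _ _ _ _ _ _ _ _ _ _ Hc.
Let Hbd := hp_bd _ _ _ _ _ _ _ _ _ _ _ _ Hc.
Let HT := hp_T _ _ _ _ _ _ _ _ _ _ _ _ Hc.

Lemma dom_plus x y : DA x -> DA y -> DA (plus x y).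
Proof. by case: HDA => _ [H _]; apply: H. Qed.

Lemma dom_scal (r : R) (x : X) : DA x -> DA (scal r (x : XR)).
Proof. by case: HDA => _ [_ H]; apply: (H (RtoC r)). Qed.

Lemma minus_re (x y : X) : minus x y = plus (x : XR) (scal (-1) (y : XR)).
Proof. by change (minus (x : XR) y = plus (x : XR) (scal (-1) (y : XR))); module XR. Qed.

Lemma dom_minus x y : DA x -> DA y -> DA (minus x y).
Proof. by move=> Hx Hy; rewrite minus_re; apply: dom_plus => //; apply: dom_scal. Qed.

Lemma op_scal (r : R) (x : X) : DA x -> A (scal r (x : XR)) = scal r (A x : XR).
Proof. by case: HA => _ H; apply: (H (RtoC r)). Qed.

Lemma op_minus x y : DA x -> DA y -> A (minus x y) = minus (A x) (A y).
Proof.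
move=> Hx Hy; rewrite !minus_re (proj1 HA) ?op_scal //; exact: dom_scal.
Qed.

Lemma bd_minus x y : DA x -> DA y -> bd (minus x y) = minus (bd x) (bd y).
Proof.
move=> Hx Hy; rewrite minus_re (proj1 Hbd) //; last exact: dom_scal.
rewrite (proj2 Hbd (RtoC (-1)) y Hy).
change (plus (bd x : YR) (scal (-1) (bd y : YR)) = minus (bd x : YR) (bd y)); by module YR.
Qed.

Lemma op_zero : A zero = zero.
Proof.
have := op_minus zero zero (proj1 HDA) (proj1 HDA).
by rewrite !minus_eq_zero.
Qed.

Lemma stable_semigroup_re : exists M a, stable_semigroup (V := XR) E M a.
Proof.
have [HE _] := hp_gen _ _ _ _ _ _ _ _ _ _ _ _ Hc.
have [[Hlb Hglb] Hneg] := hp_type _ _ _ _ _ _ _ _ _ _ _ _ Hc.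
(* The type is an infimum, possibly minus infinity, so a negative exponent is not chosen by formula:
   if none were admissible, 0 would be a lower bound above omega. *)
have [a [[M HM] Ha]] : exists a : R, (exists M, forall t x, 0 <= t ->
    norm (E t x) <= M * exp (a * t) * norm x) /\ a < 0.
  apply: NNPP => Hn.
  have : Rbar_le 0 omega.
    apply: Hglb => a Ha /=; apply: Rnot_lt_le => Ha0; apply: Hn; by exists a.
  by move=> H; apply: (Rbar_lt_not_le _ _ Hneg).
exists (Rabs M), a; split=> //.
- by move=> t Ht; apply: is_linear_re; apply: (sg_linear _ _ HE).
- exact: (sg_0 _ _ HE).
- exact: (sg_add _ _ HE).
- exact: (sg_cont _ _ HE).
- move=> t x Ht; apply: Rle_trans (HM t x Ht) _.
  apply: Rmult_le_compat_r; first exact: norm_ge_0.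
  by apply: Rmult_le_compat_r; [apply: Rlt_le; apply: exp_pos | apply: Rle_abs].
- exact: Rabs_pos.
Qed.

Lemma generator_re x y : generator (V := XR) E x y <-> DA0 DA bd x /\ A x = y.
Proof. by have [_ H] := hp_gen _ _ _ _ _ _ _ _ _ _ _ _ Hc; split=> H'; apply/H. Qed.

(** [iota] selects the intended preimage only under unique existence, which is surjectivity and
    injectivity of the generator. *)
Lemma generator_A0inv y : generator (V := XR) E (A0inv DA A bd y) y.
Proof.
have [M [a HE]] := stable_semigroup_re.
apply/generator_re; apply: (iota_correct (V := X) (fun x => DA0 DA bd x /\ A x = y)).
have [x Hx] := generator_surj _ _ _ HE y.
exists x; split; first by apply/generator_re.
by move=> z /generator_re Hz; apply: (generator_unique _ _ _ HE x z y).
Qed.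

(** [A] need not be closed; the identity below only holds along curves whose boundary values are
    differentiable too.  Subtracting the lifting [K(z) bd v] moves the curve into [D(A_0)], where
    [A_0] has a bounded inverse. *)
Lemma op_deriv (v v1 Av1 : R -> XR) (b1 : R -> YR) t : itv T t ->
  (forall s, itv T s -> DA (v s)) -> DA (v1 t) ->
  deriv_within (itv T) v t (v1 t) ->
  deriv_within (V := XR) (itv T) (fun s => A (v s)) t (Av1 t) ->
  deriv_within (V := YR) (itv T) (fun s => bd (v s)) t (b1 t) ->
  A (v1 t) = Av1 t.
Proof.
move=> Ht Dv Dv1 Hv HAv Hbv.
have [M [a HE]] := stable_semigroup_re.
have HB := generator_A0inv; set B := A0inv DA A bd in HB.
have HL := geninv_linear (V := XR) _ _ _ HE B HB.
have [w0 [Mk [_ HKb]]] := hp_K_bound _ _ _ _ _ _ _ _ _ _ _ _ Hc.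
(* Solvability needs a positive real part and the uniform bound needs one of at least omega_0. *)
set z := Rmax 1 w0.
have Hz1 : 1 <= z by apply: Rmax_l.
have HKz b : exists x, DA x /\ A x = scal z (x : XR) /\ bd x = b.
  have [|x [Hx _]] := hp_K _ _ _ _ _ _ _ _ _ _ _ _ Hc (RtoC z) b; first by rewrite /=; lra.
  by exists x.
pose k b := proj1_sig (constructive_indefinite_description _ (HKz b)).
have Hk b : DA (k b) /\ A (k b) = scal z (k b : XR) /\ bd (k b) = b
  := proj2_sig (constructive_indefinite_description _ (HKz b)).
have Huniq b x : DA x -> A x = scal z (x : XR) -> bd x = b -> k b = x.
  move=> H1 H2 H3.
  have [|y [_ Hy]] := hp_K _ _ _ _ _ _ _ _ _ _ _ _ Hc (RtoC z) b; first by rewrite /=; lra.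
  rewrite -(Hy x) //; apply: eq_sym; apply: Hy; exact: Hk.
have Hklin : is_linear (U := YR) (V := XR) k.
  split.
  - move=> b c; have [H1 [H2 H3]] := Hk b; have [H1' [H2' H3']] := Hk c.
    apply: Huniq; first exact: dom_plus.
      by rewrite (proj1 HA) // H2 H2' -scal_distr_l.
    by rewrite (proj1 Hbd) // H3 H3'.
  - move=> r b; have [H1 [H2 H3]] := Hk b.
    apply: Huniq; first exact: dom_scal.
      by rewrite op_scal // H2; module XR.
    by rewrite (proj2 Hbd (RtoC r)) // H3.
  - exists (Rabs Mk + 1); split; first by have := Rabs_pos Mk; lra.
    move=> b; have [H1 [H2 H3]] := Hk b.
    have := HKb (RtoC z) b (k b) _ _ H1 H2 H3; rewrite /= => H.
    apply: Rle_trans (H _ (Rmax_r _ _)) _; first lra.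
    apply: Rmult_le_compat_r; first exact: norm_ge_0.
    by have := Rle_abs Mk; lra.
have [K1 [K2 K3]] := Hk (b1 t).
(* The curve minus its lifting has zero boundary values, so it lies in D(A_0) and equals [B] applied
   to [Aw]; a derivative can then be taken through the bounded operator [B]. *)
pose w s : XR := minus (v s) (k (bd (v s))).
pose Aw s : XR := minus (A (v s) : XR) (scal z (k (bd (v s)) : XR)).
have Hkv : deriv_within (V := XR) (itv T) (fun s => k (bd (v s))) t (k (b1 t)).
  exact: (deriv_within_linear (V := YR) (W := XR)).
have Hw : deriv_within (V := XR) (itv T) w t (minus (v1 t) (k (b1 t))).
  exact: deriv_within_minus.
have HAw : deriv_within (V := XR) (itv T) Aw t (minus (Av1 t) (scal z (k (b1 t) : XR))).
  by apply: deriv_within_minus => //; apply: deriv_within_scal.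
have Ew s : itv T s -> B (Aw s) = w s.
  move=> Hs; have [H1 [H2 H3]] := Hk (bd (v s)); have Ds := Dv s Hs.
  apply: (generator_unique (V := XR) _ _ _ HE _ _ _ (HB _)); apply/generator_re.
  split; last by rewrite /w op_minus // H2.
  by split; [apply: dom_minus | rewrite bd_minus // H3 minus_eq_zero].
have HBw : deriv_within (V := XR) (itv T) w t (B (minus (Av1 t) (scal z (k (b1 t) : XR)))).
  apply: (deriv_within_ext (V := XR) _ (fun s => B (Aw s))) => //.
  exact: (deriv_within_linear (V := XR) (W := XR)).
(* The two derivatives of [w] agree, so v1 - k b1 is B of Av1 - z k b1; applying A and cancelling
   the lifting gives the claim. *)
have HT' := HT; have Heq := deriv_within_unique 0 T w t _ _ HT' Ht Hw HBw.
have := HB (minus (Av1 t) (scal z (k (b1 t) : XR))); rewrite -Heq => /generator_re [_].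
rewrite op_minus // K2 => H.
have -> : A (v1 t) = plus (minus (A (v1 t) : XR) (scal z (k (b1 t) : XR)))
  (scal z (k (b1 t) : XR)) by module XR.
by rewrite H; module XR.
Qed.

Lemma deriv_solution t : itv T t ->
  deriv_within (V := XR) (itv T) u t (plus (A (u t) : XR) (f t (u t))).
Proof.
move=> Ht; have [_ H] := hp_sol _ _ _ _ _ _ _ _ _ _ _ _ Hc t Ht.
exact: (frechet_of_filterdiff (U := R_NormedModule) (V := XR)).
Qed.

(** * Duhamel form of the stages and of the local error *)

Section Propagators.
Variables M a : R.
Hypothesis HE : stable_semigroup (V := XR) E M a.

Lemma duhamel_zero phi s : 0 <= s -> (forall t : R, continuous phi t) ->
  duhamel (V := XR) E phi s zero = zero.
Proof.
move=> Hs Hphi.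
have H : is_RInt (V := XR) (fun tau => E (s - tau) (scal (phi tau) (zero : XR))) 0 s
    (scal (s - 0) (zero : XR)).
  apply: (is_RInt_ext (V := XR) (fun _ => zero)); last exact: is_RInt_const.
  move=> t; rewrite Rmin_left // Rmax_right // => Ht.
  rewrite (scal_zero_r (V := XR)) (linear_zero (U := XR) (V := XR)) //.
  by apply: (ss_linear _ _ _ HE); lra.
rewrite -[RHS](scal_zero_r (V := XR) (s - 0 : R_Ring)); exact: (is_RInt_unique (V := XR)).
Qed.

(** When psi starts at v0 the orbit term vanishes and only the integral of A psi - psi' remains. *)
Lemma lin_sol_duhamel v0 psi dpsi phi (w : X) s : 0 <= s -> psi 0 = v0 ->
  (forall tau, 0 < tau < s -> minus (A (psi tau)) (dpsi tau) = scal (phi tau) (w : XR)) ->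
  lin_sol X A E v0 psi dpsi s = plus (psi s) (duhamel (V := XR) E phi s w).
Proof.
move=> Hs H0 H; rewrite /lin_sol H0 minus_eq_zero.
rewrite (linear_zero (U := XR) (V := XR) _ (ss_linear _ _ _ HE s Hs)) plus_zero_r.
congr plus; apply: (RInt_ext (V := XR)) => t; rewrite Rmin_left // Rmax_right // => Ht.
by rewrite H.
Qed.

Lemma lin_sol_homogeneous (v0 : X) s : 0 <= s ->
  lin_sol X A E v0 (fun _ => zero) (fun _ => zero) s = E s v0.
Proof.
move=> Hs; rewrite /lin_sol minus_zero_r plus_zero_l op_zero minus_eq_zero.
rewrite -[RHS](plus_zero_r (E s v0)); congr plus.
have -> : RInt (V := XR) (fun tau => E (s - tau) zero) 0 s = duhamel (V := XR) E (fun _ => 1) s zero.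
  by apply: (RInt_ext (V := XR)) => t _; rewrite (scal_zero_r (V := XR)).
by apply: duhamel_zero => // t; apply: continuous_const.
Qed.

Lemma lin_sol_constant (v0 : X) s : 0 <= s ->
  lin_sol X A E v0 (fun _ => v0) (fun _ => zero) s =
  plus (v0 : XR) (duhamel (V := XR) E (fun _ => 1) s (A v0)).
Proof.
move=> Hs; apply: lin_sol_duhamel => // tau _.
by rewrite minus_zero_r (scal_one (V := XR)).
Qed.

(** The corrected boundary data pays off here: A psi - psi' is tau A^2 v0, because the constant term
    A v0 cancels, and its integral is of order 2 instead of 1. *)
Lemma lin_sol_affine (v0 : X) s : 0 <= s -> DA v0 -> DA (A v0) ->
  lin_sol X A E v0 (fun s => plus v0 (scal (RtoC s) (A v0))) (fun _ => A v0) s =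
  plus (plus (v0 : XR) (scal s (A v0 : XR))) (duhamel (V := XR) E (fun tau => tau) s (A (A v0))).
Proof.
move=> Hs D1 D2; apply: lin_sol_duhamel => //.
  change (plus (v0 : XR) (scal 0 (A v0 : XR)) = v0); by module XR.
move=> tau _; rewrite (proj1 HA) //; last exact: (dom_scal tau).
rewrite (op_scal tau) //.
change (minus (plus (A v0 : XR) (scal tau (A (A v0) : XR))) (A v0) = scal tau (A (A v0) : XR)).
by module XR.
Qed.

Lemma lin_sol_source (v0 w : X) s : 0 <= s ->
  lin_sol X A E v0 (fun _ => w) (fun _ => zero) s =
  plus (plus (w : XR) (E s (minus v0 w))) (duhamel (V := XR) E (fun _ => 1) s (A w)).
Proof.
move=> Hs; rewrite /lin_sol; congr plus; apply: (RInt_ext (V := XR)) => t _.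
by rewrite minus_zero_r (scal_one (V := XR)).
Qed.

Variable rk : tableau.
Hypothesis Hrk : tableau_hyp rk.

Lemma KbarE k n : 0 < k -> forall i, (1 <= i <= rk_s rk)%nat ->
  Kbar X A E f u rk k n i =
  plus (plus (u (INR n * k) : XR)
         (duhamel (V := XR) E (fun _ => 1) (rk_c rk i * k) (A (u (INR n * k)))))
    (scal k (sum_n_m (fun j => scal (rk_a rk i j)
       (E ((rk_c rk i - rk_c rk j) * k)
          (f (INR n * k + rk_c rk j * k) (Kbar X A E f u rk k n j)) : XR)) 1 (i - 1))).
Proof.
move=> Hk i Hi; rewrite {1}/Kbar stageE; last by case: Hi.
have Hci := rk_c_range _ Hrk i Hi.
rewrite lin_sol_constant; last by apply: Rmult_le_pos; lra.
congr plus; congr scal; apply: sum_n_m_ext_loc => j Hj.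
case: (Req_dec (rk_a rk i j) 0) => [->|Ha]; first by rewrite !(scal_zero_l (V := XR)).
congr scal; rewrite lin_sol_homogeneous //.
by apply: Rmult_le_pos; [apply: rk_c_sub_ge0 | lra].
Qed.

Lemma local_errorE k n : 0 < k -> DA (u (INR n * k)) -> DA (A (u (INR n * k))) ->
  local_error A E f u rk k n =
  minus
    (plus (plus (plus (u (INR n * k) : XR) (scal k (A (u (INR n * k)) : XR)))
                (duhamel (V := XR) E (fun tau => tau) k (A (A (u (INR n * k))))))
      (scal k (sum_n_m (fun i => scal (rk_b rk i)
         (plus (plus (f (INR n * k) (u (INR n * k)) : XR) (E ((1 - rk_c rk i) * k)
                  (minus (f (INR n * k + rk_c rk i * k) (Kbar X A E f u rk k n i))
                     (f (INR n * k) (u (INR n * k))))))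
               (duhamel (V := XR) E (fun _ => 1) ((1 - rk_c rk i) * k)
                  (A (f (INR n * k) (u (INR n * k))))))) 1 (rk_s rk))))
    (u (INR (S n) * k)).
Proof.
move=> Hk D1 D2; rewrite /local_error /ubar (lin_sol_affine _ _ (Rlt_le _ _ Hk) D1 D2).
congr (minus (plus _ (scal _ _)) _); apply: sum_n_m_ext_loc => i Hi.
congr (scal _ _); apply: lin_sol_source.
by have := rk_c_range _ Hrk i Hi => Hci; apply: Rmult_le_pos; lra.
Qed.

End Propagators.
End BoundaryProblem.

(** * The local error under the regularity hypotheses on the solution *)

Lemma continuous_into_DAl2 {X : CompleteNormedModule C_AbsRing} T (DA : X -> Prop) (A : X -> X)
    (u : R -> X) :
  (forall x y, DA x -> DA y -> A (minus x y) = minus (A x) (A y)) ->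
  continuous_into_DAl T DA A 2 u ->
  (forall t, itv T t -> DA (u t) /\ DA (A (u t))) /\
  continuous_within (V := re_Banach X) (itv T) (fun t => A (A (u t))).
Proof.
move=> HA [HD HC].
have HD' t : itv T t -> DA (u t) /\ DA (A (u t)).
  by move=> Ht; split; [apply: (HD t Ht 0%nat) | apply: (HD t Ht 1%nat)]; lia.
split=> // t Ht eps He; have [d [Hd K]] := HC t Ht eps He.
exists d; split=> // s Hs Hst; have [D1 D2] := HD' t Ht; have [D3 D4] := HD' s Hs.
apply: Rle_lt_trans (K s Hs Hst).
rewrite /graph_norm !sum_Sn sum_O /= !HA // /plus /=.
have N x : 0 <= norm (x : X) by apply: norm_ge_0.
have N1 := N (minus (u s) (u t)); have N2 := N (minus (A (u s)) (A (u t))).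
rewrite -[X in X <= _]Rplus_0_l; apply: Rplus_le_compat_r; lra.
Qed.

Section LocalError.
Variables X Y : CompleteNormedModule C_AbsRing.
Variables (T : R) (DA : X -> Prop) (A : X -> X) (bd : X -> Y) (E : R -> X -> X) (omega : Rbar).
Variables (f : R -> X -> X) (g : R -> Y) (u0 : X) (u : R -> X) (rk : tableau).

Let XR := re_Banach X.
Let YR := re_Banach Y.

Hypothesis Hc : continuous_hyp T DA A bd E f u omega g u0.
Hypothesis Hrk : tableau_hyp rk.
Hypothesis Df : forall t, itv T t -> DA (f t (u t)).
Hypothesis HAf : class_C (V := XR) 0 (itv T) (fun t => A (f t (u t))).
Hypothesis Hu2 : continuous_into_DAl T DA A 2 u.
Hypothesis Cu2 : class_C (V := XR) 2 (itv T) u.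

Let rho := local_error A E f u rk.
Let Au t : XR := A (u t).
Let A2u t : XR := A (A (u t)).
Let Af t : XR := A (f t (u t)).
Let K := Kbar X A E f u rk.

Lemma velocityE (u1 : R -> XR) : (forall t, itv T t -> deriv_within (itv T) (u : R -> XR) t (u1 t)) ->
  forall t, itv T t -> u1 t = plus (Au t) (f t (u t) : XR).
Proof.
move=> H t Ht; have HT := hp_T _ _ _ _ _ _ _ _ _ _ _ _ Hc.
apply: (deriv_within_unique (V := XR) 0 T u t) => //; first exact: H.
exact: (deriv_solution _ _ _ _ _ _ _ _ _ _ _ _ Hc).
Qed.

Lemma bounded_along_solution :
  (exists C, 0 <= C /\ forall t, itv T t -> norm (Au t) <= C) /\
  (exists C, 0 <= C /\ forall t, itv T t -> norm (A2u t) <= C) /\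
  (exists C, 0 <= C /\ forall t, itv T t -> norm (f t (u t) : XR) <= C) /\
  (exists C, 0 <= C /\ forall t, itv T t -> norm (Af t) <= C).
Proof.
have HAu : exists C, 0 <= C /\ forall t, itv T t -> norm (Au t) <= C.
  by apply: (itv_bounded (V := XR)); apply: class_C0_continuous;
    exact: (hp_Au _ _ _ _ _ _ _ _ _ _ _ _ Hc).
split=> //; split; [|split].
- apply: (itv_bounded (V := XR)).
  by apply: (proj2 (continuous_into_DAl2 _ _ _ _ _ Hu2)) => x y; apply: (op_minus _ _ _ _ _ _ _ _ _ _ _ _ Hc).
(* Along the solution [f] equals u' - A u, a difference of two bounded functions. *)
- have [u1 [H1 H1']] := class_C_deriv (V := XR) _ _ _ Cu2.
  have [u2 [H2 _]] := class_C_deriv (V := XR) _ _ _ H1'.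
  have [C [HC Hb]] := itv_bounded (V := XR) _ _ (deriv_within_continuous_within _ _ _ H2).
  have [C' [HC' Hb']] := HAu.
  exists (C + C'); split=> [|t Ht]; first lra.
  have -> : (f t (u t) : XR) = minus (u1 t) (Au t).
    by rewrite (velocityE u1 H1 t Ht); module XR.
  by apply: norm_minus_le; [apply: Hb | apply: Hb'].
- by apply: (itv_bounded (V := XR)); apply: class_C0_continuous.
Qed.

Lemma domain_along_solution t : itv T t -> DA (u t) /\ DA (A (u t)).
Proof.
move=> Ht; apply: (proj1 (continuous_into_DAl2 _ _ _ _ _ Hu2)) => // x y.
exact: (op_minus _ _ _ _ _ _ _ _ _ _ _ _ Hc).
Qed.

Lemma local_error_bigO2 : bigO (V := XR) T rho 2.
Proof.
have [u1 [H1 H1']] := class_C_deriv (V := XR) _ _ _ Cu2.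
have [u2 [H2 H2']] := class_C_deriv (V := XR) _ _ _ H1'.
have [M [a HE]] := stable_semigroup_re _ _ _ _ _ _ _ _ _ _ _ _ Hc.
have [B1 [B2 [B3 B4]]] := bounded_along_solution.
apply: (local_error_order2 (V := XR) T M a E rk f u Au A2u Af u1 K rho HE Hrk B1 B2 B3 B4).
- exact: velocityE.
- exact: (class_C1_near_curve (V := XR) T f u u1 H1 (hp_f _ _ _ _ _ _ _ _ _ _ _ _ Hc)).
- move=> k n [Hk _]; exact: (KbarE _ _ _ _ _ _ _ _ _ _ _ _ Hc _ _ HE _ Hrk).
- move=> k n Hv; have [D1 D2] := domain_along_solution _ (valid_step_itv0 _ _ _ Hv).
  exact: (local_errorE _ _ _ _ _ _ _ _ _ _ _ _ Hc _ _ HE _ Hrk _ _ (proj1 Hv) D1 D2).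
- apply: (taylor_order2 T (u : R -> XR) u1 u2 H1 H2).
  by apply: itv_bounded; apply: class_C0_continuous.
Qed.

Lemma inv_local_error_bigO3 (fu : R -> X -> X -> X) :
  class_C_f T f 2 -> class_C (V := XR) 3 (itv T) u -> partial_u T f fu ->
  (exists M, forall w t, DA0 DA bd w -> itv T t ->
     norm (A0inv DA A bd (fu t (u t) (A w))) <= M * norm w) ->
  classical_order_ge rk 2 ->
  bigO (V := XR) T (fun k n => A0inv DA A bd (rho k n)) 3.
Proof.
move=> Cf Cu3 Hfu [Mf HMf] Hord.
have [u1 [H1 H1']] := class_C_deriv (V := XR) _ _ _ Cu3.
have [u2 [H2 H2']] := class_C_deriv (V := XR) _ _ _ H1'.
have [u3 [H3 H3']] := class_C_deriv (V := XR) _ _ _ H2'.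
have [M [a HE]] := stable_semigroup_re _ _ _ _ _ _ _ _ _ _ _ _ Hc.
have HB := generator_A0inv _ _ _ _ _ _ _ _ _ _ _ _ Hc.
have [B1 [B2 [B3 B4]]] := bounded_along_solution.
have [dF [HdF Htay]] := class_C2_near_curve (V := XR) T f u u1 H1 Cf.
(* The partial derivatives in time and state, read off from the total derivative that the Taylor
   estimate uses. *)
pose ft t : XR := dF (t, u t) (1, zero).
pose fv t (w : XR) : XR := dF (t, u t) (0, w).
have HdFl t : itv T t -> is_linear (V := XR) (dF (t, u t)).
  by move=> Ht; apply: (proj1 (HdF (t, u t) Ht)).
have dFE t s (w : XR) : itv T t -> dF (t, u t) (s, w) = plus (scal s (ft t)) (fv t w).
  move=> Ht; rewrite /ft /fv -(linear_scal _ (HdFl t Ht)) -(linear_plus _ (HdFl t Ht)).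
  congr (dF _ _); rewrite /plus /scal /= /prod_plus /prod_scal /= /plus /scal /= /mult /=.
  congr (_, _); first by rewrite Rmult_1_r Rplus_0_r.
  by change (w = plus (scal s (zero : XR)) w); module XR.
have Hfvl t : itv T t -> is_linear (U := XR) (V := XR) (fv t).
  move=> Ht; apply: (is_linear_comp (fun w : XR => (0, w)) _ _ (HdFl t Ht)).
  exact: (is_linear_prod (T := XR) (U := R_NormedModule) (V := XR)
    _ _ is_linear_zero is_linear_id).
(* The bound with A_0^{-1} is assumed for the given [fu]; uniqueness of the derivative transfers it
   to [fv]. *)
have fvE t (w : XR) : itv T t -> fv t w = fu t (u t) w.
  move=> Ht; apply: (frechet_linear_unique (U := XR) (V := XR) (f t) (fv t) _ (u t)).
  - exact: Hfvl.
  - by case: (Hfu t (u t) Ht).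
  - exact: (frechet_partial (V := XR) T f _ _ _ Ht (proj2 (HdF (t, u t) Ht))).
  - exact: (frechet_of_filterdiff_locally (U := XR) (V := XR) _ _ _ (Hfu t (u t) Ht)).
apply: (inv_local_error_order3 (V := XR) T M a E (A0inv DA A bd) rk f u Au A2u Af u1 K rho HE HB Hrk
  B1 B2 B3 B4 _ _ _ _ ft u2 fv Hfvl).
- exact: velocityE.
- exact: (class_C1_near_curve (V := XR) T f u u1 H1 (hp_f _ _ _ _ _ _ _ _ _ _ _ _ Hc)).
- move=> k n [Hk _]; exact: (KbarE _ _ _ _ _ _ _ _ _ _ _ _ Hc _ _ HE _ Hrk).
- move=> k n Hv; have [D1 D2] := domain_along_solution _ (valid_step_itv0 _ _ _ Hv).
  exact: (local_errorE _ _ _ _ _ _ _ _ _ _ _ _ Hc _ _ HE _ Hrk _ _ (proj1 Hv) D1 D2).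
(* Any y is A (B y) with B y in D(A_0), so the hypothesis applies with w = B y. *)
- exists (Rabs Mf); split=> [|t y Ht]; first exact: Rabs_pos.
  have [Dy Ey] := proj1 (generator_re _ _ _ _ _ _ _ _ _ _ _ _ Hc _ _) (HB y).
  rewrite fvE // -{1}Ey; apply: Rle_trans (HMf _ _ Dy Ht) _.
  by apply: Rmult_le_compat_r; [apply: norm_ge_0 | apply: Rle_abs].
- have [r [L [Hr [HL Ht]]]] := Htay; exists r, L; split=> //; split=> // t It s v Hs Hst Hv.
  by have := Ht t It s v Hs Hst Hv; rewrite dFE.
- move=> t Ht.
  have [D1 D2] := domain_along_solution t Ht.
  have Hf0 : deriv_within (V := XR) (itv T) (fun s => f s (u s)) t (plus (ft t) (fv t (u1 t))).
    have -> : plus (ft t) (fv t (u1 t)) = dF (t, u t) (1, u1 t).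
      by rewrite dFE // (scal_one (V := XR)).
    apply: (deriv_within_comp (V := XR) (fun q => itv T (fst q)) (itv T)
      (fun q : prod_NormedModule R_AbsRing R_NormedModule XR => f (fst q) (snd q)) _
      (fun s => (s, u s))) => //.
    - exact: HdFl.
    - exact: (proj2 (HdF (t, u t) Ht)).
    - exact: (deriv_within_graph (V := XR) (itv T) u t _ (H1 t Ht)).
  (* A is not continuous, so A u is differentiated through the equation, as u' - f(t,u). *)
  have HAu : deriv_within (V := XR) (itv T) (fun s => A (u s)) t
      (minus (u2 t) (plus (ft t) (fv t (u1 t)))).
    apply: (deriv_within_ext (V := XR) _ (fun s => minus (u1 s) (f s (u s) : XR))) => //.
      by move=> s Hs; rewrite (velocityE u1 H1 s Hs) -/(Au s); module XR.
    by apply: deriv_within_minus => //; apply: H2.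
  have [g1 [Hg1 _]] := class_C_deriv (V := YR) _ _ _ (hp_g _ _ _ _ _ _ _ _ _ _ _ _ Hc).
  (* u' = A u + f lies in D(A) by both domain hypotheses, and the boundary values g are C^1; these
     are the conditions for A to commute with the derivative. *)
  have HA1 : A (u1 t) = minus (u2 t) (plus (ft t) (fv t (u1 t))).
    apply: (op_deriv _ _ _ _ _ _ _ _ _ _ _ _ Hc u u1
      (fun t => minus (u2 t) (plus (ft t) (fv t (u1 t)))) g1 t Ht) => //.
    - by move=> s /domain_along_solution [].
    - rewrite (velocityE u1 H1 t Ht).
      by apply: (dom_plus _ _ _ _ _ _ _ _ _ _ _ _ Hc) => //; apply: Df.
    - exact: H1.
    - apply: (deriv_within_ext (V := YR) _ g) => //; last exact: Hg1.
      by move=> s Hs; rewrite (hp_bc _ _ _ _ _ _ _ _ _ _ _ _ Hc s Hs).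
  have -> : u2 t = plus (minus (u2 t) (plus (ft t) (fv t (u1 t)))) (plus (ft t) (fv t (u1 t)))
    by module XR.
  rewrite -HA1 {1}(velocityE u1 H1 t Ht); congr plus.
  by apply: (proj1 (hp_A _ _ _ _ _ _ _ _ _ _ _ _ Hc)) => //; apply: Df.
- exact: classical_order2_condition.
- apply: (taylor_order3 T (u : R -> XR) u1 u2 H1 H2 u3 H3).
  by apply: itv_bounded; apply: class_C0_continuous.
Qed.

End LocalError.

Theorem theorem10
  (d : nat) (Omega : bounded_domain d) (Y : CompleteNormedModule C_AbsRing)
  (T : R) (DA : CX Omega -> Prop) (A : CX Omega -> CX Omega)
  (bd : CX Omega -> Y) (E : R -> CX Omega -> CX Omega) (omega : Rbar)
  (f : R -> CX Omega -> CX Omega) (g : R -> Y)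
  (u0 : CX Omega) (u : R -> CX Omega)
  (D : discretization d Omega Y) (rk : tableau) :
  (1 <= d)%nat ->
  continuous_hyp T DA A bd E f u omega g u0 ->
  discretization_hyp D T DA A bd E f u ->
  tableau_hyp rk ->
  (forall t, itv T t -> DA (f t (u t))) ->
  class_C (V := re_Banach (CX Omega)) 0 (itv T) (fun t => A (f t (u t))) ->
  continuous_into_DAl T DA A 2 u ->
  class_C (V := re_Banach (CX Omega)) 2 (itv T) u ->
  let rho := local_error A E f u rk in
  step_bigO T rho 2 /\
  (class_C_f T f 2 ->
   class_C (V := re_Banach (CX Omega)) 3 (itv T) u ->
   forall fu : R -> CX Omega -> CX Omega -> CX Omega,
   partial_u T f fu ->
   (exists M, forall w t, DA0 DA bd w -> itv T t ->
      norm (A0inv DA A bd (fu t (u t) (A w))) <= M * norm w) ->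
   classical_order_ge rk 2 ->
   step_bigO T (fun k n => A0inv DA A bd (rho k n)) 3).
Proof.
move=> _ Hc _ Hrk Df HAf Hu2 Cu2 rho; split.
  exact (local_error_bigO2 (CX Omega) Y _ _ _ _ _ _ _ _ _ _ _ Hc Hrk HAf Hu2 Cu2).
move=> Cf Cu3 fu Hfu HM Hord.
exact (inv_local_error_bigO3 (CX Omega) Y _ _ _ _ _ _ _ _ _ _ _ Hc Hrk Df HAf Hu2 Cu2
  fu Cf Cu3 Hfu HM Hord).
Qed.
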